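(* Let $T>0$, $\theta_1,\theta_2>0$, and for each $n\in\mathbb N$ let the observation times of $X$ and of $Y$ be the arrival times of two homogeneous Poisson processes $\tilde n^{(n)}$ and $\tilde m^{(n)}$ that are mutually independent and independent of the processes $X$ and $Y$, with parameters $Tn/\theta_1$ and $Tn/\theta_2$, such that the waiting times between jumps are exponentially distributed with expectations $\theta_1/n$ and $\theta_2/n$, respectively. Let $G^N,F^N,H^N$ be the quadratic (co-)variations of times defined in the context, with $N=\tilde N(T)^{(n)}$. Then for $t\in[0,T]$, as $n\to\infty$, $$G^N(t)\stackrel{p}{\longrightarrow}2\left(1-\frac{2\theta_1^2\theta_2^2}{\theta_1^2\theta_2^2+(\theta_1^2+\theta_2^2)(\theta_1+\theta_2)^2}\right)\frac tT\qquad\left(=\frac{14}{9}\frac tT\ \text{ if }\theta_1=\theta_2=\theta\right),$$ $$F^N(t)\stackrel{p}{\longrightarrow}\left(\frac{2\theta_1\theta_2}{\theta_1^2+\theta_1\theta_2+\theta_2^2}+\frac{4\theta_1^2\theta_2^2}{\left(\theta_1+\theta_2-\frac{\theta_1\theta_2}{\theta_1+\theta_2}\right)^2(\theta_1+\theta_2)^2}\right)\frac tT\qquad\left(=\frac{10}{9}\frac tT\ \text{ if }\theta_1=\theta_2=\theta\right),$$ $$H^N(t)\stackrel{p}{\longrightarrow}2\left(\frac{1}{\left(\theta_1+\theta_2-\frac{\theta_1\theta_2}{\theta_1+\theta_2}\right)^2}\,\frac{\theta_1^2\theta_2^2}{(\theta_1+\theta_2)^2}\right)\frac tT\qquad\left(=\frac{2}{9}\frac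 tT\ \text{ if }\theta_1=\theta_2=\theta\right).$$
   Context: $X$ and $Y$ are two continuous semimartingales observed at discrete times on $[0,T]$. For each $n$, let $t_0<t_1<\dots$ and $\tau_0<\tau_1<\dots$ be the arrival times of the two Poisson processes, i.e. the observation times of $X$ and $Y$ (superscripts $(n)$ omitted). Almost surely no $t_i$ equals a $\tau_j$. **Synchronization algorithm.** Put $q_0=r_0=0$. In step $i=0,1,2,\dots$, given $q_i,r_i$: (a) if $t_{q_i}<\tau_{r_i}$: $\mu_i=\min\{w\ge q_i+1: \tau_{r_i}\le t_w\}$, $w_i=r_i$; $r_{i+1}=r_i+1$; $q_{i+1}=\mu_i+1$ if $\tau_{r_i}=t_{\mu_i}$ and $q_{i+1}=\mu_i$ if $\tau_{r_i}<t_{\mu_i}$; (b) if $t_{q_i}=\tau_{r_i}$: $\mu_i=q_i$, $w_i=r_i$, $q_{i+1}=q_i+1$, $r_{i+1}=r_i+1$; (c) if $t_{q_i}>\tau_{r_i}$: $w_i=\min\{l\ge r_i+1: t_{q_i}\le\tau_l\}$, $\mu_i=q_i$; $q_{i+1}=q_i+1$; $r_{i+1}=w_i+1$ if $t_{q_i}=\tau_{w_i}$ and $r_{i+1}=w_i$ if $t_{q_i}<\tau_{w_i}$. Put $g_i=t_{\mu_i}$, $\gamma_i=\tau_{w_i}$ ($i\ge0$), $l_i=t_{q_i-1}$, $\lambda_i=\tau_{r_i-1}$ ($i\ge1$), $l_0=t_0$, $\lambda_0=\tau_0$, $T_i=\min(g_i,\gamma_i)$ (strictly increasing), $\Delta T_i=T_i-T_{i-1}$.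 Let $\tilde N(T)^{(n)}=\max\{k: T_k\le T\}$. **Quadratic (co-)variations of times.** With $N=\tilde N(T)^{(n)}$ and $t\in[0,T]$ (sums over $i\ge1$): $$G^N(t)=\frac NT\sum_{T_i\le t}(\Delta T_i)^2,$$ $$F^N(t)=\frac NT\sum_{T_{i+1}\le t}\big[(T_i-\lambda_i)(g_i-T_i)+(T_i-l_i)(\gamma_i-T_i)+\Delta T_{i+1}(T_i-l_{i+1})+\Delta T_{i+1}(T_i-\lambda_{i+1})\big],$$ $$H^N(t)=\frac NT\sum_{T_{i+1}\le t}\big[(T_i-l_{i+1})(g_i-T_i)+(T_i-\lambda_{i+1})(\gamma_i-T_i)\big].$$ $\stackrel{p}{\longrightarrow}$ denotes convergence in probability.
   Formalization: The three limits are proved with factor t in place of t/T: with prefactor N/T the printed limits are false for T≠1, t>0 (e.g. G^N(T) is asymptotically at least T, while the printed limit at t=T is below 2); all printed constants are kept, and at T=1 the two forms agree. *)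

(* Defs.v *)
From mathcomp Require Import all_boot all_order all_algebra finmap.
From mathcomp Require Import all_classical all_reals all_analysis.

Set Implicit Arguments.
Unset Strict Implicit.
Unset Printing Implicit Defensive.

Import Order.TTheory GRing.Theory Num.Theory.
Import numFieldNormedType.Exports.

Local Open Scope classical_set_scope.
Local Open Scope ring_scope.

Section Probability.
Context (R : realType) (d : measure_display) (Omega : measurableType d).
Variable P : probability Omega R.

Definition cvg_in_probability (Z : nat -> Omega -> R) (c : R) : Prop :=
  forall eps : R, 0 < eps ->
    (fun n => P [set w | eps <= `|Z n w - c|]) @ \oo --> 0%E.

Definition mutually_independent (I : choiceType) (G : I -> set (set Omega)) :
    Prop :=
  forall (J : {fset I}) (E : I -> set Omega),
    (forall i, i \in J -> G i (E i)) ->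
    P (\bigcap_(i in [set` J]) E i) = (\prod_(i <- J) P (E i))%E.

Definition generated_by_var (Z : Omega -> R) : set (set Omega) :=
  preimage_set_system setT Z measurable.

Definition generated_by_process (I : Type) (D : set I) (Z : I -> Omega -> R) :
    set (set Omega) :=
  <<s \bigcup_(i in D) generated_by_var (Z i) >>.

(* Waiting times of a point process on [0, +oo[ with arrival times
   a 0 <= a 1 <= ...; the first one is the waiting time from time 0. *)
Definition waiting_time (a : nat -> Omega -> R) (k : nat) (w : Omega) : R :=
  if k is k'.+1 then a k w - a k' w else a 0%N w.

(* The arrival times of a homogeneous Poisson process whose waiting times have
   expectation m, i.e. of intensity m^-1 per unit of time (a Poisson process
   with T / m expected arrivals in [0, T]). *)
Definition poisson_arrival_times (m : R) (a : nat -> Omega -> R) : Prop :=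
  [/\ forall k, measurable_fun setT (a k),
      mutually_independent (fun k => generated_by_var (waiting_time a k))
    & forall k (B : set R), measurable B ->
        P (waiting_time a k @^-1` B) = exponential_prob m^-1 B].

End Probability.

(* Continuous semimartingales on the time interval [0, T]: processes which are
   almost surely equal to X_0 + M + A with M a continuous local martingale and A
   a continuous adapted process of finite variation, both null at time 0. *)
Section Semimartingale.
Context (R : realType) (d : measure_display) (Omega : measurableType d).
Variables (P : probability Omega R) (T : R).

Definition filtration (Fi : R -> set (set Omega)) : Prop :=
  [/\ forall s, 0 <= s <= T -> sigma_algebra setT (Fi s),
      forall s, 0 <= s <= T -> Fi s `<=` measurable
    & forall r s, 0 <= r -> r <= s -> s <= T -> Fi r `<=` Fi s].

Definition continuous_process (Z : R -> Omega -> R) : Prop :=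
  {ae P, forall w, {within `[0, T], continuous (fun s => Z s w)}}.

Variable Fi : R -> set (set Omega).

Definition adapted (Z : R -> Omega -> R) : Prop :=
  forall s, 0 <= s <= T -> generated_by_var (Z s) `<=` Fi s.

Definition martingale (M : R -> Omega -> R) : Prop :=
  [/\ adapted M,
      forall s, 0 <= s <= T -> P.-integrable setT (EFin \o M s)
    & forall r s (E : set Omega), 0 <= r -> r <= s -> s <= T -> Fi r E ->
        (\int[P]_(w in E) (M s w)%:E = \int[P]_(w in E) (M r w)%:E)%E].

Definition stopping_time (sigma : Omega -> R) : Prop :=
  (forall w, 0 <= sigma w <= T) /\
  (forall s, 0 <= s <= T -> Fi s [set w | sigma w <= s]).

Definition stopped (sigma : Omega -> R) (Z : R -> Omega -> R)
    (s : R) (w : Omega) : R :=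
  Z (Num.min s (sigma w)) w.

(* On the compact time interval [0, T], a localizing sequence almost surely
   reaches T after finitely many steps. *)
Definition local_martingale (M : R -> Omega -> R) : Prop :=
  exists sigma : nat -> Omega -> R,
    [/\ forall k, stopping_time (sigma k),
        {ae P, forall w, {homo sigma ^~ w : j k / (j <= k)%N >-> j <= k}},
        {ae P, forall w, \forall k \near \oo, sigma k w = T}
      & forall k, martingale (stopped (sigma k) M)].

Definition continuous_semimartingale (X : R -> Omega -> R) : Prop :=
  [/\ adapted X, continuous_process X &
   exists M A : R -> Omega -> R,
    [/\ [/\ adapted M, continuous_process M & local_martingale M],
        [/\ adapted A, continuous_process A &
            {ae P, forall w, bounded_variation 0 T (fun s => A s w)}],
        {ae P, forall w, M 0 w = 0 /\ A 0 w = 0}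
      & {ae P, forall w, forall s, 0 <= s <= T ->
                           X s w = X 0 w + M s w + A s w}]].

End Semimartingale.

(* Junk value 0 if A is empty. *)
Definition least (A : set nat) : nat :=
  xget 0%N [set k | A k /\ forall j, A j -> (k <= j)%N].

(* Junk value 0 if A is empty or unbounded. *)
Definition greatest (A : set nat) : nat :=
  xget 0%N [set k | A k /\ forall j, A j -> (j <= k)%N].

(* Synchronization of two sequences t, tau of observation times. *)
Section Synchronization.
Context (R : realType).
Variables t tau : nat -> R.

Definition step_mu (q r : nat) : nat :=
  if t q < tau r then least [set k | (q.+1 <= k)%N /\ tau r <= t k] else q.

Definition step_w (q r : nat) : nat :=
  if tau r < t q then least [set k | (r.+1 <= k)%N /\ t q <= tau k] else r.

Definition sync_step (qr : nat * nat) : nat * nat :=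
  let: (q, r) := qr in
  let mu := step_mu q r in
  let w := step_w q r in
  if t q < tau r then (if tau r == t mu then mu.+1 else mu, r.+1)
  else if t q == tau r then (q.+1, r.+1)
  else (q.+1, if t q == tau w then w.+1 else w).

Definition sync_q (i : nat) : nat := (iter i sync_step (0%N, 0%N)).1.
Definition sync_r (i : nat) : nat := (iter i sync_step (0%N, 0%N)).2.

Definition sync_g (i : nat) : R := t (step_mu (sync_q i) (sync_r i)).
Definition sync_gamma (i : nat) : R := tau (step_w (sync_q i) (sync_r i)).

(* As sync_q 0 = sync_r 0 = 0 and 0.-1 = 0, these are t 0 and tau 0 at i = 0. *)
Definition sync_l (i : nat) : R := t (sync_q i).-1.
Definition sync_lambda (i : nat) : R := tau (sync_r i).-1.

Definition sync_T (i : nat) : R := Num.min (sync_g i) (sync_gamma i).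
Definition sync_DT (i : nat) : R := sync_T i - sync_T i.-1.

Definition sync_N (T : R) : nat := greatest [set k | sync_T k <= T].

(* In the three sums below s <= T, so that sync_T k <= s forces
   k <= sync_N T; the bounds on i are therefore no further restriction.
   With sync_T i = i * T / N for all i <= N one has G s = s at each of these
   times s: limits of G, F and H are naturally multiples of s, not of s / T. *)
Definition qvar_G (T s : R) : R :=
  let N := sync_N T in
  N%:R / T * \sum_(1 <= i < N.+1 | sync_T i <= s) sync_DT i ^+ 2.

Definition qvar_F (T s : R) : R :=
  let N := sync_N T in
  N%:R / T * \sum_(1 <= i < N | sync_T i.+1 <= s)
    ((sync_T i - sync_lambda i) * (sync_g i - sync_T i)
     + (sync_T i - sync_l i) * (sync_gamma i - sync_T i)
     + sync_DT i.+1 * (sync_T i - sync_l i.+1)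
     + sync_DT i.+1 * (sync_T i - sync_lambda i.+1)).

Definition qvar_H (T s : R) : R :=
  let N := sync_N T in
  N%:R / T * \sum_(1 <= i < N | sync_T i.+1 <= s)
    ((sync_T i - sync_l i.+1) * (sync_g i - sync_T i)
     + (sync_T i - sync_lambda i.+1) * (sync_gamma i - sync_T i)).

End Synchronization.

(* Main.v *)
(* After multiplying all times by n, the waiting times are exponential with the
   fixed rates la = 1 / theta1 and mu = 1 / theta2.  By memorylessness the
   synchronized times T_i form a renewal structure: after T_i the residual waiting
   times of both processes are again independent Poisson waiting times x, y,
   independent of the past; the next step has length max (x, y), and the process
   that is observed first is last observed an exponential time of rate la + mu
   before the other one.  Every summand of G, F and H is a sum of products of a
   predictable factor and such an innovation, so a martingale-difference argument
   gives, uniformly in n, a mean-square law of large numbers.  The number of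
   steps up to time s is n s / m with m = E max (x, y), by the law of large numbers
   for the lengths; as the summands are nonnegative, a sum with a random number of
   terms is squeezed between sums with deterministic numbers of terms.  Hence a
   quadratic variation whose summands have mean c tends to s c / m ^ 2. *)

Require Import Defs.
From mathcomp Require Import all_boot all_order all_algebra finmap.
From mathcomp Require Import all_classical all_reals all_analysis.
From mathcomp Require Import measurable_realfun ring lra.

Set Implicit Arguments.
Unset Strict Implicit.
Unset Printing Implicit Defensive.

Import Order.TTheory GRing.Theory Num.Theory.
Import numFieldNormedType.Exports.

Local Open Scope classical_set_scope.
Local Open Scope ring_scope.

(** * Laws of images and densities *)

(** Nothing relates the processes for different [n], so only estimates for one [n] at a time are
    available; a variance bound with a constant free of [n] is of this kind. Independence of the
    past is expressed without conditional expectations: [poisson_on] compares probabilities of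
    cylinder events on an event [E], and [E] later ranges over all that has been observed. The
    obstacle is that one step consumes a random number of waiting times. It is split by the number
    [j.+1] of arrivals of one process that precede the first arrival of the other: each further
    arrival is one more use of memorylessness, at a level that is itself random. The minimum of two
    exponential times is independent of which of them is smaller, so the age at the end has rate
    [la + mu] for every [j], and the masses [p ^+ j.+1 * (1 - p)] with [p = la / (la + mu)] add up
    to [p]. The mirrored runs have mass [1 - p], so ties and endless runs are null without a
    separate argument. Waiting times are nonnegative only almost surely; absolute values keep the
    integrands nonnegative everywhere. *)

Section Density.
Local Open Scope ereal_scope.
Import HBNNSimple.

(** By simple functions and monotone convergence it is enough to know [nu] on events. Both [phi] and
    [p] are free, so that laws with a density ([phi = id]), laws on an event ([p] an indicator) and
    conditional means ([phi] the identity onto a smaller sigma-algebra) are all covered. *)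
Lemma ge0_integral_density (R : realType) d1 d2 (X : measurableType d1)
    (Y : measurableType d2) (phi : X -> Y) (mu : {measure set X -> \bar R})
    (nu : {measure set Y -> \bar R}) (p : X -> R) (f : Y -> R) :
  measurable_fun setT phi -> measurable_fun setT p -> measurable_fun setT f ->
  (forall x, 0 <= p x)%R -> (forall y, 0 <= f y)%R ->
  (forall A, measurable A -> nu A = \int[mu]_(x in phi @^-1` A) (p x)%:E) ->
  \int[nu]_y (f y)%:E = \int[mu]_x (f (phi x) * p x)%:E.
Proof.
move=> mphi mp mf p0 f0 nuE.
have mEf : measurable_fun [set: Y] (fun y => (f y)%:E) by exact/measurable_EFinP.
pose h := nnsfun_approx measurableT mEf.
have mh n : measurable_fun setT (fun x => h n (phi x) : R).
  by apply: measurableT_comp => //; exact/measurable_funP.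
have hcvg y : EFin \o h ^~ y @ \oo --> (f y)%:E.
  by apply: cvg_nnsfun_approx => // z _; rewrite lee_fin.
have -> : \int[nu]_y (f y)%:E = limn (fun n => \int[nu]_y (h n y)%:E).
  rewrite -monotone_convergence//.
  - by apply: eq_integral => y _; apply/esym/cvg_lim => //; exact: hcvg.
  - by move=> n; apply/measurable_EFinP/measurable_funP.
  - by move=> n y _; rewrite lee_fin.
  - by move=> y _ a b ab; rewrite lee_fin; exact/lefP/nd_nnsfun_approx.
have -> : \int[mu]_x (f (phi x) * p x)%:E =
    limn (fun n => \int[mu]_x (h n (phi x) * p x)%:E).
  rewrite -monotone_convergence//.
  - apply: eq_integral => x _; apply/esym/cvg_lim => //.
    rewrite EFinM; under eq_fun do rewrite EFinM.
    by apply: cvgeZr => //; exact: hcvg.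
  - by move=> n; apply/measurable_EFinP/measurable_funM.
  - by move=> n x _; rewrite lee_fin mulr_ge0.
  - move=> x _ a b ab; rewrite lee_fin ler_wpM2r//.
    exact/lefP/nd_nnsfun_approx.
congr (limn _); apply/funext => n.
have mpre r : measurable (phi @^-1` (h n @^-1` [set r])).
  by rewrite -[_ @^-1` _]setTI; exact: mphi.
transitivity (\int[nu]_y
   (\sum_(r \in range (h n)) (r * \1_(h n @^-1` [set r]) y)%:E)).
  by apply: eq_integral => y _; rewrite fimfunE -fsumEFin.
rewrite ge0_integral_fsum//; last 2 first.
- by move=> r; apply/measurable_EFinP/measurable_funM.
- by move=> r y _; exact: nnfun_muleindic_ge0.
transitivity (\int[mu]_x
   (\sum_(r \in range (h n)) (r * \1_(h n @^-1` [set r]) (phi x))%:E * (p x)%:E));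
    last first.
  apply: eq_integral => x _.
  rewrite -ge0_mule_fsuml => [|y]; last exact: nnfun_muleindic_ge0.
  by rewrite fsumEFin// -(fimfunE _ (phi x)) -EFinM.
rewrite ge0_integral_fsum//; last 2 first.
- move=> r; apply: emeasurable_funM; apply/measurable_EFinP => //.
  apply: measurable_funM => //.
  exact: (measurableT_comp (measurable_indic _) mphi).
- by move=> r x _; rewrite mule_ge0 ?lee_fin//; exact: nnfun_muleindic_ge0.
apply: eq_fsbigr => r; rewrite inE => -[y _ <-].
set s := h n y; have s0 : (0 <= s)%R by exact: fun_ge0.
under eq_integral do rewrite EFinM.
rewrite ge0_integralZl//; last first.
- by apply/measurable_EFinP; exact: measurable_indic.
under [RHS]eq_integral do rewrite EFinM -muleA.
rewrite ge0_integralZl//; last 2 first.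
- apply: emeasurable_funM; apply/measurable_EFinP => //.
  exact: (measurableT_comp (measurable_indic _) mphi).
- by move=> z _; rewrite mule_ge0 ?lee_fin.
congr (_ * _); rewrite integral_indic// setIT nuE// integral_mkcond.
apply: eq_integral => x _; rewrite patchE indicE.
have -> : (x \in phi @^-1` (h n @^-1` [set s])) =
    (phi x \in h n @^-1` [set s]) by apply/idP/idP; rewrite !inE.
by case: ifPn; rewrite ?mul1e ?mul0e.
Qed.

End Density.

Section ImageOn.
Context (R : realType) d d' (T : measurableType d) (T' : measurableType d').
Variables (P : {measure set T -> \bar R}) (E : set T) (mE : measurable E).
Variables (f : T -> T') (mf : measurable_fun setT f).

(** The law of [f] on [E], not normalized: [P E] may vanish. *)
Definition image_on : {measure set T' -> \bar R} :=
  measure_function_pushforward__canonical__measure_function_Measure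
    (mrestr P mE : {measure set T -> \bar R}) mf.

Lemma image_onE A : image_on A = P (f @^-1` A `&` E).
Proof. by []. Qed.

End ImageOn.

(** * Exponential distributions *)

Section ExponentialLaw.
Context (R : realType).
Local Notation leb := (@lebesgue_measure R).

Definition exponential_law (la : R) (la0 : 0 < la) :
    probability (measurableTypeR R) R :=
  exponential_distribution_exponential_prob__canonical__probability_measure_Probability
    la0.

Lemma exponential_lawE (la : R) (la0 : 0 < la) (A : set R) :
  exponential_law la0 A = exponential_prob la A.
Proof. by []. Qed.

Lemma cvg_powM_expRN (la : R) (k : nat) : 0 < la ->
  x ^+ k * expR (- la * x) @[x --> +oo] --> 0.
Proof.
move=> la0.
(* The term of degree [k.+1] in the series of [expR (la * x)] alone gives
   [x ^+ k * expR (- la * x) <= c / x]. *)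
pose c := (k.+1)`!%:R / la ^+ k.+1.
apply: (@squeeze_cvgr _ _ _ _ (fun=> 0) (fun x : R => c * x^-1)).
- near=> x.
  have x0 : 0 < x by near: x; exact: nbhs_pinfty_gt.
  rewrite mulr_ge0 ?expR_ge0 ?exprn_ge0 ?(ltW x0)//=.
  have lax : 0 < la * x by rewrite mulr_gt0.
  have fac0 : 0 < (k.+1)`!%:R :> R by rewrite ltr0n fact_gt0.
  have /(le_trans _) : (la * x) ^+ k.+1 / (k.+1)`!%:R <= expR (la * x).
    by rewrite (le_trans _ (expR_ge1Dxn k (ltW lax)))// lerDr.
  move=> /(_ _ (lexx _)) h.
  rewrite mulNr expRN /c ler_pdivrMr ?expR_gt0//.
  have -> : x ^+ k = (k.+1)`!%:R / la ^+ k.+1 / x *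
      ((la * x) ^+ k.+1 / (k.+1)`!%:R).
    by rewrite exprMn (exprS x); field; rewrite ?expf_neq0 ?gt_eqF//=.
  by apply: ler_wpM2l => //; rewrite !divr_ge0 ?exprn_ge0 ?ler0n ?ltW.
- exact: cvg_cst.
- rewrite -(mulr0 c); apply: cvgMr.
  apply/gtr0_cvgV0; last exact: cvg_id.
  exact: nbhs_pinfty_gt.
Unshelve. all: by end_near. Qed.

Lemma continuous_powM_expR (la : R) (k : nat) :
  continuous (fun x : R => x ^+ k * (la * expR (- la * x))).
Proof.
move=> x.
apply: (@continuousM _ R^o (fun x => x ^+ k) (fun x => la * expR (- la * x))).
  exact: exprn_continuous.
apply: (@continuousM _ R^o (fun=> la) (fun x => expR (- la * x))).
  exact: cst_continuous.
apply: continuous_comp; last exact: continuous_expR.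
by apply: (@continuousM _ R^o (fun=> - la) id); [exact: cst_continuous|exact: cvg_id].
Qed.

(** The primitive of [x ^+ k * (la * expR (- la * x))] obtained by repeated integration by parts; it
    vanishes at infinity, and its value at 0 is minus the [k]-th moment. *)
Fixpoint moment_primitive (la : R) (k : nat) (x : R) : R :=
  if k is k'.+1 then
    - (x ^+ k * expR (- la * x)) + k%:R / la * moment_primitive la k' x
  else - expR (- la * x).

Lemma is_derive_moment_primitive (la : R) (k : nat) (x : R) : 0 < la ->
  is_derive x 1 (moment_primitive la k) (x ^+ k * (la * expR (- la * x))).
Proof.
move=> la0.
have dE : is_derive x 1 (fun y => expR (- la * y)) (- la * expR (- la * x)).
  have dl : is_derive x 1 (fun y : R => - la * y) (- la).
    by apply: is_derive_eq; rewrite -?[_ *: _]/(_ * _) ?mulr1 ?scaler1 ?mulr0 ?add0r.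
  by have := is_derive1_comp (is_derive_expR (- la * x)) dl; rewrite mulrC.
elim: k => [|k IH] /=.
  by apply: is_derive_eq; rewrite expr0 mul1r mulNr opprK.
have dX : is_derive x 1 (fun y : R => y ^+ k.+1) (k.+1%:R * x ^+ k).
  apply: DeriveDef; first exact: exprn_derivable.
  by rewrite -derive1E exp_derive1.
have dM := is_deriveM dX dE.
have dMN := is_deriveN dM.
have dS := is_deriveD dMN (is_deriveZ (k.+1%:R / la) IH).
apply: is_derive_eq dS _.
rewrite -![_ *: _]/(_ * _) exprS.
by field; rewrite gt_eqF.
Qed.

Lemma moment_primitive0 (la : R) (k : nat) : 0 < la ->
  moment_primitive la k 0 = - (k`!%:R / la ^+ k).
Proof.
move=> la0; elim: k => [|k IH] /=.
  by rewrite mulr0 expR0 fact0 expr0 divr1.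
rewrite IH expr0n/= mul0r oppr0 add0r factS natrM exprS.
by field; rewrite ?expf_neq0 ?gt_eqF.
Qed.

Lemma cvg_moment_primitive (la : R) (k : nat) : 0 < la ->
  moment_primitive la k x @[x --> +oo] --> 0.
Proof.
move=> la0; elim: k => [|k IH] /=.
  rewrite -oppr0; apply: cvgN.
  have := @cvg_powM_expRN la 0 la0.
  by under eq_fun do rewrite expr0 mul1r.
rewrite -[X in _ --> X]addr0; apply: cvgD.
  by rewrite -oppr0; apply: cvgN; exact: cvg_powM_expRN.
rewrite -(mulr0 (k.+1%:R / la)).
exact: cvgMr.
Qed.

Lemma exponential_moment (la : R) (la0 : 0 < la) (k : nat) :
  (\int[exponential_law la0]_x (`|x| ^+ k)%:E = (k`!%:R / la ^+ k)%:E)%E.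
Proof.
rewrite (@ge0_integral_density _ _ _ (measurableTypeR R) _ id leb _
  (exponential_pdf la))//; last 3 first.
- exact: measurable_exponential_pdf.
- by apply: measurable_funX; exact: normr_measurable.
- by move=> x; apply: exponential_pdf_ge0; exact: ltW.
transitivity (\int[leb]_(x in `[0%R, +oo[)
    (x ^+ k * (la * expR (- la * x)))%:E)%E.
  rewrite [RHS]integral_mkcond; apply: eq_integral => x _.
  rewrite /exponential_pdf !patchE; case: ifPn => [|_]; last by rewrite mulr0.
  by rewrite inE/= in_itv/= andbT => x0; rewrite ger0_norm.
rewrite (@ge0_continuous_FTC2y _ (fun x : R => x ^+ k * (la * expR (- la * x)))
  (moment_primitive la k) 0 0).
- by rewrite moment_primitive0// sub0e EFinN oppeK.
- by move=> x x0; rewrite !mulr_ge0 ?exprn_ge0 ?expR_ge0// ltW.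
- by apply: continuous_subspaceT; exact: continuous_powM_expR.
- exact: cvg_moment_primitive.
- by move=> x _; have [] := is_derive_moment_primitive k x la0.
- apply/cvg_at_right_filter/differentiable_continuous/derivable1_diffP.
  by have [] := is_derive_moment_primitive k 0 la0.
- move=> x _; rewrite derive1E.
  by have [_ ->] := is_derive_moment_primitive k x la0.
Qed.

(** [Num.max x 0] keeps the formula valid for negative [x]: [eq_measure_rays] compares measures on
    all rays. *)
Lemma exponential_tail (la : R) (la0 : 0 < la) (x : R) :
  exponential_law la0 `]x, +oo[%classic = (expR (- la * Num.max x 0))%:E.
Proof.
have tail0 y : 0 <= y -> exponential_law la0 `[y, +oo[%classic = (expR (- la * y))%:E.
  move=> y0; rewrite exponential_lawE /exponential_prob.
  rewrite (@ge0_continuous_FTC2y _ _ (moment_primitive la 0) y 0).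
  - by rewrite sub0e -EFinN opprK.
  - by move=> z _; apply: exponential_pdf_ge0; exact: ltW.
  - apply: (@continuous_subspaceW R^o _ _ [set` `[0, +oo[%R]).
      by move=> z /=; rewrite !in_itv/= !andbT; exact: le_trans.
    exact: within_continuous_exponential_pdf.
  - exact: cvg_moment_primitive.
  - by move=> z _; have [] := is_derive_moment_primitive 0 z la0.
  - apply/cvg_at_right_filter/differentiable_continuous/derivable1_diffP.
    by have [] := is_derive_moment_primitive 0 y la0.
  - move=> z; rewrite in_itv/= andbT => yz; rewrite derive1E.
    have [_ ->] := is_derive_moment_primitive 0 z la0.
    by rewrite expr0 mul1r exponential_pdfE// (le_trans y0)// ltW.
have [x0|x0] := leP 0 x.
  rewrite -tail0// !exponential_lawE /exponential_prob integral_itv_obnd_cbnd//.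
  apply/measurable_EFinP/measurable_funTS.
  exact: measurable_exponential_pdf.
rewrite mulr0 expR0; apply/eqP; rewrite eq_le probability_le1//=.
rewrite -[X in (X <= _)%E](_ : exponential_law la0 `[0, +oo[%classic = 1%E); last first.
  by rewrite tail0// mulr0 expR0.
apply: le_measure; rewrite ?inE//=.
by move=> z /=; rewrite !in_itv/= !andbT; exact: lt_le_trans.
Qed.

(** Rays are closed under intersection and generate the Borel sets, so an identity between laws
    reduces to one between tails. *)
Lemma eq_measure_rays (m1 m2 : {measure set (measurableTypeR R) -> \bar R}) :
  (m1 setT < +oo)%E ->
  (forall x, m1 `]x, +oo[%classic = m2 `]x, +oo[%classic) ->
  forall A, measurable A -> m1 A = m2 A.
Proof.
move=> m1oo m12 A mA.
apply: (@measure_unique _ R (measurableTypeR R) (@RGenOInfty.G R)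
  (fun n => `]- n%:R, +oo[%classic) _ _ _ _ m1 m2 _ _ A mA) => //.
- exact: RGenOInfty.measurableE.
- move=> _ _ [x ->] [y ->]; exists (Num.max x y).
  by apply/seteqP; split => z; rewrite /= !in_itv/= !andbT gt_max => /andP.
- by move=> n; exists (- n%:R).
- rewrite -subTset => x _.
  exists (Num.truncn `|x|).+1 => //=; rewrite in_itv/= andbT ltrNl.
  by rewrite (le_lt_trans _ (truncnS_gt _))// (le_trans (ler_norm _))// normrN.
- by move=> _ [x ->]; exact: m12.
- by move=> n; rewrite (le_lt_trans _ m1oo)//; apply: le_measure; rewrite ?inE.
Qed.

(** Both sides are finite measures in [B], so tails decide. An arbitrary [B] is kept because later
    events involve the whole law of the residual time. *)
Lemma exponential_memoryless (la : R) (la0 : 0 < la) (d : R) (B : set R) :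
  0 <= d -> measurable B ->
  exponential_law la0 [set z | d < z /\ B (z - d)] =
  ((expR (- la * d))%:E * exponential_law la0 B)%E.
Proof.
move=> d0 mB.
have mD : measurable (`]d, +oo[%classic : set (measurableTypeR R)) by [].
have msub : measurable_fun [set: measurableTypeR R]
  (fun z : R => z - d : measurableTypeR R) by exact: measurable_funB.
transitivity (image_on (exponential_law la0) mD msub B).
  rewrite image_onE; congr (exponential_law la0 _).
  by apply/seteqP; split => z /=; rewrite in_itv/= andbT => -[].
apply: (@eq_measure_rays _
  (mscale (NngNum (expR_ge0 (- la * d))) (exponential_law la0)) _ _ B mB).
- rewrite image_onE preimage_setT setTI.
  exact: le_lt_trans (probability_le1 (exponential_law la0) mD) (ltry _).
- move=> x.
  (* For [x < 0] the constraint [d < z] is the binding one, hence the maximum. *)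
  transitivity (exponential_law la0 `]Num.max d (d + x), +oo[%classic).
    rewrite image_onE; congr (exponential_prob la _).
    apply/seteqP; split => z /=; rewrite !in_itv/= !andbT gt_max.
      by move=> [xz ->]/=; rewrite addrC -ltrBrDr.
    by move=> /andP[-> dxz]; rewrite ltrBrDr addrC.
  transitivity
    ((expR (- la * d))%:E * exponential_law la0 `]x, +oo[%classic)%E => //.
  rewrite !exponential_tail -EFinM -expRD; congr (expR _)%:E.
  rewrite -mulrDr; congr (_ * _).
  have [x0|x0] := leP 0 x.
    by rewrite (@max_r _ _ d) ?lerDl// max_l// addr_ge0.
  by rewrite (@max_l _ _ d) ?gerDl ?ltW// max_l// addr0.
Qed.

Lemma exponential_scale (la : R) (la0 : 0 < la) (c : R) (lac0 : 0 < la / c)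
    (B : set R) : 0 < c -> measurable B ->
  exponential_law la0 [set z | B (c * z)] = exponential_law lac0 B.
Proof.
move=> c0 mB.
have mM : measurable_fun [set: measurableTypeR R]
  (fun z : R => c * z : measurableTypeR R) by exact: measurable_funM.
transitivity (image_on (exponential_law la0) measurableT mM B).
  by rewrite image_onE setIT.
apply: (@eq_measure_rays _ (exponential_law lac0) _ _ B mB).
- rewrite image_onE preimage_setT setTI.
  exact: le_lt_trans (probability_le1 (exponential_law la0) measurableT) (ltry _).
- move=> x; transitivity (exponential_law la0 `]x / c, +oo[%classic).
    rewrite image_onE setIT; congr (exponential_prob la _).
    by apply/seteqP; split => z /=; rewrite !in_itv/= !andbT ltr_pdivrMr// mulrC.
  transitivity (exponential_law lac0 `]x, +oo[%classic) => //.
  rewrite !exponential_tail; congr (expR _)%:E.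
  have [x0|x0] := leP 0 x.
    by rewrite max_l ?divr_ge0 ?(ltW c0)//; field; rewrite gt_eqF.
  by rewrite max_r ?mulr0// ltW// pmulr_llt0 ?invr_gt0.
Qed.

(* The mass of [min X Y] on the event [X < Y], for independent [X], [Y]. *)
Lemma exponential_race (la mu : R) (la0 : 0 < la) (mu0 : 0 < mu)
    (lamu0 : 0 < la + mu) (A : set R) : measurable A ->
  (\int[exponential_law la0]_x
     (\1_A x * fine (exponential_law mu0 `]x, +oo[%classic))%:E)%E =
  ((la / (la + mu))%:E * exponential_law lamu0 A)%E.
Proof.
move=> mA.
have mmax : measurable_fun setT (fun x : measurableTypeR R => Num.max x 0).
  by apply: measurable_maxr.
under eq_integral do rewrite exponential_tail /=.
rewrite (@ge0_integral_density _ _ _ (measurableTypeR R) _ id leb _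
  (exponential_pdf la)
  (fun x => \1_A x * expR (- mu * Num.max x 0)))//; last 3 first.
- exact: measurable_exponential_pdf.
- apply: measurable_funM; first exact: measurable_indic.
  by apply: measurableT_comp => //; exact: measurable_funM.
- by move=> x; apply: exponential_pdf_ge0; exact: ltW.
rewrite exponential_lawE /exponential_prob -ge0_integralZl//; last 3 first.
- by apply/measurable_EFinP; apply: measurable_funTS; exact: measurable_exponential_pdf.
- by move=> x _; rewrite lee_fin; apply: exponential_pdf_ge0; exact: ltW.
- by rewrite lee_fin divr_ge0 ?ltW.
rewrite [RHS]integral_mkcond; apply: eq_integral => x _.
rewrite patchE indicE; case: (x \in A); rewrite ?mul0r//= mul1r -EFinM.
congr EFin; rewrite /exponential_pdf !patchE; case: ifPn => [|_].
  rewrite inE/= in_itv/= andbT => x0; rewrite max_l//.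
  rewrite mulrCA -expRD mulrA divfK ?gt_eqF//; congr (_ * expR _).
  by ring.
by rewrite !mulr0.
Qed.

End ExponentialLaw.

(** * Independent Poisson waiting times *)

Section MeasureFacts.
Local Open Scope ereal_scope.

Lemma measurable_preimage d d' (T : measurableType d) (T' : measurableType d')
    (f : T -> T') (A : set T') :
  measurable_fun setT f -> measurable A -> measurable (f @^-1` A).
Proof. by move=> mf mA; rewrite -[_ @^-1` _]setTI; exact: mf. Qed.

Lemma measurable_set_ltr (R : realType) d (T : measurableType d) (f g : T -> R) :
  measurable_fun setT f -> measurable_fun setT g ->
  measurable [set x | (f x < g x)%R].
Proof.
move=> mf mg.
exact: (@measurable_preimage _ _ T bool _ [set true]
  (measurable_fun_ltr mf mg)).
Qed.

Lemma eq_measure_prod (R : realType) d1 d2 (T1 : measurableType d1)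
    (T2 : measurableType d2) (m1 m2 : {measure set (T1 * T2) -> \bar R}) :
  m1 setT < +oo ->
  (forall A B, measurable A -> measurable B -> m1 (A `*` B) = m2 (A `*` B)) ->
  forall W, measurable W -> m1 W = m2 W.
Proof.
move=> m1oo m12 W mW.
apply: (measure_unique [set A `*` B | A in measurable & B in measurable]
  (fun=> setT)) => //.
- exact: measurable_prod_measurableType.
- move=> _ _ [A mA [B mB <-]] [C mC [D mD <-]]; rewrite -setXI.
  by exists (A `&` C); [exact: measurableI|exists (B `&` D) => //; exact: measurableI].
- by move=> _; exists setT => //; exists setT => //; rewrite setXTT.
- by rewrite bigcup_const.
- by move=> _ [A mA [B mB <-]]; exact: m12.
Qed.

Lemma ge0_integral_law (R : realType) d1 d2 (T : measurableType d1)
    (T' : measurableType d2) (P : {measure set T -> \bar R}) (E : set T)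
    (V : T -> T') (c : {nonneg R}) (nu : {measure set T' -> \bar R})
    (f : T' -> R) :
  measurable E -> measurable_fun setT V -> measurable_fun setT f ->
  (forall y, 0 <= f y)%R ->
  (forall A, measurable A -> P (E `&` V @^-1` A) = c%:num%:E * nu A) ->
  \int[P]_(w in E) (f (V w))%:E = c%:num%:E * \int[nu]_y (f y)%:E.
Proof.
move=> mE mV mf f0 h.
rewrite -ge0_integral_mscale//; last 2 first.
- exact/measurable_EFinP.
- by move=> y _; rewrite lee_fin.
rewrite (@ge0_integral_density _ _ _ _ _ V P _ (\1_E))//.
- rewrite integral_mkcond; apply: eq_integral => w _.
  by rewrite patchE indicE; case: (w \in E); rewrite ?mulr1 ?mulr0.
- move=> A mA; rewrite integral_indic//; last exact: measurable_preimage.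
  by rewrite h.
Qed.

End MeasureFacts.

(** * Memorylessness at random levels, relative to an event of the past *)

Section PoissonOn.
Context (R : realType) d (Omega : measurableType d) (P : probability Omega R).
Local Open Scope ereal_scope.

Implicit Types (E : set Omega) (a b : nat -> Omega -> R) (As Bs : seq (set R)).

Definition shift_seq a : nat -> Omega -> R := fun k => a k.+1.

Definition cons_seq (f : Omega -> R) a : nat -> Omega -> R :=
  fun k => if k is k'.+1 then a k' else f.

(** The recursion shifts the sequence, so that consuming the first waiting time amounts to removing
    the head of the list. *)
Fixpoint cylinder As a : set Omega :=
  if As is A :: As' then a 0%N @^-1` A `&` cylinder As' (shift_seq a) else setT.

Fixpoint all_measurable As : Prop :=
  if As is A :: As' then measurable A /\ all_measurable As' else True.

Fixpoint weight (la : R) As : \bar R :=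
  if As is A :: As' then exponential_prob la A * weight la As' else 1.

(* On the event [E], the waiting times [a] and [b] are those of two independent
   Poisson processes with rates [la] and [mu], independent of [E]. *)
Definition poisson_on (la mu : R) E a b : Prop :=
  [/\ measurable E, forall k, measurable_fun setT (a k),
      forall k, measurable_fun setT (b k) &
      forall As Bs, all_measurable As -> all_measurable Bs ->
        P (E `&` cylinder As a `&` cylinder Bs b) =
        P E * (weight la As * weight mu Bs)].

Lemma measurable_cylinder As a : (forall k, measurable_fun setT (a k)) ->
  all_measurable As -> measurable (cylinder As a).
Proof.
elim: As a => [|A As IH] a ma /=; first by move=> _; exact: measurableT.
move=> [mA mAs].
by apply: measurableI; [exact: measurable_preimage|apply: IH => // k; exact: ma].
Qed.

Lemma weight_fin (la : R) As : (0 < la)%R -> all_measurable As ->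
  0 <= weight la As < +oo.
Proof.
move=> la0; elim: As => [|A As IH] /=; first by rewrite lee01 ltry.
move=> [mA /IH/andP[w0 woo]].
have e0 : 0 <= exponential_prob la A by exact: (measure_ge0 (exponential_law la0)).
have e1 := probability_le1 (exponential_law la0) mA.
apply/andP; split; first exact: mule_ge0.
by apply: lte_mul_pinfty => //; rewrite ge0_fin_numE// (le_lt_trans e1) ?ltry.
Qed.

Lemma weight_num (la mu : R) As Bs : (0 < la)%R -> (0 < mu)%R ->
  all_measurable As -> all_measurable Bs ->
  exists kap : {nonneg R}, kap%:num%:E = weight la As * weight mu Bs.
Proof.
move=> la0 mu0 mAs mBs.
have /andP[wa0 waoo] := weight_fin la0 mAs.
have /andP[wb0 wboo] := weight_fin mu0 mBs.
have k0 : (0 <= fine (weight la As * weight mu Bs))%R.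
  by rewrite fine_ge0// mule_ge0.
by exists (NngNum k0); rewrite /= fineK// fin_numM// ge0_fin_numE.
Qed.

Lemma poisson_onC (la mu : R) E a b :
  poisson_on la mu E a b -> poisson_on mu la E b a.
Proof.
move=> [mE ma mb h]; split => // As Bs mAs mBs.
by rewrite setIAC h// (muleC (weight mu _)).
Qed.

Lemma exponential_probT (la : R) : (0 < la)%R -> exponential_prob la setT = 1.
Proof. by move=> la0; exact: (probability_setT (exponential_law la0)). Qed.

Section Rates.
Variables (la mu : R) (la0 : (0 < la)%R) (mu0 : (0 < mu)%R).

Section Absorb.
Context d' (T' : measurableType d') (U : Omega -> T') (mU : measurable_fun setT U).
Variables (E : set Omega) (mE : measurable E) (a b : nat -> Omega -> R).
Hypothesis h : forall A, measurable A ->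
  poisson_on la mu (E `&` U @^-1` A) a b.

(** On rectangles this is the hypothesis on [E] and the preimage of [A] under [U]. Both sides are
    finite measures in [W], so it extends to all measurable [W], in particular to comparisons of
    [a 0] with a function of [U]. *)
Lemma poisson_on_joint As Bs (W : set (T' * R)) :
  all_measurable As -> all_measurable Bs -> measurable W ->
  P (E `&` (fun w => (U w, a 0%N w)) @^-1` W `&`
     cylinder As (shift_seq a) `&` cylinder Bs b) =
  \int[image_on P mE mU]_u exponential_law la0 (xsection W u) *
  (weight la As * weight mu Bs).
Proof.
move=> mAs mBs mW.
have [_ ma mb _] := h measurableT.
have mC : measurable (E `&` (cylinder As (shift_seq a) `&` cylinder Bs b)).
  apply: measurableI => //; apply: measurableI; apply: measurable_cylinder => //.
  by move=> k; exact: ma.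
have mUa : measurable_fun setT (fun w => (U w, a 0%N w) : T' * measurableTypeR R).
  by apply: (@measurable_fun_pair _ _ _ Omega T' (measurableTypeR R)) => //; exact: ma.
have [kap kE] := weight_num la0 mu0 mAs mBs.
transitivity (image_on P mC mUa W).
  rewrite image_onE; congr (P _).
  by rewrite setIA setIA [X in X `&` _ `&` _]setIC.
rewrite muleC.
transitivity (mscale kap (image_on P mE mU \x exponential_law la0) W);
  last by rewrite -kE.
apply: (@eq_measure_prod R _ _ T' (measurableTypeR R) (image_on P mC mUa)
  (mscale kap (image_on P mE mU \x exponential_law la0))) => //.
  rewrite image_onE preimage_setT setTI.
  by rewrite (le_lt_trans (probability_le1 P mC))// ltry.
move=> A B mA mB; rewrite image_onE.
have [_ _ _ hA] := h mA.
have := hA (B :: As) Bs; rewrite /= => /(_ (conj mB mAs) mBs) hAB.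
transitivity (P (E `&` U @^-1` A) *
    (exponential_prob la B * weight la As * weight mu Bs)).
  rewrite -hAB; congr (P _); apply/seteqP; split => w /=; tauto.
have -> : mscale kap (image_on P mE mU \x exponential_law la0) (A `*` B)
  = kap%:num%:E * (image_on P mE mU \x exponential_law la0) (A `*` B).
  by [].
rewrite product_measure1E// kE image_onE (setIC _ E).
by rewrite [RHS]muleC !muleA.
Qed.

(** With empty cylinders, [poisson_on_joint] identifies the integral as the probability of the
    enlarged event; the first waiting time thus joins the past. *)
Lemma poisson_on_absorb (W : set (T' * R)) : measurable W ->
  poisson_on la mu (E `&` (fun w => (U w, a 0%N w)) @^-1` W) (shift_seq a) b.
Proof.
move=> mW; have [_ ma mb _] := h measurableT; split.
- apply: measurableI => //; apply: measurable_preimage => //.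
  exact: measurable_fun_pair.
- by move=> k; exact: ma.
- by [].
- move=> As Bs mAs mBs; rewrite poisson_on_joint//.
  by have := @poisson_on_joint [::] [::] W I I mW; rewrite /= !setIT !mule1 => ->.
Qed.

(** For a given value of [U] the level is a constant, memorylessness applies, and the factor
    [expR (- la * thr u)] integrates out. It holds only for levels that are nonnegative, whence the
    null-set hypothesis. *)
Lemma poisson_on_residual (thr : T' -> R) (A : set T') :
  measurable_fun setT thr -> measurable A ->
  P (E `&` [set w | thr (U w) < 0]%R) = 0 ->
  poisson_on la mu (E `&` U @^-1` A `&` [set w | thr (U w) < a 0%N w]%R)
    (cons_seq (fun w => a 0%N w - thr (U w))%R (shift_seq a)) b.
Proof.
move=> mthr mA thr0.
have [_ ma mb _] := h measurableT.
have mthrU : measurable_fun setT (fun w => thr (U w)) by exact: measurableT_comp.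
set Ia := \int[image_on P mE mU]_u (\1_A u * expR (- la * thr u))%:E.
have key B As Bs : measurable B -> all_measurable As -> all_measurable Bs ->
    P (E `&` U @^-1` A `&` [set w | thr (U w) < a 0%N w]%R `&`
       ((fun w => a 0%N w - thr (U w))%R @^-1` B `&` cylinder As (shift_seq a)) `&`
       cylinder Bs b) =
    Ia * (exponential_prob la B * weight la As * weight mu Bs).
  move=> mB mAs mBs.
  pose W : set (T' * R) := [set uz | A uz.1 /\
    ((thr uz.1 < uz.2)%R /\ B (uz.2 - thr uz.1)%R)].
  have mthr1 : measurable_fun [set: T' * R] (fun uz => thr uz.1).
    by apply: measurableT_comp => //; exact: measurable_fst.
  have mW : measurable W.
    apply: measurableI; first exact: (measurable_preimage measurable_fst mA).
    apply: measurableI.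
      by apply: measurable_set_ltr => //; exact: measurable_snd.
    by apply: (measurable_preimage _ mB); exact: measurable_funB.
  transitivity (P (E `&` (fun w => (U w, a 0%N w)) @^-1` W `&`
     cylinder As (shift_seq a) `&` cylinder Bs b)).
    by congr (P _); apply/seteqP; split => w; rewrite /W/=; tauto.
  have mIa : measurable_fun [set: T'] (fun u => (\1_A u * expR (- la * thr u))%:E).
    apply/measurable_EFinP; apply: measurable_funM; first exact: measurable_indic.
    by apply: measurableT_comp => //; exact: measurable_funM.
  suff eqI : \int[image_on P mE mU]_u exponential_law la0 (xsection W u) =
      exponential_law la0 B * Ia.
    by rewrite poisson_on_joint// eqI (muleC _ Ia) !muleA.
  rewrite /Ia.
  rewrite -ge0_integralZl//.
  apply: ae_eq_integral => //.
  - exact: measurable_fun_xsection.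
  - exact: emeasurable_funM.
  exists [set u | thr u < 0]%R; split.
  - exact: measurable_set_ltr.
  - by rewrite image_onE setIC.
  move=> u /=; apply: contra_notP => /negP; rewrite -leNgt => thru _ /=.
  rewrite indicE; have [uA|uA] := boolP (u \in A); last first.
    rewrite mul0r mule0 [xsection _ _](_ : _ = set0) ?measure0//.
    apply/seteqP; split => z //=; rewrite /xsection/= inE => -[/= Au _].
    by move: uA; rewrite notin_setE.
  rewrite mul1r muleC -exponential_memoryless//; congr (exponential_prob la _).
  apply/seteqP; split => z; rewrite /xsection/= inE /W/=; first by case.
  by move=> ?; split => //; rewrite -inE.
split.
- apply: measurableI; last exact: measurable_set_ltr.
  by apply: measurableI => //; exact: measurable_preimage.
- by case=> [|k] /=; [exact: measurable_funB|exact: ma].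
- by [].
(* [B = setT] with empty lists shows that [Ia] is the probability of the conditioning event. *)
have keyT : P (E `&` U @^-1` A `&` [set w | thr (U w) < a 0%N w]%R) = Ia.
  have := key setT [::] [::] measurableT I I.
  by rewrite exponential_probT//= !mule1 preimage_setT !setIT.
move=> [|B As] Bs /=.
  move=> _ mBs; have := key setT [::] Bs measurableT I mBs.
  by rewrite exponential_probT// keyT/= preimage_setT !setIT !mul1e.
by move=> [mB mAs] mBs; rewrite keyT -key.
Qed.

End Absorb.

End Rates.

(** * The race between two exponential waiting times *)

Section Race.
Variables (la mu : R) (la0 : (0 < la)%R) (mu0 : (0 < mu)%R).

Section First.
Variables (E : set Omega) (a b : nat -> Omega -> R).
Hypothesis h : poisson_on la mu E a b.

Lemma poisson_on_first (A : set R) : measurable A ->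
  P (E `&` a 0%N @^-1` A) = P E * exponential_law la0 A.
Proof.
move=> mA; have [_ _ _ hP] := h.
by have := hP [:: A] [::] (conj mA I) I; rewrite /= !setIT !mule1.
Qed.

Lemma poisson_on_shift (A : set R) : measurable A ->
  poisson_on la mu (E `&` a 0%N @^-1` A) (shift_seq a) b.
Proof.
move=> mA; have [mE ma mb hP] := h; split => //.
- by apply: measurableI => //; exact: measurable_preimage.
- by move=> k; exact: ma.
- move=> As Bs mAs mBs; rewrite poisson_on_first// -!muleA -setIA.
  by have := hP (A :: As) Bs (conj mA mAs) mBs; rewrite /= !setIA -!muleA.
Qed.

Lemma poisson_on_first_ge0 : P (E `&` [set w | a 0%N w < 0]%R) = 0.
Proof.
have := @poisson_on_first [set x | x < 0]%R; rewrite /preimage/= => ->; last first.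
  by rewrite -set_itvNyo.
suff -> : exponential_law la0 [set x | x < 0]%R = 0 by rewrite mule0.
have m0 : measurable (`]0%R, +oo[%classic : set (measurableTypeR R)) by [].
apply: (@subset_measure0 _ (measurableTypeR R) R (exponential_law la0) _
  (~` `]0%R, +oo[%classic)).
- by rewrite -set_itvNyo.
- exact: measurableC.
- by move=> x /= x0; rewrite in_itv/= andbT => /(lt_trans x0); rewrite ltxx.
- transitivity (1 - exponential_law la0 `]0%R, +oo[%classic).
    exact: (probability_setC (exponential_law la0) m0).
  by rewrite exponential_tail maxxx mulr0 expR0 subee.
Qed.

(** With [a 0] counted as past, [b 0] exceeds it with probability an exponential tail; integration
    against the law of [a 0] leaves [exponential_race]. The factorized form says that the minimum is
    independent of which time is smaller. *)
Lemma poisson_on_race (lamu0 : (0 < la + mu)%R) (A : set R) : measurable A ->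
  P (E `&` [set w | a 0%N w < b 0%N w]%R `&` a 0%N @^-1` A) =
  P E * ((la / (la + mu))%:E * exponential_law lamu0 A).
Proof.
move=> mA; have [mE ma mb hP] := h.
have ma0 : @measurable_fun _ _ Omega (measurableTypeR R) setT (a 0%N) := ma 0%N.
pose W : set (measurableTypeR R * measurableTypeR R) := [set uz | A uz.1 /\ (uz.1 < uz.2)%R].
have mW : measurable W.
  apply: measurableI; first exact: (measurable_preimage measurable_fst mA).
  by apply: measurable_set_ltr; [exact: measurable_fst|exact: measurable_snd].
have h' B : measurable B ->
    poisson_on mu la (E `&` a 0%N @^-1` B) b (shift_seq a).
  by move=> mB; apply: poisson_onC; exact: poisson_on_shift.
transitivity (P (E `&` (fun w => (a 0%N w, b 0%N w)) @^-1` W `&`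
    cylinder [::] (shift_seq b) `&` cylinder [::] (shift_seq a))).
  by congr (P _); apply/seteqP; split => w; rewrite /W/=; tauto.
rewrite (poisson_on_joint mu0 la0 ma0 mE h')//.
have -> : weight mu [::] * weight la [::] = 1 by rewrite /= mule1.
rewrite mule1.
have kE : (NngNum (fine_ge0 (measure_ge0 P E)))%:num%:E = P E.
  by rewrite /= fineK// fin_num_measure.
rewrite (@eq_measure_integral _ _ _ _
  (mscale (NngNum (fine_ge0 (measure_ge0 P E))) (exponential_law la0))); last first.
  move=> B mB _; rewrite image_onE setIC.
  transitivity (P E * exponential_law la0 B); first exact: poisson_on_first.
  by rewrite -{1}kE.
rewrite ge0_integral_mscale//; last exact: measurable_fun_xsection.
rewrite kE; congr (_ * _); rewrite -(exponential_race la0 mu0)//.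
apply: eq_integral => u _; rewrite indicE EFinM fineK ?fin_num_measure//.
have [uA|uA] := boolP (u \in A).
  rewrite mul1e; congr (exponential_law mu0 _); apply/seteqP; split => z.
    by rewrite /xsection/= inE in_itv/= andbT => -[].
  by rewrite /xsection/= inE in_itv/= andbT; split => //; rewrite -inE.
rewrite mul0e [xsection _ _](_ : _ = set0) ?measure0//.
apply/seteqP; split => z //=; rewrite /xsection/= inE => -[/= Au _].
by move: uA; rewrite notin_setE.
Qed.

End First.

(** The level at which memorylessness of [b] is used is [a 0] itself, so [a 0] is first absorbed
    into the past beside [U]. *)
Lemma poisson_on_merge d' (T' : measurableType d') (U : Omega -> T')
    (E : set Omega) (a b : nat -> Omega -> R) (W : set (T' * R)) :
  measurable_fun setT U ->
  (forall A, measurable A -> poisson_on la mu (E `&` U @^-1` A) a b) ->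
  measurable W ->
  poisson_on la mu
    (E `&` [set w | a 0%N w < b 0%N w]%R `&` (fun w => (U w, a 0%N w)) @^-1` W)
    (shift_seq a) (cons_seq (fun w => b 0%N w - a 0%N w)%R (shift_seq b)).
Proof.
move=> mU h mW.
have [] := h _ measurableT; rewrite preimage_setT setIT => mE ma mb _.
have hT : poisson_on la mu E a b.
  by have := h _ measurableT; rewrite preimage_setT setIT.
apply: poisson_onC; rewrite setIAC.
have mUa : measurable_fun setT (fun w => (U w, a 0%N w)).
  by apply: measurable_fun_pair => //; exact: ma.
apply: (@poisson_on_residual mu la mu0 la0 _ _ _ mUa E mE b (shift_seq a) _ snd W) => //.
- by move=> A mA; apply: poisson_onC; exact: poisson_on_absorb.
- exact: (poisson_on_first_ge0 hT).
Qed.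

End Race.

End PoissonOn.

(** * The first synchronized observation *)

Section MeasureSums.
Context (R : realType) d (T : measurableType d) (P : probability T R).
Local Open Scope ereal_scope.

Lemma measure_bigcup_scale (F : nat -> set T) (X Y : set T) (c : R) :
  (forall j, measurable (F j)) -> trivIset setT F ->
  measurable X -> measurable Y -> (0 <= c)%R ->
  (forall j, P (X `&` F j) = c%:E * P (Y `&` F j)) ->
  P (X `&` \bigcup_j F j) = c%:E * P (Y `&` \bigcup_j F j).
Proof.
move=> mF tF mX mY c0 h.
rewrite !setI_bigcupr !measure_bigcup//; last 4 first.
- by move=> j _; exact: measurableI.
- exact: trivIset_setIl.
- by move=> j _; exact: measurableI.
- exact: trivIset_setIl.
by rewrite -nneseriesZl//; apply: eq_eseriesr => j _; exact: h.
Qed.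

Lemma measure_bigcup_geometric (F : nat -> set T) (X : set T) (c p : R) :
  (forall j, measurable (F j)) -> trivIset setT F -> measurable X ->
  (0 <= p < 1)%R ->
  (forall j, P (X `&` F j) = (c * (p ^+ j.+1 * (1 - p)))%:E) ->
  P (X `&` \bigcup_j F j) = (c * p)%:E.
Proof.
move=> mF tF mX /andP[p0 p1] h.
rewrite setI_bigcupr measure_bigcup//; last 2 first.
- by move=> j _; exact: measurableI.
- exact: trivIset_setIl.
rewrite (eq_eseriesl (Q := xpredT)); last by move=> j; rewrite in_setT.
apply/cvg_lim => //.
have -> : (fun n => \sum_(0 <= i < n) P (X `&` F i)) =
    (fun n => (c * (p - p * p ^+ n))%:E).
  apply/funext => n; under eq_bigr do rewrite h.
  rewrite sumEFin; congr EFin; rewrite -mulr_sumr; congr (_ * _)%R.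
  elim: n => [|n IH]; first by rewrite big_geq// expr0 mulr1 subrr.
  by rewrite big_nat_recr//= IH !exprS; ring.
apply: cvg_EFin; first by near=> n.
rewrite [X in (_ --> X)%classic](_ : _ = (c * (p - p * 0))%R); last first.
  by rewrite mulr0 subr0.
apply: cvgMr; apply: cvgB; first exact: cvg_cst.
apply: cvgMr; apply: cvg_expr.
by rewrite ger0_norm.
Unshelve. all: by end_near. Qed.

End MeasureSums.

Section Block.
Context (R : realType) d (Omega : measurableType d) (P : probability Omega R).
Local Open Scope ereal_scope.

Implicit Types (a b : nat -> Omega -> R) (L : Omega -> R).

Definition arrival a (j : nat) (w : Omega) : R := (\sum_(k < j.+1) a k w)%R.

(* The first [j + 1] arrivals of [a] precede the first arrival of [b]. *)
Definition run a b (j : nat) : set Omega :=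
  [set w | forall k, (k <= j)%N -> (arrival a k w < b 0%N w)%R].

Definition run_end a b (j : nat) : set Omega :=
  run a b j `&` [set w | b 0%N w < arrival a j.+1 w]%R.

Definition tail_seq a (j : nat) : nat -> Omega -> R := fun k => a (k + j)%N.

Definition age a b (j : nat) (w : Omega) : R := (b 0%N w - arrival a j w)%R.

Lemma arrival0 a : arrival a 0 = a 0%N.
Proof. by apply/funext => w; rewrite /arrival big_ord1. Qed.

Lemma arrivalS a j w : arrival a j.+1 w = (arrival a j w + a j.+1 w)%R.
Proof. by rewrite /arrival big_ord_recr. Qed.

Lemma measurable_arrival a j : (forall k, measurable_fun setT (a k)) ->
  measurable_fun setT (arrival a j).
Proof. by move=> ma; apply: measurable_sum => k; exact: ma. Qed.

Lemma run0 a b : run a b 0 = [set w | a 0%N w < b 0%N w]%R.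
Proof.
apply/seteqP; split => w /=; first by move=> /(_ 0%N (leqnn _)); rewrite arrival0.
by move=> ab k; rewrite leqn0 => /eqP ->; rewrite arrival0.
Qed.

Lemma runS a b j :
  run a b j.+1 = run a b j `&` [set w | a j.+1 w < age a b j w]%R.
Proof.
apply/seteqP; split => w /=.
  move=> h; split; first by move=> k kj; apply: h; exact: leqW.
  by have := h _ (leqnn _); rewrite arrivalS /age ltrBrDl.
move=> [h ha] k; rewrite leq_eqVlt => /predU1P[->|]; last by rewrite ltnS; exact: h.
by rewrite arrivalS -ltrBrDl.
Qed.

Lemma run_endE a b j :
  run_end a b j = run a b j `&` [set w | age a b j w < a j.+1 w]%R.
Proof.
by rewrite /run_end; congr (_ `&` _); apply/seteqP; split => w /=;
  rewrite arrivalS /age ltrBlDl.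
Qed.

Lemma trivIset_run_end a b : trivIset setT (run_end a b).
Proof.
apply/trivIsetP => i j _ _; wlog: i j / (i < j)%N.
  by move=> wl ij; case: (ltngtP i j) => [|ji|/eqP];
    [move=> /wl; exact|rewrite setIC; apply: wl => //; rewrite eq_sym|rewrite (negbTE ij)].
move=> ij _; apply/seteqP; split => // w [[_ /= h1] [h2 _]].
by have := lt_trans h1 (h2 _ ij); rewrite ltxx.
Qed.

Lemma run_end_lt a b : \bigcup_j run_end a b j `<=` [set w | a 0%N w < b 0%N w]%R.
Proof. by move=> w [j _ [/(_ 0%N (leq0n _))]]; rewrite arrival0. Qed.

Lemma cylinder_ext (As : seq (set R)) a a' w : (forall k, a k w = a' k w) ->
  cylinder As a w -> cylinder As a' w.
Proof.
elim: As a a' => [//|A As IH] a a' aa' /= [h1 h2]; split.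
  by rewrite /preimage/= -aa'.
by apply: IH h2 => k; exact: aa'.
Qed.

Lemma cylinder_ext_eq (As Bs : seq (set R)) a a' b b' (X Y : set Omega) :
  (forall w, Y w -> forall k, a k w = a' k w) ->
  (forall w, Y w -> forall k, b k w = b' k w) ->
  X `&` cylinder As a `&` cylinder Bs b `&` Y =
  X `&` Y `&` cylinder As a' `&` cylinder Bs b'.
Proof.
move=> aa' bb'; apply/seteqP; split => w /=.
  move=> [[[? h1] h2] Yw]; split; last exact: cylinder_ext (bb' _ Yw) h2.
  by split => //; exact: cylinder_ext (aa' _ Yw) h1.
move=> [[[? Yw] h1] h2]; split => //; split; last first.
  by apply: cylinder_ext h2 => k; rewrite bb'.
by split => //; apply: cylinder_ext h1 => k; rewrite aa'.
Qed.

(* What the next block of waiting times [a'], [b'] has to be once [b] ends a run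
   of [a]; [L] is the time since the last arrival of [a]. *)
Definition next_block a b L a' b' : Prop :=
  forall j w, run_end a b j w ->
    [/\ L w = age a b j w, a' 0%N w = (arrival a j.+1 w - b 0%N w)%R,
        forall k, a' k.+1 w = a (k + j.+2)%N w & forall k, b' k w = b k.+1 w].

Section OneSide.
Variables (la mu : R) (la0 : (0 < la)%R) (mu0 : (0 < mu)%R).
Variables (E : set Omega) (a b : nat -> Omega -> R).
Hypothesis h : poisson_on P la mu E a b.

Let lamu0 : (0 < la + mu)%R. Proof. exact: addr_gt0. Qed.
Let mE : measurable E. Proof. by case: h. Qed.
Let ma k : measurable_fun setT (a k). Proof. by case: h. Qed.
Let mb k : measurable_fun setT (b k). Proof. by case: h. Qed.

Lemma measurable_run j : measurable (run a b j).
Proof.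
elim: j => [|j IH]; first by rewrite run0; exact: measurable_set_ltr.
rewrite runS; apply: measurableI => //; apply: measurable_set_ltr => //.
by apply: measurable_funB => //; exact: measurable_arrival.
Qed.

Lemma measurable_run_end j : measurable (run_end a b j).
Proof.
apply: measurableI; first exact: measurable_run.
by apply: measurable_set_ltr => //; exact: measurable_arrival.
Qed.

(** Each further arrival of [a] is one [poisson_on_merge], with the current age in the role of the
    first wait of [b]. Of the past only [a 0] and the last arrival are recorded: together with the
    final age they determine [b 0]. *)
Lemma poisson_on_run j (W : set (R * R)) : measurable W ->
  poisson_on P la mu
    (E `&` run a b j `&` (fun w => (a 0%N w, arrival a j w)) @^-1` W)
    (tail_seq a j.+1) (cons_seq (age a b j) (shift_seq b)).
Proof.
elim: j W => [|j IH] W mW.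
  have m2 : measurable_fun setT (fun u : R * R => (u.2, u.2)).
    by apply: measurable_fun_pair; exact: measurable_snd.
  (* A trivial past is encoded by a constant function, whose preimages are full or empty. *)
  have hc (A : set R) : measurable A ->
      poisson_on P la mu (E `&` (cst 0%R) @^-1` A) a b.
    move=> mA; rewrite preimage_cst; case: ifPn => _; first by rewrite setIT.
    rewrite setI0; split => // As Bs _ _.
    by rewrite !set0I measure0 mul0e.
  have := @poisson_on_merge _ _ _ P la mu la0 mu0 _ R (cst 0%R : Omega -> R) E a b
    ((fun u => (u.2, u.2)) @^-1` W) _ hc _.
  move=> /(_ (measurable_cst _) (measurable_preimage m2 mW)).
  rewrite run0 arrival0.
  have -> : cons_seq (fun w => b 0%N w - a 0%N w)%R (shift_seq b) =
      cons_seq (age a b 0) (shift_seq b).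
    by congr cons_seq; apply/funext => w; rewrite /age arrival0.
  by have -> : shift_seq a = tail_seq a 1 by apply/funext => k; rewrite /tail_seq addn1.
have mU : measurable_fun setT (fun w => (a 0%N w, arrival a j w)).
  by apply: measurable_fun_pair => //; exact: measurable_arrival.
have m3 : measurable_fun setT (fun u : (R * R) * R => (u.1.1, u.1.2 + u.2)%R).
  apply: measurable_fun_pair.
    by apply: measurableT_comp; [exact: measurable_fst|exact: measurable_fst].
  apply: measurable_funD; last exact: measurable_snd.
  by apply: measurableT_comp; [exact: measurable_snd|exact: measurable_fst].
have := @poisson_on_merge _ _ _ P la mu la0 mu0 _ _ _ (E `&` run a b j) _ _
  ((fun u : (R * R) * R => (u.1.1, u.1.2 + u.2)%R) @^-1` W) mU IH.
move=> /(_ (measurable_preimage m3 mW)).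
have -> : shift_seq (tail_seq a j.+1) = tail_seq a j.+2.
  by apply/funext => k; rewrite /shift_seq /tail_seq addSnnS.
congr (poisson_on _ _ _ _ _ _).
  rewrite runS setIA; congr (_ `&` _).
  by apply/seteqP; split => w /=; rewrite arrivalS.
congr cons_seq; apply/funext => w /=.
by rewrite /age arrivalS /tail_seq add0n opprD addrA.
Qed.

(** The roles are exchanged in the last merge: the remaining wait of [b], which is the age, comes
    before the next arrival of [a], and now [a] keeps a residual. *)
Lemma poisson_on_run_end j (B : set (R * R * R)) : measurable B ->
  poisson_on P la mu
    (E `&` (run_end a b j `&`
     (fun w => (a 0%N w, b 0%N w, age a b j w)) @^-1` B))
    (cons_seq (fun w => arrival a j.+1 w - b 0%N w)%R (tail_seq a j.+2)) (shift_seq b).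
Proof.
move=> mB.
have mU : measurable_fun setT (fun w => (a 0%N w, arrival a j w)).
  by apply: measurable_fun_pair => //; exact: measurable_arrival.
(* [b 0] is the last arrival plus the age, so the triple is a function of the recorded past and of
   the wait just absorbed. *)
have m3 : measurable_fun setT
    (fun u : (R * R) * R => ((u.1.1, u.1.2 + u.2), u.2)%R).
  apply: measurable_fun_pair; last exact: measurable_snd.
  apply: measurable_fun_pair.
    by apply: measurableT_comp; [exact: measurable_fst|exact: measurable_fst].
  apply: measurable_funD; last exact: measurable_snd.
  by apply: measurableT_comp; [exact: measurable_snd|exact: measurable_fst].
have := @poisson_on_merge _ _ _ P mu la mu0 la0 _ _ _ (E `&` run a b j) _ _
  ((fun u : (R * R) * R => ((u.1.1, u.1.2 + u.2), u.2)%R) @^-1` B) mU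
  (fun A mA => poisson_onC (poisson_on_run j mA)).
move=> /(_ (measurable_preimage m3 mB)) /poisson_onC.
congr (poisson_on _ _ _ _ _ _).
  rewrite run_endE !setIA; congr (_ `&` _).
  have e w : (arrival a j w + age a b j w = b 0%N w)%R by rewrite /age addrC subrK.
  by apply/seteqP; split => w; rewrite /preimage/= e.
apply/funext => -[|k]; apply/funext => w /=.
  by rewrite /age arrivalS /tail_seq add0n; ring.
by rewrite /shift_seq /tail_seq addSnnS.
Qed.

Let p := (la / (la + mu))%R.

Let p01 : (0 <= p < 1)%R.
Proof. by rewrite divr_ge0 ?ltW//= ltr_pdivrMr// mul1r ltrDl. Qed.

Let q_p : (mu / (mu + la) = 1 - p)%R.
Proof. by rewrite /p addrC; field; rewrite gt_eqF. Qed.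

Lemma prob_run j : P (E `&` run a b j) = P E * (p ^+ j.+1)%:E.
Proof.
elim: j => [|j IH].
  rewrite run0 expr1; have := @poisson_on_race _ _ _ P la mu la0 mu0 _ _ _ h lamu0
    setT measurableT.
  by rewrite exponential_lawE exponential_probT// mule1 preimage_setT setIT.
have := poisson_on_run j measurableT; rewrite preimage_setT setIT => hj.
have := @poisson_on_race _ _ _ P la mu la0 mu0 _ _ _ hj lamu0 setT measurableT.
rewrite exponential_lawE exponential_probT// mule1 preimage_setT setIT/=.
rewrite runS setIA => ->; rewrite IH -muleA; congr (_ * _).
by rewrite -EFinM -exprSr.
Qed.

(** A run of [j.+1] won races ends with a race lost by [a], and the shorter time in that race has
    rate [la + mu] whatever came before; so the law of the age does not depend on [j]. *)
Lemma prob_run_end_age j (A : set R) : measurable A ->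
  P (E `&` (run_end a b j `&` age a b j @^-1` A)) =
  (fine (P E) * (p ^+ j.+1 * (1 - p)))%:E * exponential_law lamu0 A.
Proof.
move=> mA.
have := poisson_on_run j measurableT; rewrite preimage_setT setIT => /poisson_onC hj.
have mula0 : (0 < mu + la)%R by rewrite addrC.
have := @poisson_on_race _ _ _ P mu la mu0 la0 _ _ _ hj mula0 A mA.
rewrite run_endE !setIA /= => ->.
rewrite prob_run q_p (addrC mu la) !muleA; congr (_ * _).
by rewrite !EFinM fineK ?fin_num_measure// !muleA.
Qed.

(** As the law of the age is the same for all [j], the pieces of the union are proportional with a
    common factor, and the remaining masses form a geometric series. *)
Lemma prob_runs_end_age L (A : set R) : measurable A ->
  measurable_fun setT L -> (forall j w, run_end a b j w -> L w = age a b j w) ->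
  P (E `&` (\bigcup_j run_end a b j `&` L @^-1` A)) =
  (fine (P E) * p)%:E * exponential_law lamu0 A.
Proof.
move=> mA mL hL.
have eAfin : exponential_law lamu0 A \is a fin_num by exact: fin_num_measure.
have mLA : measurable (E `&` L @^-1` A).
  by apply: measurableI => //; exact: measurable_preimage.
rewrite setICA setIC -(fineK eAfin) muleC.
rewrite (measure_bigcup_scale (X := E `&` L @^-1` A) (Y := E)
  (c := fine (exponential_law lamu0 A)))//.
- congr (_ * _); apply: measure_bigcup_geometric => //.
  + exact: measurable_run_end.
  + exact: trivIset_run_end.
  + move=> j; have := prob_run_end_age j measurableT.
    by rewrite exponential_lawE exponential_probT// mule1 preimage_setT setIT.
- exact: measurable_run_end.
- exact: trivIset_run_end.
- exact: fine_ge0.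
move=> j.
transitivity (P (E `&` (run_end a b j `&` age a b j @^-1` A))).
  congr (P _); apply/seteqP; split => w /=.
    by move=> [[Ew LA] wj]; split => //; split => //; rewrite /preimage/= -(hL _ _ wj).
  by move=> [Ew [wj LA]]; split => //; split => //; rewrite /preimage/= (hL _ _ wj).
rewrite prob_run_end_age// fineK// muleC; congr (_ * _).
have := prob_run_end_age j measurableT.
by rewrite exponential_lawE exponential_probT// mule1 preimage_setT setIT => ->.
Qed.

Lemma prob_runs_end : P (E `&` \bigcup_j run_end a b j) = (fine (P E) * p)%:E.
Proof.
apply: measure_bigcup_geometric => //.
- exact: measurable_run_end.
- exact: trivIset_run_end.
- move=> j; have := prob_run_end_age j measurableT.
  by rewrite exponential_lawE exponential_probT// mule1 preimage_setT setIT.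
Qed.

(** The weights of the next block do not depend on the length of the run, so the factorization on
    each piece passes to the union. *)
Lemma poisson_on_runs_end L a' b' (B : set (R * R * R)) As Bs :
  measurable_fun setT L -> (forall k, measurable_fun setT (a' k)) ->
  (forall k, measurable_fun setT (b' k)) -> next_block a b L a' b' ->
  measurable B -> all_measurable As -> all_measurable Bs ->
  P (E `&` (fun w => (a 0%N w, b 0%N w, L w)) @^-1` B `&` cylinder As a' `&`
     cylinder Bs b' `&` \bigcup_j run_end a b j) =
  P (E `&` (fun w => (a 0%N w, b 0%N w, L w)) @^-1` B `&` \bigcup_j run_end a b j) *
  (weight la As * weight mu Bs).
Proof.
move=> mL ma' mb' nb mB mAs mBs.
have /andP[wa0 waoo] := weight_fin la0 mAs.
have /andP[wb0 wboo] := weight_fin mu0 mBs.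
have wfin : weight la As * weight mu Bs \is a fin_num.
  by rewrite fin_numM// ge0_fin_numE.
have mxi : measurable (E `&` (fun w => (a 0%N w, b 0%N w, L w)) @^-1` B).
  apply: measurableI => //; apply: measurable_preimage mB.
  by apply: measurable_fun_pair => //; exact: measurable_fun_pair.
rewrite -(fineK wfin) muleC; apply: measure_bigcup_scale => //.
- exact: measurable_run_end.
- exact: trivIset_run_end.
- by apply: measurableI; [apply: measurableI => //|]; exact: measurable_cylinder.
- by rewrite fine_ge0// mule_ge0.
move=> j; rewrite fineK//.
have [_ _ _ hj] := poisson_on_run_end j mB.
rewrite (@cylinder_ext_eq _ _ _
  (cons_seq (fun w => arrival a j.+1 w - b 0%N w)%R (tail_seq a j.+2)) _ (shift_seq b)).
- have -> : E `&` (fun w => (a 0%N w, b 0%N w, L w)) @^-1` B `&` run_end a b j =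
     E `&` (run_end a b j `&` (fun w => (a 0%N w, b 0%N w, age a b j w)) @^-1` B).
    apply/seteqP; split => w /=.
      by move=> [[Ew LA] wj]; split => //; split => //; rewrite /preimage/=;
        have [<- _ _ _] := nb _ _ wj.
    by move=> [Ew [wj LA]]; split => //; split => //; rewrite /preimage/=;
      have [-> _ _ _] := nb _ _ wj.
  by rewrite hj// muleC.
- by move=> w /nb[_ a0 ak _] [|k]/=; [exact: a0|exact: ak].
- by move=> w /nb[_ _ _ bk] k; exact: bk.
Qed.

End OneSide.

Section TwoSides.
Variables (la mu : R) (la0 : (0 < la)%R) (mu0 : (0 < mu)%R).
Variables (E : set Omega) (a b : nat -> Omega -> R).
Hypothesis h : poisson_on P la mu E a b.

Let ab := \bigcup_j run_end a b j.
Let ba := \bigcup_j run_end b a j.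

Lemma measurable_runs_end : measurable ab /\ measurable ba.
Proof.
have [_ ma mb _] := h.
by split; apply: bigcupT_measurable => j;
  [exact: (measurable_run_end h)|exact: (measurable_run_end (poisson_onC h))].
Qed.

Lemma runs_end_disjoint : ab `&` ba = set0.
Proof.
apply/seteqP; split => // w [/run_end_lt/= h1 /run_end_lt/= h2].
by have := lt_trans h1 h2; rewrite ltxx.
Qed.

(** The two kinds of runs have fractions [p] and [1 - p] of the mass of [E]; nothing is left for
    ties and for runs without end. *)
Lemma prob_runs_end_full : P (E `\` (ab `|` ba)) = 0.
Proof.
have [mE ma mb _] := h; have [mab mba] := measurable_runs_end.
rewrite measureD//; last 2 first.
- exact: measurableU.
- by rewrite (le_lt_trans (probability_le1 P mE)) ?ltry.
rewrite setIUr measureU//; last 3 first.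
- exact: measurableI.
- exact: measurableI.
- by rewrite setIACA runs_end_disjoint setI0.
rewrite [X in _ - (X + _)](prob_runs_end la0 mu0 h).
rewrite [X in _ - (_ + X)](prob_runs_end mu0 la0 (poisson_onC h)).
rewrite -EFinD -mulrDr (addrC mu) -mulrDl divff ?gt_eqF ?addr_gt0// mulr1.
by rewrite fineK ?fin_num_measure// subee// fin_num_measure.
Qed.

Lemma prob_split_runs_end (G : set Omega) : measurable G -> G `<=` E ->
  P G = P (G `&` ab) + P (G `&` ba).
Proof.
move=> mG GE; have [mE ma mb _] := h; have [mab mba] := measurable_runs_end.
rewrite -measureU//; last 3 first.
- exact: measurableI.
- exact: measurableI.
- by rewrite setIACA runs_end_disjoint setI0.
rewrite -setIUr (measureDI P mG (measurableU _ _ mab mba)).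
rewrite [X in X + _](_ : _ = 0) ?add0e//.
apply: (subset_measure0 _ _ _ prob_runs_end_full).
- by apply: measurableD => //; exact: measurableU.
- by apply: measurableD => //; exact: measurableU.
- exact: setSD.
Qed.

(** The renewal property in the form used for induction: the data of a block join the past and the
    next block starts afresh, whichever process ends the run. *)
Lemma poisson_on_block L a' b' (B : set (R * R * R)) :
  measurable_fun setT L -> (forall k, measurable_fun setT (a' k)) ->
  (forall k, measurable_fun setT (b' k)) ->
  next_block a b L a' b' -> next_block b a L b' a' -> measurable B ->
  poisson_on P la mu (E `&` (fun w => (a 0%N w, b 0%N w, L w)) @^-1` B) a' b'.
Proof.
move=> mL ma' mb' nab nba mB; have [mE ma mb _] := h.
have mxi : measurable (E `&` (fun w => (a 0%N w, b 0%N w, L w)) @^-1` B).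
  apply: measurableI => //; apply: measurable_preimage mB.
  by apply: measurable_fun_pair => //; exact: measurable_fun_pair.
split => // As Bs mAs mBs.
(* The mirrored runs deliver the data with [a] and [b] exchanged. *)
have msw : measurable_fun setT (fun u : R * R * R => (u.1.2, u.1.1, u.2)).
  apply: measurable_fun_pair; last exact: measurable_snd.
  apply: measurable_fun_pair.
    by apply: measurableT_comp; [exact: measurable_snd|exact: measurable_fst].
  by apply: measurableT_comp; [exact: measurable_fst|exact: measurable_fst].
rewrite prob_split_runs_end; last 2 first.
- by apply: measurableI; [apply: measurableI => //|]; exact: measurable_cylinder.
- by move=> w [[[]]].
rewrite [in RHS]prob_split_runs_end//.
rewrite (poisson_on_runs_end la0 mu0 h mL ma' mb' nab mB mAs mBs).
have := poisson_on_runs_end mu0 la0 (poisson_onC h) mL mb' ma' nba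
  (measurable_preimage msw mB) mBs mAs.
rewrite [weight mu Bs * _]muleC => h2.
rewrite (setIAC _ (cylinder As a') (cylinder Bs b'))
  [X in _ + X]h2 -ge0_muleDl//; exact: measure_ge0.
Qed.

Lemma prob_lt_age L a' b' (A : set R) (lamu0 : (0 < la + mu)%R) :
  measurable_fun setT L -> next_block a b L a' b' -> measurable A ->
  P (E `&` [set w | a 0%N w < b 0%N w]%R `&` L @^-1` A) =
  (fine (P E) * (la / (la + mu)))%:E * exponential_law lamu0 A.
Proof.
move=> mL nab mA; have [mE ma mb _] := h.
rewrite prob_split_runs_end; last 2 first.
- apply: measurableI; last exact: measurable_preimage.
  by apply: measurableI => //; exact: measurable_set_ltr.
- by move=> w [[]].
(* A mirrored run has [b 0 < a 0], so its part of the event is empty. *)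
rewrite [X in _ + X](_ : _ = 0) ?adde0; last first.
  rewrite [X in P X](_ : _ = set0) ?measure0//; apply/seteqP; split => // w.
  by move=> [[[_ /= h1] _] /run_end_lt /= h2]; have := lt_trans h1 h2; rewrite ltxx.
rewrite -[RHS](prob_runs_end_age la0 mu0 h mA mL); last by move=> j w /nab[].
congr (P _); apply/seteqP; split => w /=.
  by move=> [[[? ?] ?] ?].
move=> [Ew [wab Lw]]; split => //; split => //; split => //.
exact: run_end_lt wab.
Qed.

End TwoSides.

End Block.

(** * Measurability of the synchronization *)

Section LeastGreatest.

Lemma least_eq (A : set nat) n : A n -> (forall j, A j -> (n <= j)%N) ->
  least A = n.
Proof.
move=> An nle; apply: xget_unique; first by split.
by move=> k [Ak kle]; apply/eqP; rewrite eqn_leq kle// nle.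
Qed.

Lemma least_none (A : set nat) : (forall j, ~ A j) -> least A = 0%N.
Proof. by move=> nA; rewrite /least xgetPN// => k [/nA]. Qed.

Lemma greatest_eq (A : set nat) n : A n -> (forall j, A j -> (j <= n)%N) ->
  greatest A = n.
Proof.
move=> An nle; apply: xget_unique; first by split.
by move=> k [Ak kle]; apply/eqP; rewrite eqn_leq kle// nle.
Qed.

Lemma greatest_none (A : set nat) :
  (forall n, ~ (A n /\ forall j, A j -> (j <= n)%N)) -> greatest A = 0%N.
Proof. by move=> nA; rewrite /greatest xgetPN// => k; exact: nA. Qed.

End LeastGreatest.

Section NatMeasurable.
Context d (Omega : measurableType d).
Implicit Types (f g N : Omega -> nat) (A : Omega -> set nat).

(** Stated by fibres because a random index is always handled by splitting over its countably many
    values. *)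
Definition nat_measurable f := forall n, measurable [set w | f w = n].

Lemma nat_measurable_cst n : nat_measurable (fun=> n).
Proof.
move=> m; have [->|nm] := eqVneq n m.
  by rewrite [X in measurable X](_ : _ = setT)//; apply/seteqP; split.
rewrite [X in measurable X](_ : _ = set0)//; apply/seteqP; split => // w /= nm'.
by rewrite nm' eqxx in nm.
Qed.

Lemma measurable_nat_comp d' (T' : measurableType d') (g : nat -> Omega -> T') N :
  nat_measurable N -> (forall n, measurable_fun setT (g n)) ->
  measurable_fun setT (fun w => g (N w) w).
Proof.
move=> mN mg _ B mB; rewrite setTI.
rewrite [X in measurable X](_ : _ =
    \bigcup_n ([set w | N w = n] `&` g n @^-1` B)).
  apply: bigcupT_measurable => n; apply: measurableI; first exact: mN.
  exact: measurable_preimage.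
by apply/seteqP; split => [w Bw|w [n _ [/= <-]]]//; exists (N w).
Qed.

Lemma nat_measurable_comp (g : nat -> Omega -> nat) N :
  nat_measurable N -> (forall n, nat_measurable (g n)) ->
  nat_measurable (fun w => g (N w) w).
Proof.
move=> mN mg m.
rewrite [X in measurable X](_ : _ =
    \bigcup_n ([set w | N w = n] `&` [set w | g n w = m])).
  by apply: bigcupT_measurable => n; apply: measurableI; [exact: mN|exact: mg].
by apply/seteqP; split => [w Bw|w [n _ [/= <-]]]//; exists (N w).
Qed.

Lemma nat_measurable_if (c : Omega -> bool) f g :
  measurable [set w | c w] -> nat_measurable f -> nat_measurable g ->
  nat_measurable (fun w => if c w then f w else g w).
Proof.
move=> mc mf mg n.
rewrite [X in measurable X](_ : _ = ([set w | c w] `&` [set w | f w = n]) `|`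
    (~` [set w | c w] `&` [set w | g w = n])).
  apply: measurableU; apply: measurableI => //; exact: measurableC.
apply/seteqP; split => w /=; first by case: (c w) => ?; [left|right].
by move=> [[->]//|[/negP/negbTE ->]].
Qed.

Lemma nat_measurable_least A : (forall k, measurable [set w | A w k]) ->
  nat_measurable (fun w => least (A w)).
Proof.
move=> mA n.
pose F := fun m => [set w | A w m] `&` \bigcap_(j < m) ~` [set w | A w j].
have mF m : measurable (F m).
  apply: measurableI => //; apply: bigcap_measurableType => //.
  by move=> j _; exact: measurableC.
have FE m w : F m w -> least (A w) = m.
  move=> [Am h]; apply: least_eq => // j Aj; rewrite leqNgt; apply/negP => jm.
  exact: (h _ jm).
(* The value 0 is special: it is also the default when the set is empty. *)
have [->|n0] := eqVneq n 0%N; last first.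
  rewrite [X in measurable X](_ : _ = F n)//; apply/seteqP; split => w /=; last first.
    exact: FE.
  move=> ln; have [[m Am]|] := pselect (exists m, A w m); last first.
    by move=> /forallNP /least_none; rewrite ln => /eqP; rewrite (negbTE n0).
  have /ex_minnP[k /asboolP Ak kmin] : exists m, `[< A w m >].
    by exists m; apply/asboolP.
  have kle j : A w j -> (k <= j)%N by move=> Aj; apply: kmin; exact/asboolP.
  have kn : k = n by rewrite -ln; apply/esym; exact: least_eq.
  by rewrite -kn; split => // j /= jk Aj; have := kle _ Aj; rewrite leqNgt jk.
rewrite [X in measurable X](_ : _ = F 0%N `|` \bigcap_j ~` [set w | A w j]).
  by apply: measurableU => //; apply: bigcapT_measurable => j; exact: measurableC.
apply/seteqP; split => w /=; last first.
  move=> [/FE//|h]; apply: least_none => j; exact: h.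
move=> ln; have [[m Am]|] := pselect (exists m, A w m); last first.
  by move=> /forallNP h; right => j _; exact: h.
have /ex_minnP[k /asboolP Ak kmin] : exists m, `[< A w m >].
  by exists m; apply/asboolP.
have kle j : A w j -> (k <= j)%N by move=> Aj; apply: kmin; exact/asboolP.
have k0 : k = 0%N by rewrite -ln; apply/esym; exact: least_eq.
by left; split; [rewrite -k0|].
Qed.

Lemma nat_measurable_greatest A : (forall k, measurable [set w | A w k]) ->
  nat_measurable (fun w => greatest (A w)).
Proof.
move=> mA n.
pose F := fun m => [set w | A w m] `&` \bigcap_(j in [set j | (m < j)%N])
  ~` [set w | A w j].
have mF m : measurable (F m).
  apply: measurableI => //; apply: bigcap_measurableType => //.
  by move=> j _; exact: measurableC.
have FP m w : F m w <-> (A w m /\ forall j, A w j -> (j <= m)%N).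
  split=> -[Am h]; split => // j; last by move=> mj Aj; have := h _ Aj; rewrite leqNgt mj.
  by move=> Aj; rewrite leqNgt; apply/negP => mj; exact: (h _ mj).
have FE m w : F m w -> greatest (A w) = m.
  by move=> /FP[Am h]; exact: greatest_eq.
(* The value 0 is special: it is also the default when there is no maximum. *)
have [->|n0] := eqVneq n 0%N; last first.
  rewrite [X in measurable X](_ : _ = F n)//; apply/seteqP; split => w /=; last first.
    exact: FE.
  move=> ln; have [[m Fm]|] := pselect (exists m, F m w).
    by rewrite -ln (FE _ _ Fm).
  move=> /forallNP h; have : greatest (A w) = 0%N.
    by apply: greatest_none => m /FP; exact: h.
  by rewrite ln => /eqP; rewrite (negbTE n0).
rewrite [X in measurable X](_ : _ = F 0%N `|` ~` \bigcup_m F m).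
  by apply: measurableU => //; apply: measurableC; exact: bigcupT_measurable.
apply/seteqP; split => w /=; last first.
  by move=> [/FE//|h]; apply: greatest_none => m /FP Fm; apply: h; exists m.
move=> ln; have [[m Fm]|] := pselect (exists m, F m w).
  by left; rewrite -ln (FE _ _ Fm).
by move=> /forallNP h; right => -[m _]; exact: h.
Qed.

End NatMeasurable.

Section SyncMeasurable.
Context (R : realType) d (Omega : measurableType d).
Variables (t tau : nat -> Omega -> R).
Hypotheses (mt : forall k, measurable_fun setT (t k))
  (mtau : forall k, measurable_fun setT (tau k)).

Let lt_meas (f g : Omega -> R) : measurable_fun setT f -> measurable_fun setT g ->
  measurable [set w | f w < g w].
Proof. exact: measurable_set_ltr. Qed.

Let le_meas (f g : Omega -> R) : measurable_fun setT f -> measurable_fun setT g ->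
  measurable [set w | f w <= g w].
Proof.
move=> mf mg; rewrite [X in measurable X](_ : _ = ~` [set w | g w < f w]).
  by apply: measurableC; exact: measurable_set_ltr.
by apply/seteqP; split => w /=; rewrite leNgt => /negP.
Qed.

Let eq_meas (f g : Omega -> R) : measurable_fun setT f -> measurable_fun setT g ->
  measurable [set w | f w == g w].
Proof.
move=> mf mg; rewrite [X in measurable X](_ : _ =
    [set w | f w <= g w] `&` [set w | g w <= f w]).
  by apply: measurableI; exact: le_meas.
by apply/seteqP; split => w /=; rewrite eq_le => /andP.
Qed.

Lemma nat_measurable_step_mu q r :
  nat_measurable (fun w => step_mu (t ^~ w) (tau ^~ w) q r).
Proof.
apply: nat_measurable_if; first exact: lt_meas; last exact: nat_measurable_cst.
apply: nat_measurable_least => k; case: (leqP q.+1 k) => qk.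
  by rewrite [X in measurable X](_ : _ = [set w | tau r w <= t k w]);
    [exact: le_meas|apply/seteqP; split => w /=; [case|]].
rewrite [X in measurable X](_ : _ = set0)//.
by apply/seteqP; split => w //= -[]; rewrite ltnNge -ltnS qk.
Qed.

Lemma nat_measurable_step_w q r :
  nat_measurable (fun w => step_w (t ^~ w) (tau ^~ w) q r).
Proof.
apply: nat_measurable_if; first exact: lt_meas; last exact: nat_measurable_cst.
apply: nat_measurable_least => k; case: (leqP r.+1 k) => rk.
  by rewrite [X in measurable X](_ : _ = [set w | t q w <= tau k w]);
    [exact: le_meas|apply/seteqP; split => w /=; [case|]].
rewrite [X in measurable X](_ : _ = set0)//.
by apply/seteqP; split => w //= -[]; rewrite ltnNge -ltnS rk.
Qed.

Lemma nat_measurable_succ (f : Omega -> nat) : nat_measurable f ->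
  nat_measurable (fun w => (f w).+1).
Proof.
by move=> mf; apply: (nat_measurable_comp (g := fun n _ => n.+1) mf) => n;
  exact: nat_measurable_cst.
Qed.

Lemma nat_measurable_sync_step q r :
  nat_measurable (fun w => (sync_step (t ^~ w) (tau ^~ w) (q, r)).1) /\
  nat_measurable (fun w => (sync_step (t ^~ w) (tau ^~ w) (q, r)).2).
Proof.
have mmu := nat_measurable_step_mu q r.
have mw := nat_measurable_step_w q r.
split.
- under [X in nat_measurable X]eq_fun do rewrite /sync_step !(fun_if fst)/=.
  apply: nat_measurable_if; first exact: lt_meas.
    apply: nat_measurable_if => //; last exact: nat_measurable_succ.
    by apply: eq_meas => //; exact: measurable_nat_comp.
  apply: nat_measurable_if; first exact: eq_meas; exact: nat_measurable_cst.
- under [X in nat_measurable X]eq_fun do rewrite /sync_step !(fun_if snd)/=.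
  apply: nat_measurable_if; first exact: lt_meas.
    exact: nat_measurable_cst.
  apply: nat_measurable_if; first exact: eq_meas.
    exact: nat_measurable_cst.
  apply: nat_measurable_if => //; last exact: nat_measurable_succ.
  by apply: eq_meas => //; exact: measurable_nat_comp.
Qed.

Lemma nat_measurable_sync i :
  nat_measurable (fun w => sync_q (t ^~ w) (tau ^~ w) i) /\
  nat_measurable (fun w => sync_r (t ^~ w) (tau ^~ w) i).
Proof.
elim: i => [|i [IHq IHr]]; first by split; exact: nat_measurable_cst.
split.
- have -> : (fun w => sync_q (t ^~ w) (tau ^~ w) i.+1) = (fun w =>
    (sync_step (t ^~ w) (tau ^~ w)
      (sync_q (t ^~ w) (tau ^~ w) i, sync_r (t ^~ w) (tau ^~ w) i)).1).
    by apply/funext => w; rewrite /sync_q /sync_r iterS -surjective_pairing.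
  apply: (nat_measurable_comp (g := fun q w => (sync_step (t ^~ w) (tau ^~ w)
    (q, sync_r (t ^~ w) (tau ^~ w) i)).1) IHq) => q.
  apply: (nat_measurable_comp (g := fun r w => (sync_step (t ^~ w) (tau ^~ w)
    (q, r)).1) IHr) => r.
  by have [] := nat_measurable_sync_step q r.
- have -> : (fun w => sync_r (t ^~ w) (tau ^~ w) i.+1) = (fun w =>
    (sync_step (t ^~ w) (tau ^~ w)
      (sync_q (t ^~ w) (tau ^~ w) i, sync_r (t ^~ w) (tau ^~ w) i)).2).
    by apply/funext => w; rewrite /sync_q /sync_r iterS -surjective_pairing.
  apply: (nat_measurable_comp (g := fun q w => (sync_step (t ^~ w) (tau ^~ w)
    (q, sync_r (t ^~ w) (tau ^~ w) i)).2) IHq) => q.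
  apply: (nat_measurable_comp (g := fun r w => (sync_step (t ^~ w) (tau ^~ w)
    (q, r)).2) IHr) => r.
  by have [] := nat_measurable_sync_step q r.
Qed.

Let mq i : nat_measurable (fun w => sync_q (t ^~ w) (tau ^~ w) i).
Proof. by have [] := nat_measurable_sync i. Qed.

Let mr i : nat_measurable (fun w => sync_r (t ^~ w) (tau ^~ w) i).
Proof. by have [] := nat_measurable_sync i. Qed.

Lemma measurable_sync_g i :
  measurable_fun setT (fun w => sync_g (t ^~ w) (tau ^~ w) i).
Proof.
apply: measurable_nat_comp => //.
apply: (nat_measurable_comp (g := fun q w => step_mu (t ^~ w) (tau ^~ w) q
  (sync_r (t ^~ w) (tau ^~ w) i)) (mq i)) => q.
apply: (nat_measurable_comp (g := fun r w => step_mu (t ^~ w) (tau ^~ w) q r) (mr i)).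
exact: nat_measurable_step_mu.
Qed.

Lemma measurable_sync_gamma i :
  measurable_fun setT (fun w => sync_gamma (t ^~ w) (tau ^~ w) i).
Proof.
apply: measurable_nat_comp => //.
apply: (nat_measurable_comp (g := fun q w => step_w (t ^~ w) (tau ^~ w) q
  (sync_r (t ^~ w) (tau ^~ w) i)) (mq i)) => q.
apply: (nat_measurable_comp (g := fun r w => step_w (t ^~ w) (tau ^~ w) q r) (mr i)).
exact: nat_measurable_step_w.
Qed.

Lemma measurable_sync_l i :
  measurable_fun setT (fun w => sync_l (t ^~ w) (tau ^~ w) i).
Proof. exact: (measurable_nat_comp (g := fun q => t q.-1) (mq i)). Qed.

Lemma measurable_sync_lambda i :
  measurable_fun setT (fun w => sync_lambda (t ^~ w) (tau ^~ w) i).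
Proof. exact: (measurable_nat_comp (g := fun r => tau r.-1) (mr i)). Qed.

Lemma measurable_sync_T i :
  measurable_fun setT (fun w => sync_T (t ^~ w) (tau ^~ w) i).
Proof.
by apply: measurable_minr; [exact: measurable_sync_g|exact: measurable_sync_gamma].
Qed.

Lemma measurable_sync_DT i :
  measurable_fun setT (fun w => sync_DT (t ^~ w) (tau ^~ w) i).
Proof. by apply: measurable_funB; exact: measurable_sync_T. Qed.

Lemma nat_measurable_sync_N T :
  nat_measurable (fun w => sync_N (t ^~ w) (tau ^~ w) T).
Proof.
apply: nat_measurable_greatest => k.
by apply: le_meas => //; exact: measurable_sync_T.
Qed.

Lemma measurable_sum_cond (f : nat -> Omega -> R) (u : nat -> Omega -> R) (s : R)
    (m n : nat) : (forall k, measurable_fun setT (f k)) ->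
  (forall k, measurable_fun setT (u k)) ->
  measurable_fun setT (fun w => \sum_(m <= i < n | u i w <= s) f i w).
Proof.
move=> mf mu.
have -> : (fun w => \sum_(m <= i < n | u i w <= s) f i w) =
    (fun w => \sum_(i <- index_iota m n) (if u i w <= s then f i w else 0)).
  by apply/funext => w; rewrite big_mkcond.
apply: measurable_sum => i; apply: measurable_fun_ifT => //.
exact: measurable_fun_ler.
Qed.

Lemma measurable_qvar_G (T s : R) :
  measurable_fun setT (fun w => qvar_G (t ^~ w) (tau ^~ w) T s).
Proof.
apply: (measurable_nat_comp (g := fun N w => N%:R / T *
  \sum_(1 <= i < N.+1 | sync_T (t ^~ w) (tau ^~ w) i <= s)
    sync_DT (t ^~ w) (tau ^~ w) i ^+ 2) (nat_measurable_sync_N T)) => N.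
apply: measurable_funM => //; apply: measurable_sum_cond => k.
  by apply: measurable_funX; exact: measurable_sync_DT.
exact: measurable_sync_T.
Qed.

Lemma measurable_qvar_F (T s : R) :
  measurable_fun setT (fun w => qvar_F (t ^~ w) (tau ^~ w) T s).
Proof.
apply: (measurable_nat_comp (g := fun N w => N%:R / T *
  \sum_(1 <= i < N | sync_T (t ^~ w) (tau ^~ w) i.+1 <= s)
    ((sync_T (t ^~ w) (tau ^~ w) i - sync_lambda (t ^~ w) (tau ^~ w) i) *
       (sync_g (t ^~ w) (tau ^~ w) i - sync_T (t ^~ w) (tau ^~ w) i)
     + (sync_T (t ^~ w) (tau ^~ w) i - sync_l (t ^~ w) (tau ^~ w) i) *
       (sync_gamma (t ^~ w) (tau ^~ w) i - sync_T (t ^~ w) (tau ^~ w) i)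
     + sync_DT (t ^~ w) (tau ^~ w) i.+1 *
       (sync_T (t ^~ w) (tau ^~ w) i - sync_l (t ^~ w) (tau ^~ w) i.+1)
     + sync_DT (t ^~ w) (tau ^~ w) i.+1 *
       (sync_T (t ^~ w) (tau ^~ w) i - sync_lambda (t ^~ w) (tau ^~ w) i.+1)))
  (nat_measurable_sync_N T)) => N.
have mT := measurable_sync_T; have ml := measurable_sync_l.
have mla := measurable_sync_lambda; have mg := measurable_sync_g.
have mga := measurable_sync_gamma; have mD := measurable_sync_DT.
apply: measurable_funM => //; apply: measurable_sum_cond => k; last exact: mT.
by do ?[apply: measurable_funB => //|apply: measurable_funM|apply: measurable_funD].
Qed.

Lemma measurable_qvar_H (T s : R) :
  measurable_fun setT (fun w => qvar_H (t ^~ w) (tau ^~ w) T s).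
Proof.
apply: (measurable_nat_comp (g := fun N w => N%:R / T *
  \sum_(1 <= i < N | sync_T (t ^~ w) (tau ^~ w) i.+1 <= s)
    ((sync_T (t ^~ w) (tau ^~ w) i - sync_l (t ^~ w) (tau ^~ w) i.+1) *
       (sync_g (t ^~ w) (tau ^~ w) i - sync_T (t ^~ w) (tau ^~ w) i)
     + (sync_T (t ^~ w) (tau ^~ w) i - sync_lambda (t ^~ w) (tau ^~ w) i.+1) *
       (sync_gamma (t ^~ w) (tau ^~ w) i - sync_T (t ^~ w) (tau ^~ w) i)))
  (nat_measurable_sync_N T)) => N.
have mT := measurable_sync_T; have ml := measurable_sync_l.
have mla := measurable_sync_lambda; have mg := measurable_sync_g.
have mga := measurable_sync_gamma.
apply: measurable_funM => //; apply: measurable_sum_cond => k; last exact: mT.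
by do ?[apply: measurable_funB => //|apply: measurable_funM|apply: measurable_funD].
Qed.

End SyncMeasurable.

(** * Steps of the synchronization *)

Section SyncSteps.
Context (R : realType).
Implicit Types u v : nat -> R.

Lemma sync_qrS u v i : (sync_q u v i.+1, sync_r u v i.+1) =
  sync_step u v (sync_q u v i, sync_r u v i).
Proof. by rewrite /sync_q /sync_r iterS -!surjective_pairing. Qed.

(** The algorithm treats the two processes alike, so pathwise facts are proved for runs of [u] ended
    by [v] and transported to the other case. *)
Lemma sync_step_swap u v q r : sync_step v u (r, q) =
  ((sync_step u v (q, r)).2, (sync_step u v (q, r)).1).
Proof.
rewrite /sync_step -/(step_w u v q r) -/(step_mu u v q r).
case: (ltgtP (u q) (v r)) => [uv|uv|uv].
- by rewrite -[step_w v u r q]/(step_mu u v q r); case: ifP.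
- by rewrite -[step_mu v u r q]/(step_w u v q r); case: ifP.
- by [].
Qed.

Lemma sync_swap u v i :
  sync_q v u i = sync_r u v i /\ sync_r v u i = sync_q u v i.
Proof.
elim: i => [//|i [IHq IHr]].
have := sync_qrS v u i; rewrite IHq IHr sync_step_swap -sync_qrS /=.
by case.
Qed.

Lemma sync_q_swap u v i : sync_q v u i = sync_r u v i.
Proof. by have [] := sync_swap u v i. Qed.

Lemma sync_r_swap u v i : sync_r v u i = sync_q u v i.
Proof. by have [] := sync_swap u v i. Qed.

Lemma sync_g_swap u v i : sync_g v u i = sync_gamma u v i.
Proof. by rewrite /sync_g /sync_gamma (sync_q_swap u v) (sync_r_swap u v). Qed.

Lemma sync_gamma_swap u v i : sync_gamma v u i = sync_g u v i.
Proof. by rewrite /sync_g /sync_gamma (sync_q_swap u v) (sync_r_swap u v). Qed.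

Lemma sync_T_swap u v i : sync_T v u i = sync_T u v i.
Proof. by rewrite /sync_T (sync_g_swap u v) (sync_gamma_swap u v) minC. Qed.

Lemma sync_l_swap u v i : sync_l v u i = sync_lambda u v i.
Proof. by rewrite /sync_l /sync_lambda (sync_q_swap u v). Qed.

Lemma sync_lambda_swap u v i : sync_lambda v u i = sync_l u v i.
Proof. by rewrite /sync_l /sync_lambda (sync_r_swap u v). Qed.

(** Time 0 stands for the missing predecessor of [T_0], as the first waiting times are measured from
    0. *)
Definition prev_T u v i : R := if i is i'.+1 then sync_T u v i' else 0.

Lemma prev_T_swap u v i : prev_T v u i = prev_T u v i.
Proof. by case: i => //= i; exact: sync_T_swap. Qed.

(* The waiting times of [u] that remain after the [i]-th synchronized time; those
   of [v] are [resid v u i]. *)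
Definition resid u v i k : R :=
  if k is k'.+1 then u (sync_q u v i + k)%N - u (sync_q u v i + k')%N
  else u (sync_q u v i) - prev_T u v i.

(* Time elapsed since the last observation of the process that is not observed
   at time [sync_T u v i]; the other one of the two summands vanishes. *)
Definition last_age u v i : R :=
  (sync_T u v i - sync_l u v i.+1) + (sync_T u v i - sync_lambda u v i.+1).

Lemma last_age_swap u v i : last_age v u i = last_age u v i.
Proof.
by rewrite /last_age (sync_T_swap u v) (sync_l_swap u v) (sync_lambda_swap u v) addrC.
Qed.

Lemma sum_resid u v i j :
  \sum_(k < j.+1) resid u v i k = u (sync_q u v i + j)%N - prev_T u v i.
Proof.
elim: j => [|j IH]; first by rewrite big_ord1 addn0.
by rewrite big_ord_recr/= IH addrC addrA subrK.
Qed.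

(** The pathwise form of [run_end] for the residual sequences; the two are convertible. *)
Definition ends_run u v i j : Prop :=
  (forall k, (k <= j)%N -> \sum_(l < k.+1) resid u v i l < resid v u i 0) /\
  resid v u i 0 < \sum_(l < j.+2) resid u v i l.

Lemma ends_run_step u v i j : ends_run u v i j ->
  [/\ sync_q u v i.+1 = (sync_q u v i + j.+1)%N,
      sync_r u v i.+1 = (sync_r u v i).+1,
      sync_g u v i = u (sync_q u v i + j.+1)%N,
      sync_gamma u v i = v (sync_r u v i) &
      sync_T u v i = v (sync_r u v i)].
Proof.
move=> [h1]; rewrite sum_resid /= (prev_T_swap u v) (sync_q_swap u v) ltrBlDr subrK => h2.
set q := sync_q u v i; set r := sync_r u v i.
have {}h1 k : (k <= j)%N -> u (q + k)%N < v r.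
  move=> /h1; rewrite sum_resid /= (prev_T_swap u v) (sync_q_swap u v).
  by rewrite ltrBlDr subrK.
have uqvr : u q < v r by have := h1 0%N (leq0n _); rewrite addn0.
(* All [u] up to index [q + j] lie before [v r] and the next one lies after it, so the latter
   attains the minimum. *)
have mu : step_mu u v q r = (q + j.+1)%N.
  rewrite /step_mu uqvr; apply: least_eq => /=.
    by rewrite addnS ltnS leq_addr -addnS ltW.
  move=> k [qk vk]; rewrite leqNgt; apply/negP => kj.
  have := h1 (k - q)%N; rewrite subnKC ?(ltnW qk)//.
  rewrite leq_subLR -ltnS -addnS => /(_ kj); rewrite ltNge => /negP; exact.
have wE : step_w u v q r = r by rewrite /step_w ltNge (ltW uqvr).
have := sync_qrS u v i; rewrite /sync_step -/q -/r uqvr.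
(* The strict inequality excludes a tie, so the next [q] is [mu] and not [mu + 1]. *)
rewrite mu (lt_eqF h2) => -[-> ->].
have gE : sync_g u v i = u (q + j.+1)%N by rewrite /sync_g -/q -/r mu.
have gaE : sync_gamma u v i = v r by rewrite /sync_gamma -/q -/r wE.
by split => //; rewrite /sync_T gE gaE min_r// ltW.
Qed.

(** [T_i] is an observation of [v] and [u] is next observed strictly later, so the overshoot of [u]
    beyond [T_i] is its new first wait, while [v] simply drops one waiting time. *)
Lemma ends_run_facts u v i j : ends_run u v i j ->
  [/\ resid u v i 0 < resid v u i 0,
      sync_T u v i - prev_T u v i = resid v u i 0,
      sync_gamma u v i = sync_T u v i,
      sync_g u v i - sync_T u v i = resid u v i.+1 0 &
      sync_lambda u v i.+1 = sync_T u v i] /\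
  [/\ last_age u v i = resid v u i 0 - \sum_(l < j.+1) resid u v i l,
      resid u v i.+1 0 = \sum_(l < j.+2) resid u v i l - resid v u i 0,
      forall k, resid u v i.+1 k.+1 = resid u v i (k + j.+2)%N &
      forall k, resid v u i.+1 k = resid v u i k.+1].
Proof.
move=> hr; have [qE rE gE gaE TE] := ends_run_step hr.
have yE : resid v u i 0 = v (sync_r u v i) - prev_T u v i.
  by rewrite /= (prev_T_swap u v) (sync_q_swap u v).
have laE : sync_lambda u v i.+1 = sync_T u v i by rewrite /sync_lambda rE TE.
split; split.
- by have := hr.1 0%N (leq0n _); rewrite big_ord1.
- by rewrite TE yE.
- by rewrite gaE TE.
- by rewrite gE /= qE.
- exact: laE.
- rewrite /last_age laE subrr addr0 TE /sync_l qE addnS /= sum_resid -/(resid v u i 0) yE.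
  by ring.
- by rewrite sum_resid yE /= qE TE; ring.
- move=> k; rewrite (addnS k) /= qE -!addnA; congr (u _ - u _).
    by rewrite addSnnS -!addnS (addnC k) // !addSn !addnS addnC.
  by rewrite (addnC k).
- case=> [|k]; rewrite /= !(sync_q_swap u v) rE.
    by rewrite (sync_T_swap u v) TE addn0 addn1.
  by rewrite !addSnnS.
Qed.

(** The almost sure properties of a step: nonnegativity allows absolute values to be removed, and
    the end of a run rules out ties and default values of [least]. *)
Definition good_step u v i : Prop :=
  [/\ 0 <= resid u v i 0, 0 <= resid v u i 0 &
      (exists j, ends_run u v i j) \/ (exists j, ends_run v u i j)].

(** On good steps, the indicator that [T_i] is an observation of [v]. As a factor 0 or 1 it replaces
    the case distinction of the algorithm, so that the summands become sums of products. *)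
Definition tau_last u v i : R :=
  (resid u v i 0 < resid v u i 0)%R%:R.

Definition block_length u v i : R := Num.max (resid u v i 0) (resid v u i 0).

Lemma good_step_cases u v i : good_step u v i ->
  [/\ tau_last u v i = 1, tau_last v u i = 0, 0 <= last_age u v i &
   [/\ sync_T u v i - prev_T u v i = resid v u i 0,
      block_length u v i = resid v u i 0,
      sync_gamma u v i = sync_T u v i,
      sync_g u v i = sync_T u v i + resid u v i.+1 0 &
      sync_lambda u v i.+1 = sync_T u v i /\
      sync_T u v i - sync_l u v i.+1 = last_age u v i]] \/
  [/\ tau_last u v i = 0, tau_last v u i = 1, 0 <= last_age u v i &
   [/\ sync_T u v i - prev_T u v i = resid u v i 0,
      block_length u v i = resid u v i 0,
      sync_g u v i = sync_T u v i,
      sync_gamma u v i = sync_T u v i + resid v u i.+1 0 &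
      sync_l u v i.+1 = sync_T u v i /\
      sync_T u v i - sync_lambda u v i.+1 = last_age u v i]].
Proof.
move=> [x0 y0 [[j hr]|[j hr]]]; [left|right];
  have [[xy TE gaE gE laE] [LE _ _ _]] := ends_run_facts hr.
- split.
  + by rewrite /tau_last xy.
  + by rewrite /tau_last ltNge (ltW xy).
  + by rewrite LE subr_ge0 ltW//; apply: hr.1.
  + split=> //; last by rewrite /last_age laE subrr addr0.
      by rewrite /block_length max_r// ltW.
    by rewrite -gE addrC subrK.
- split.
  + by rewrite /tau_last ltNge (ltW xy).
  + by rewrite /tau_last xy.
  + by rewrite -last_age_swap LE subr_ge0 ltW//; apply: hr.1.
  + move: TE gaE gE laE; rewrite (prev_T_swap u v) !(sync_T_swap u v) (sync_gamma_swap u v).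
    rewrite (sync_g_swap u v) (sync_lambda_swap u v) => TE gaE gE laE.
    split=> //; last by rewrite /last_age laE subrr add0r.
      by rewrite /block_length max_l// ltW.
    by rewrite -gE addrC subrK.
Qed.

Lemma good_step_length u v i : good_step u v i ->
  sync_T u v i - prev_T u v i = block_length u v i.
Proof. by move=> /good_step_cases[[_ _ _ [-> -> _ _ _]]|[_ _ _ [-> -> _ _ _]]]. Qed.

Lemma sync_T_sum u v k : (forall i, (i <= k)%N -> good_step u v i) ->
  sync_T u v k = \sum_(i < k.+1) block_length u v i.
Proof.
elim: k => [|k IH] h.
  by rewrite big_ord1 -good_step_length ?subr0//; exact: h.
rewrite big_ord_recr/= -IH; last by move=> i ik; apply: h; exact: leqW.
by have /= <- := good_step_length (h _ (leqnn k.+1)); rewrite addrC subrK.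
Qed.

Lemma sync_DT_length u v i : good_step u v i.+1 ->
  sync_DT u v i.+1 = block_length u v i.+1.
Proof. by move=> /good_step_length <-. Qed.

Lemma H_term u v i : good_step u v i ->
  (sync_T u v i - sync_l u v i.+1) * (sync_g u v i - sync_T u v i)
  + (sync_T u v i - sync_lambda u v i.+1) * (sync_gamma u v i - sync_T u v i) =
  tau_last u v i * last_age u v i * resid u v i.+1 0
  + tau_last v u i * last_age u v i * resid v u i.+1 0.
Proof.
move=> /good_step_cases[[-> -> _ [_ _ -> -> [-> ->]]]|[-> -> _ [_ _ -> -> [-> ->]]]].
  by ring.
by ring.
Qed.

Lemma good_step_ages u v i : good_step u v i ->
  sync_T u v i - sync_l u v i.+1 = tau_last u v i * last_age u v i /\
  sync_T u v i - sync_lambda u v i.+1 = tau_last v u i * last_age u v i.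
Proof.
move=> /good_step_cases[[-> -> _ [_ _ _ _ [-> ->]]]|[-> -> _ [_ _ _ _ [-> ->]]]].
  by split; ring.
by split; ring.
Qed.

(** The last observation of a process before [T_{i+1}] may precede [T_i]: the elapsed time is then
    the block length plus the age left by the step before. Multiplied by a residual after [T_{i+1}],
    this gives terms that span three blocks. *)
Lemma F_term u v i : good_step u v i -> good_step u v i.+1 ->
  good_step u v i.+2 ->
  (sync_T u v i.+1 - sync_lambda u v i.+1) * (sync_g u v i.+1 - sync_T u v i.+1)
  + (sync_T u v i.+1 - sync_l u v i.+1) * (sync_gamma u v i.+1 - sync_T u v i.+1)
  + sync_DT u v i.+2 * (sync_T u v i.+1 - sync_l u v i.+2)
  + sync_DT u v i.+2 * (sync_T u v i.+1 - sync_lambda u v i.+2) =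
  tau_last u v i.+1 * resid v u i.+1 0 * resid u v i.+2 0
  + tau_last v u i * last_age u v i * tau_last u v i.+1 * resid u v i.+2 0
  + tau_last v u i.+1 * resid u v i.+1 0 * resid v u i.+2 0
  + tau_last u v i * last_age u v i * tau_last v u i.+1 * resid v u i.+2 0
  + tau_last u v i.+1 * last_age u v i.+1 * block_length u v i.+2
  + tau_last v u i.+1 * last_age u v i.+1 * block_length u v i.+2.
Proof.
move=> g0 g1 g2; rewrite sync_DT_length//.
have [l0 la0] := good_step_ages g0.
have [l1 la1] := good_step_ages g1.
rewrite l1 la1.
have -> : sync_T u v i.+1 - sync_lambda u v i.+1 =
    (sync_T u v i.+1 - sync_T u v i) + tau_last v u i * last_age u v i.
  by rewrite -la0; ring.
have -> : sync_T u v i.+1 - sync_l u v i.+1 =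
    (sync_T u v i.+1 - sync_T u v i) + tau_last u v i * last_age u v i.
  by rewrite -l0; ring.
case: (good_step_cases g1) => [[-> -> _ [TE _ -> -> _]]|[-> -> _ [TE _ -> -> _]]];
  rewrite [sync_T u v i.+1 - sync_T u v i]TE; ring.
Qed.

End SyncSteps.

(** * A mean-square law of large numbers *)

Section MeanSquareLLN.
Context (R : realType) d (Omega : measurableType d) (P : probability Omega R).
Local Open Scope ereal_scope.

Definition mean (f : Omega -> R) : \bar R := \int[P]_w (f w)%:E.

Lemma meanD (f g : Omega -> R) : measurable_fun setT f -> measurable_fun setT g ->
  (forall w, 0 <= f w)%R -> (forall w, 0 <= g w)%R ->
  mean (fun w => f w + g w)%R = mean f + mean g.
Proof.
move=> mf mg f0 g0; rewrite /mean -ge0_integralD//.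
- by move=> w _; rewrite lee_fin.
- exact/measurable_EFinP.
- by move=> w _; rewrite lee_fin.
- exact/measurable_EFinP.
Qed.

Lemma meanZ (c : R) (f : Omega -> R) : measurable_fun setT f -> (0 <= c)%R ->
  (forall w, 0 <= f w)%R -> mean (fun w => c * f w)%R = c%:E * mean f.
Proof.
move=> mf c0 f0; rewrite /mean -ge0_integralZl//.
- exact/measurable_EFinP.
- by move=> w _; rewrite lee_fin.
Qed.

Lemma mean_le (f g : Omega -> R) : measurable_fun setT f -> measurable_fun setT g ->
  (forall w, 0 <= f w <= g w)%R -> mean f <= mean g.
Proof.
move=> mf mg fg; apply: ge0_le_integral => //.
- by move=> w _; rewrite lee_fin; case/andP: (fg w).
- exact/measurable_EFinP.
- exact/measurable_EFinP.
- by move=> w _; rewrite lee_fin; case/andP: (fg w).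
Qed.

Lemma mean_ge0 (f : Omega -> R) : (forall w, 0 <= f w)%R -> 0 <= mean f.
Proof. by move=> f0; apply: integral_ge0 => w _; rewrite lee_fin. Qed.

Lemma mean_cst (c : R) : mean (fun=> c) = c%:E.
Proof.
rewrite /mean (eq_integral (cst c%:E))// integral_cst//.
by rewrite [X in _ * X](probability_setT P) mule1.
Qed.

(** A variance bound linear in the number of terms. It can be made uniform in [n], and it is stable
    under sums, delays and products of a predictable factor with an innovation. *)
Definition mean_lln (Z : nat -> Omega -> R) (c C : R) : Prop :=
  (forall i, measurable_fun setT (Z i)) /\
  forall k, mean (fun w => (\sum_(i < k) (Z i w - c)) ^+ 2)%R <= (C * k%:R)%:E.

Let measurable_centered_sum (Z : nat -> Omega -> R) (c : R) k :
  (forall i, measurable_fun setT (Z i)) ->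
  measurable_fun setT (fun w => \sum_(i < k) (Z i w - c))%R.
Proof. by move=> mZ; apply: measurable_sum => i; exact: measurable_funB. Qed.

Lemma mean_lln_cst (c : R) : mean_lln (fun _ _ => c) c 0.
Proof.
split=> // k; rewrite mul0r.
rewrite [X in mean X](_ : _ = fun=> 0%R) ?mean_cst//.
by apply/funext => w; rewrite big1 ?expr0n// => i _; rewrite subrr.
Qed.

Lemma mean_sqrD (f g : Omega -> R) (a b : R) :
  measurable_fun setT f -> measurable_fun setT g ->
  mean (fun w => f w ^+ 2)%R <= a%:E -> mean (fun w => g w ^+ 2)%R <= b%:E ->
  mean (fun w => (f w + g w) ^+ 2)%R <= (2 * a + 2 * b)%:E.
Proof.
move=> mf mg fa gb.
apply: (@le_trans _ _ (mean (fun w => 2 * f w ^+ 2 + 2 * g w ^+ 2)%R)).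
  apply: mean_le.
  - by apply: measurable_funX; exact: measurable_funD.
  - apply: measurable_funD; apply: measurable_funM => //; exact: measurable_funX.
  - move=> w; rewrite sqr_ge0/=; have := sqr_ge0 (f w - g w); nra.
have mf2 : measurable_fun setT (fun w => f w ^+ 2)%R by exact: measurable_funX.
have mg2 : measurable_fun setT (fun w => g w ^+ 2)%R by exact: measurable_funX.
rewrite meanD.
- rewrite !meanZ// => [|w|w]; rewrite ?sqr_ge0//.
  have -> : (2 * a + 2 * b)%:E = 2%:E * a%:E + 2%:E * b%:E by [].
  by apply: leeD; apply: lee_wpmul2l; rewrite ?lee_fin.
- exact: measurable_funM.
- exact: measurable_funM.
- by move=> w; rewrite mulr_ge0 ?sqr_ge0.
- by move=> w; rewrite mulr_ge0 ?sqr_ge0.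
Qed.

Lemma mean_lln_add (Z Z' : nat -> Omega -> R) (c c' C C' : R) :
  mean_lln Z c C -> mean_lln Z' c' C' ->
  mean_lln (fun i w => Z i w + Z' i w)%R (c + c') (2 * C + 2 * C').
Proof.
move=> [mZ hZ] [mZ' hZ']; split=> [i|k]; first exact: measurable_funD.
rewrite [X in mean X](_ : _ = (fun w => (\sum_(i < k) (Z i w - c) +
    \sum_(i < k) (Z' i w - c')) ^+ 2)%R); last first.
  apply/funext => w; rewrite -big_split/=; congr (_ ^+ 2)%R.
  by apply: eq_bigr => i _; ring.
rewrite mulrDl -!mulrA; apply: mean_sqrD => //; exact: measurable_centered_sum.
Qed.

(** A shift by one block, which turns an innovation into a predictable factor. *)
Definition delay (Z : nat -> Omega -> R) : nat -> Omega -> R :=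
  fun k => if k is k'.+1 then Z k' else fun=> 0%R.

Lemma mean_lln_delay (Z : nat -> Omega -> R) (c C : R) : (0 <= C)%R ->
  mean_lln Z c C -> mean_lln (delay Z) c (2 * C + 2 * c ^+ 2).
Proof.
move=> C0 [mZ hZ]; split=> [[|i]|k] //=.
case: k => [|k].
  rewrite mulr0 [X in mean X](_ : _ = fun=> 0%R) ?mean_cst//.
  by apply/funext => w; rewrite big_ord0 expr0n.
(* The initial 0 contributes the constant error [- c], whose square is absorbed since there is at
   least one term. *)
rewrite [X in mean X](_ : _ =
    (fun w => (\sum_(i < k) (Z i w - c) + cst (- c) w) ^+ 2)%R); last first.
  by apply/funext => w; rewrite big_ord_recl/= sub0r addrC.
apply: (@le_trans _ _ (2 * (C * k%:R) + 2 * c ^+ 2)%:E).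
  apply: mean_sqrD => //; first exact: measurable_centered_sum.
  by rewrite (mean_cst ((- c) ^+ 2)) sqrrN.
rewrite lee_fin -[k.+1]addn1 natrD.
have := sqr_ge0 c; have : (0 <= k%:R :> R)%R by exact: ler0n.
nra.
Qed.

Lemma mean_lln_markov (Z : nat -> Omega -> R) (c C eps : R) k :
  mean_lln Z c C -> (0 < eps)%R ->
  P [set w | eps <= `|\sum_(i < k) (Z i w - c)| ]%R <= (C * k%:R / eps ^+ 2)%:E.
Proof.
move=> [mZ hZ] e0.
have mS := measurable_centered_sum c k mZ.
set A := [set w | _].
have mA : measurable A.
  rewrite /A [X in measurable X](_ : _ =
      ~` [set w | `|\sum_(i < k) (Z i w - c)| < eps]%R).
    apply: measurableC; apply: measurable_set_ltr => //.
    exact: measurableT_comp.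
  by apply/seteqP; split => w /=; rewrite leNgt => /negP.
have e20 : (0 < eps ^+ 2)%R by rewrite exprn_gt0.
rewrite -(fineK (fin_num_measure P _ mA)) lee_fin ler_pdivlMr//.
rewrite -lee_fin mulrC EFinM fineK ?fin_num_measure//; apply: le_trans (hZ k).
rewrite [X in _ * X](_ : _ = mean (\1_A)); last first.
  by rewrite /mean integral_indic// setIT.
rewrite -meanZ//; last exact: ltW.
apply: mean_le.
- exact: measurable_funM.
- exact: measurable_funX.
move=> w; rewrite mulr_ge0 ?(ltW e20)//= indicE.
have [wA|_] := boolP (w \in A); last by rewrite mulr0 sqr_ge0.
rewrite mulr1 -[X in (_ <= X)%R]real_normK ?num_real//.
by rewrite lerXn2r ?nnegrE ?(ltW e0)//; rewrite inE in wA.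
Qed.


(** * Martingale differences with constant conditional moments *)

Section Filtration.
Variable G : nat -> set (set Omega).
Hypothesis G_measurable : forall k, G k `<=` measurable.
Hypothesis G_nd : forall k, G k `<=` G k.+1.

Definition adapted_at k (f : Omega -> R) : Prop :=
  measurable_fun setT (f : g_sigma_algebraType (G k) -> R).

(** The conditional expectation given the past, tested on events; a constant suffices, as the
    innovations are independent of the past. *)
Definition cond_mean k (f : Omega -> R) (c : R) : Prop :=
  forall E, <<s G k >> E -> \int[P]_(w in E) (f w)%:E = c%:E * P E.

Lemma sub_filtration k : <<s G k >> `<=` measurable.
Proof. by apply: smallest_sub; [exact: sigma_algebra_measurable|exact: G_measurable]. Qed.

Lemma adapted_at_measurable k f : adapted_at k f -> measurable_fun setT f.
Proof.
by move=> mf _ B mB; apply: (@sub_filtration k); exact: mf.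
Qed.

Lemma adapted_atS k f : adapted_at k f -> adapted_at k.+1 f.
Proof.
move=> mf _ B mB; have := mf measurableT B mB.
apply: smallest_sub; first exact: smallest_sigma_algebra.
by move=> A /G_nd GA; exact: sub_sigma_algebra.
Qed.

(** On the sigma-algebra of the past, the measure with density [psi] equals [c] times [P]; [phi] is
    integrated against both. *)
Lemma cond_mean_prod k (phi psi : Omega -> R) (c : R) :
  adapted_at k phi -> (forall w, 0 <= phi w)%R ->
  measurable_fun setT psi -> (forall w, 0 <= psi w)%R -> (0 <= c)%R ->
  cond_mean k psi c -> mean (fun w => phi w * psi w)%R = c%:E * mean phi.
Proof.
move=> mphi phi0 mpsi psi0 c0 h.
have mid : measurable_fun setT (id : Omega -> g_sigma_algebraType (G k)).
  by move=> _ B mB; rewrite setTI; exact: (@sub_filtration k).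
pose nu := image_on P measurableT mid.
rewrite /mean; transitivity (\int[mscale (NngNum c0) nu]_w (phi w)%:E).
  apply/esym.
  have := @ge0_integral_density _ _ _ Omega (g_sigma_algebraType (G k)) id P
    (mscale (NngNum c0) nu) psi phi mid mpsi mphi psi0 phi0.
  apply=> A mA; rewrite h; last exact: mA.
  by rewrite -[A in RHS]setIT.
rewrite ge0_integral_mscale//; last 2 first.
- exact/measurable_EFinP.
- by move=> w _; rewrite lee_fin.
congr (_ * _).
transitivity (\int[P]_w (phi w * cst 1 w)%:E); last first.
  by apply: eq_integral => w _; rewrite mulr1.
have := @ge0_integral_density _ _ _ Omega (g_sigma_algebraType (G k)) id P
  nu (cst 1%R) phi mid (measurable_cst _) mphi (fun=> ler01) phi0.
apply=> A mA; transitivity (\int[P]_(x in A) cst 1 x) => //.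
rewrite integral_cst; last exact: (@sub_filtration k).
by rewrite mul1e -[A in RHS]setIT.
Qed.

(** The cross term has mean zero because [psi - c] is centred given the past, and the conditional
    variance [c2 - c ^+ 2] is at most [c2]. *)
Lemma mean_square_step k (S phi psi : Omega -> R) (c c2 : R) :
  adapted_at k S -> adapted_at k phi -> (forall w, 0 <= phi w)%R ->
  measurable_fun setT psi -> (forall w, 0 <= psi w)%R ->
  (0 <= c)%R -> (0 <= c2)%R ->
  cond_mean k psi c -> cond_mean k (fun w => psi w ^+ 2)%R c2 ->
  mean (fun w => S w ^+ 2)%R < +oo -> mean (fun w => phi w ^+ 2)%R < +oo ->
  mean (fun w => (S w + phi w * (psi w - c)) ^+ 2)%R <=
  mean (fun w => S w ^+ 2)%R + c2%:E * mean (fun w => phi w ^+ 2)%R.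
Proof.
move=> aS aphi phi0 mpsi psi0 c0 c20 h1 h2 S2oo phi2oo.
have mS := adapted_at_measurable aS; have mphi := adapted_at_measurable aphi.
(* [S] is signed while [cond_mean_prod] takes nonnegative factors. *)
pose Sp w := Num.max (S w) 0%R; pose Sm w := Num.max (- S w)%R 0%R.
have aSp : adapted_at k Sp by exact: measurable_maxr.
have aSm : adapted_at k Sm.
  by apply: measurable_maxr => //; exact: measurable_funN.
have mSp := adapted_at_measurable aSp; have mSm := adapted_at_measurable aSm.
have Sp0 w : (0 <= Sp w)%R by rewrite le_max lexx orbT.
have Sm0 w : (0 <= Sm w)%R by rewrite le_max lexx orbT.
have SE w : S w = (Sp w - Sm w)%R.
  by rewrite /Sp /Sm; case: (leP 0%R (S w)) => s0; case: (leP 0%R (- S w)%R) => s1; lra.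
pose W2 w := ((S w + phi w * (psi w - c)) ^+ 2)%R.
pose S2 w := (S w ^+ 2)%R; pose ph2 w := (phi w ^+ 2)%R.
pose fp w := (Sp w * phi w)%R; pose fm w := (Sm w * phi w)%R.
have mW2 : measurable_fun setT W2.
  apply: measurable_funX; apply: measurable_funD => //; apply: measurable_funM => //.
  exact: measurable_funB.
have mS2 : measurable_fun setT S2 by exact: measurable_funX.
have aph2 : adapted_at k ph2 by exact: measurable_funX.
have mph2 := adapted_at_measurable aph2.
have afp : adapted_at k fp by exact: measurable_funM.
have afm : adapted_at k fm by exact: measurable_funM.
have mfp := adapted_at_measurable afp; have mfm := adapted_at_measurable afm.
have W20 w : (0 <= W2 w)%R by exact: sqr_ge0.
have S20 w : (0 <= S2 w)%R by exact: sqr_ge0.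
have ph20 w : (0 <= ph2 w)%R by exact: sqr_ge0.
have fp0 w : (0 <= fp w)%R by exact: mulr_ge0.
have fm0 w : (0 <= fm w)%R by exact: mulr_ge0.
have mpsi2 : measurable_fun setT (fun w => psi w ^+ 2)%R by exact: measurable_funX.
have psi20 w : (0 <= psi w ^+ 2)%R by exact: sqr_ge0.
(* Expanding the square and moving every negative term to the other side leaves
   nonnegative integrands only, so that no integrability has to be proved. *)
have eq_w w :
    (W2 w + ((2 * (fm w * psi w) + (2 * c) * fp w) + (2 * c) * (ph2 w * psi w)) =
     S2 w + ((ph2 w * psi w ^+ 2 + c ^+ 2 * ph2 w) +
     (2 * (fp w * psi w) + (2 * c) * fm w)))%R.
  by rewrite /W2 /S2 /ph2 /fp /fm SE; ring.
have c20' : (0 <= 2 * c)%R by rewrite mulr_ge0.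
have pM (f g : Omega -> R) : (forall w, 0 <= f w)%R -> (forall w, 0 <= g w)%R ->
    forall w, (0 <= f w * g w)%R by move=> f0 g0 w; exact: mulr_ge0.
have pZ (r : R) (f : Omega -> R) : (0 <= r)%R -> (forall w, 0 <= f w)%R ->
    forall w, (0 <= r * f w)%R by move=> r0 f0 w; exact: mulr_ge0.
have pD (f g : Omega -> R) : (forall w, 0 <= f w)%R -> (forall w, 0 <= g w)%R ->
    forall w, (0 <= f w + g w)%R by move=> f0 g0 w; exact: addr_ge0.
have mM (f g : Omega -> R) : measurable_fun setT f -> measurable_fun setT g ->
    measurable_fun setT (fun w => f w * g w)%R by move=> *; exact: measurable_funM.
have mZ (r : R) (f : Omega -> R) : measurable_fun setT f ->
    measurable_fun setT (fun w => r * f w)%R.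
  by move=> ?; apply: measurable_funM.
have mD (f g : Omega -> R) : measurable_fun setT f -> measurable_fun setT g ->
    measurable_fun setT (fun w => f w + g w)%R by move=> *; exact: measurable_funD.
have c2sq : (0 <= c ^+ 2)%R by exact: sqr_ge0.
have := congr1 mean (funext eq_w).
rewrite !meanD; [|by repeat first [assumption|exact: ler0n|apply: (mD)|apply: (mZ)
    |apply: (mM)|apply: (pD)|apply: (pZ)|apply: (pM)]..].
rewrite !meanZ; [|by repeat first [assumption|exact: ler0n|apply: (mD)|apply: (mZ)
    |apply: (mM)|apply: (pD)|apply: (pZ)|apply: (pM)]..].
rewrite (cond_mean_prod afm fm0 mpsi psi0 c0 h1).
rewrite (cond_mean_prod afp fp0 mpsi psi0 c0 h1).
rewrite (cond_mean_prod aph2 ph20 mpsi psi0 c0 h1).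
rewrite (cond_mean_prod aph2 ph20 mpsi2 psi20 c20 h2).
have fin_of (f : Omega -> R) : (forall w, 0 <= f w)%R -> mean f < +oo ->
    mean f \is a fin_num by move=> f0 foo; rewrite ge0_fin_numE// mean_ge0.
have S2ph2oo : mean (fun w => S2 w + ph2 w)%R < +oo.
  by rewrite meanD// lte_add_pinfty.
(* Only finite terms can be cancelled; finiteness follows from [Sp * phi <= S ^+ 2 + phi ^+ 2]. *)
have fpfin : mean fp \is a fin_num.
  apply: fin_of => //; apply: le_lt_trans S2ph2oo; apply: mean_le => //.
    exact: mD.
  move=> w; rewrite fp0/= /fp /S2 /ph2 SE.
  have : (Sp w * Sm w = 0)%R.
    by rewrite /Sp /Sm; case: (leP 0%R (S w)) => s0; case: (leP 0%R (- S w)%R) => s1; nra.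
  have := Sp0 w; have := phi0 w; nra.
have fmfin : mean fm \is a fin_num.
  apply: fin_of => //; apply: le_lt_trans S2ph2oo; apply: mean_le => //.
    exact: mD.
  move=> w; rewrite fm0/= /fm /S2 /ph2 SE.
  have : (Sp w * Sm w = 0)%R.
    by rewrite /Sp /Sm; case: (leP 0%R (S w)) => s0; case: (leP 0%R (- S w)%R) => s1; nra.
  have := Sm0 w; have := phi0 w; nra.
have ph2fin : mean ph2 \is a fin_num by exact: fin_of.
have S2fin : mean S2 \is a fin_num by exact: fin_of.
rewrite -/S2 -/ph2 -(fineK fpfin) -(fineK fmfin) -(fineK ph2fin) -(fineK S2fin).
set x2 := fine (mean fm); set x3 := fine (mean fp); set x4 := fine (mean ph2).
have x40 : (0 <= c ^+ 2 * x4)%R by rewrite mulr_ge0// fine_ge0// mean_ge0.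
(* The other side of the identity is finite, which excludes an infinite [mean W2]; the gap to the
   bound is [c ^+ 2 * x4]. *)
case: (mean W2) => [w2| |]; rewrite -?EFinM -?EFinD//.
move=> -[e]; rewrite lee_fin; lra.
Qed.

(** Write [phi * psi - c1 * c2 = phi * (psi - c2) + c2 * (phi - c1)]: the first part is a martingale
    difference, of second moment at most [V * c22], the second is the law of large numbers for
    [phi]. *)
Lemma mean_lln_prod (phi psi : nat -> Omega -> R) (c1 C1 c2 c22 V : R) :
  (forall k, adapted_at k (phi k)) -> (forall k w, 0 <= phi k w)%R ->
  (forall k, adapted_at k.+1 (psi k)) -> (forall k w, 0 <= psi k w)%R ->
  (0 <= c2)%R -> (0 <= c22)%R ->
  (forall k, cond_mean k (psi k) c2) ->
  (forall k, cond_mean k (fun w => psi k w ^+ 2)%R c22) ->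
  (forall k, mean (fun w => phi k w ^+ 2)%R <= V%:E) ->
  mean_lln phi c1 C1 ->
  mean_lln (fun k w => phi k w * psi k w)%R (c1 * c2)
    (2 * (V * c22) + 2 * (c2 ^+ 2 * C1)).
Proof.
move=> aphi phi0 apsi psi0 c20 c220 h1 h2 hV [_ hphi].
have mpsi k := adapted_at_measurable (apsi k).
have mphi k := adapted_at_measurable (aphi k).
pose S k w := (\sum_(i < k) phi i w * (psi i w - c2))%R.
have SS k : S k.+1 = (fun w => S k w + phi k w * (psi k w - c2))%R.
  by apply/funext => w; rewrite /S big_ord_recr.
have aS k : adapted_at k (S k).
  elim: k => [|k IH].
    rewrite [S 0%N](_ : _ = fun=> 0%R); first exact: measurable_cst.
    by apply/funext => w; rewrite /S big_ord0.
  rewrite SS; apply: measurable_funD; first exact: adapted_atS.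
  apply: measurable_funM; first exact: adapted_atS.
  by apply: measurable_funB; [exact: apsi|exact: measurable_cst].
have S2 k : mean (fun w => S k w ^+ 2)%R <= (V * c22 * k%:R)%:E.
  elim: k => [|k IH].
    rewrite mulr0 [X in mean X](_ : _ = fun=> 0%R) ?mean_cst//.
    by apply/funext => w; rewrite /S big_ord0 expr0n.
  rewrite SS; apply: le_trans (@mean_square_step k (S k) (phi k) (psi k) c2 c22
    _ _ _ _ _ _ _ _ _ _ _) _ => //.
  - exact: le_lt_trans IH (ltry _).
  - exact: le_lt_trans (hV k) (ltry _).
  rewrite -[k.+1]addn1 natrD mulrDr mulr1 EFinD; apply: leeD => //.
  rewrite (mulrC V) [X in _ <= X](_ : _ = c22%:E * V%:E)//.
  by apply: lee_wpmul2l; rewrite ?lee_fin.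
split=> [k|k]; first exact: measurable_funM.
rewrite [X in mean X](_ : _ =
    (fun w => (S k w + c2 * \sum_(i < k) (phi i w - c1)) ^+ 2)%R); last first.
  apply/funext => w; rewrite /S mulr_sumr -big_split/=; congr (_ ^+ 2)%R.
  by apply: eq_bigr => i _; ring.
rewrite mulrDl -!mulrA [(V * _)%R]mulrA; apply: mean_sqrD => //.
- exact: (adapted_at_measurable (aS k)).
- by apply: measurable_funM => //; exact: measurable_centered_sum.
under [X in mean X]eq_fun do rewrite exprMn.
rewrite meanZ ?sqr_ge0//; last 2 first.
- by apply: measurable_funX; exact: measurable_centered_sum.
- by move=> w; exact: sqr_ge0.
rewrite [X in _ <= X](_ : _ = (c2 ^+ 2)%:E * (C1 * k%:R)%:E); last first.
  by rewrite -EFinM expr2 mulrA.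
by apply: lee_wpmul2l; rewrite ?lee_fin ?sqr_ge0.
Qed.

End Filtration.

End MeanSquareLLN.

(** * The renewal structure of the synchronized times *)

Section PoissonIntegrals.
Context (R : realType) d (Omega : measurableType d) (P : probability Omega R).
Local Open Scope ereal_scope.
Variables (la mu : R) (la0 : (0 < la)%R) (mu0 : (0 < mu)%R).
Variables (E : set Omega) (a b : nat -> Omega -> R).
Hypothesis h : poisson_on P la mu E a b.

Let lamu0 : (0 < la + mu)%R. Proof. exact: addr_gt0. Qed.
Let mE : measurable E. Proof. by case: h. Qed.
Let ma k : measurable_fun setT (a k). Proof. by case: h. Qed.
Let mb k : measurable_fun setT (b k). Proof. by case: h. Qed.
Let PEfin : P E \is a fin_num. Proof. exact: fin_num_measure. Qed.

Definition precedes (w : Omega) : R := (a 0%N w < b 0%N w)%R%:R.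

Lemma integral_precedes (f : Omega -> R) :
  \int[P]_(w in E) (precedes w * f w)%:E =
  \int[P]_(w in E `&` [set w | a 0%N w < b 0%N w]%R) (f w)%:E.
Proof.
rewrite [LHS]integral_mkcond [RHS]integral_mkcond; apply: eq_integral => w _.
rewrite !patchE in_setI; case: (w \in E) => //=; rewrite /precedes.
have [ab|ab] := ltP (a 0%N w) (b 0%N w); first by rewrite mem_set// mul1r.
by rewrite memNset ?mul0r//= => /(le_lt_trans ab); rewrite ltxx.
Qed.

Lemma integral_law_moment (F : set Omega) (V : Omega -> R) (c nu : R)
    (nu0 : (0 < nu)%R) j : measurable F -> measurable_fun setT V -> (0 <= c)%R ->
  (forall A, measurable A -> P (F `&` V @^-1` A) = c%:E * exponential_law nu0 A) ->
  \int[P]_(w in F) (`|V w| ^+ j)%:E = (c * (j`!%:R / nu ^+ j))%:E.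
Proof.
move=> mF mV c0 hV.
have := @ge0_integral_law _ _ _ _ (measurableTypeR R) P F V (NngNum c0)
  (exponential_law nu0) (fun x => `|x| ^+ j)%R mF mV.
move=> -> //; first by rewrite exponential_moment.
by apply: measurable_funX; exact: normr_measurable.
Qed.

Lemma integral_first j :
  \int[P]_(w in E) (`|a 0%N w| ^+ j)%:E = (j`!%:R / la ^+ j)%:E * P E.
Proof.
rewrite (@integral_law_moment E (a 0%N) (fine (P E)) la la0)//.
- by rewrite EFinM fineK// muleC.
- exact: fine_ge0.
- by move=> A mA; rewrite fineK// (poisson_on_first la0 h).
Qed.

Let p := (la / (la + mu))%R.
Let p0 : (0 <= p)%R. Proof. by rewrite divr_ge0 ?ltW. Qed.

Let mlt : measurable (E `&` [set w | a 0%N w < b 0%N w]%R).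
Proof. by apply: measurableI => //; exact: measurable_set_ltr. Qed.

Lemma integral_first_precedes j :
  \int[P]_(w in E) (precedes w * `|a 0%N w| ^+ j)%:E =
  (p * (j`!%:R / (la + mu) ^+ j))%:E * P E.
Proof.
rewrite integral_precedes.
rewrite (@integral_law_moment _ (a 0%N) (fine (P E) * p) _ lamu0)//.
- by rewrite -mulrA EFinM fineK// muleC.
- by rewrite mulr_ge0// fine_ge0.
- by move=> A mA; rewrite (poisson_on_race la0 mu0 h lamu0)// [in RHS]EFinM fineK// muleA.
Qed.

Lemma integral_age L a' b' j : measurable_fun setT L -> next_block a b L a' b' ->
  \int[P]_(w in E) (precedes w * `|L w| ^+ j)%:E =
  (p * (j`!%:R / (la + mu) ^+ j))%:E * P E.
Proof.
move=> mL nb; rewrite integral_precedes.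
rewrite (@integral_law_moment _ L (fine (P E) * p) _ lamu0)//.
- by rewrite -mulrA EFinM fineK// muleC.
- by rewrite mulr_ge0// fine_ge0.
- by move=> A mA; rewrite (prob_lt_age la0 mu0 h lamu0 mL nb mA).
Qed.

End PoissonIntegrals.

Section PoissonTies.
Context (R : realType) d (Omega : measurableType d) (P : probability Omega R).
Local Open Scope ereal_scope.
Variables (la mu : R) (la0 : (0 < la)%R) (mu0 : (0 < mu)%R).
Variables (E : set Omega) (a b : nat -> Omega -> R).
Hypothesis h : poisson_on P la mu E a b.

(** Ties carry no mass: the ends of runs fill [E] up to a null set, and each of them lies strictly
    on one side. *)
Lemma integral_split_ties (f : Omega -> R) : measurable_fun setT f ->
  (forall w, 0 <= f w)%R ->
  \int[P]_(w in E) (f w)%:E = \int[P]_(w in E) (precedes a b w * f w)%:E +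
                              \int[P]_(w in E) (precedes b a w * f w)%:E.
Proof.
move=> mf f0; have [mE ma mb _] := h.
rewrite !integral_precedes.
have mab : measurable (E `&` [set w | a 0%N w < b 0%N w]%R).
  by apply: measurableI => //; exact: measurable_set_ltr.
have mba : measurable (E `&` [set w | b 0%N w < a 0%N w]%R).
  by apply: measurableI => //; exact: measurable_set_ltr.
have dis : [disjoint E `&` [set w | a 0%N w < b 0%N w]%R &
    E `&` [set w | b 0%N w < a 0%N w]%R].
  apply/disj_setPS => w [[_ /= h1] [_ /= h2]].
  by have := lt_trans h1 h2; rewrite ltxx.
rewrite -ge0_integral_setU//; last 2 first.
- by apply/measurable_EFinP; exact: measurable_funTS.
- by move=> w _; rewrite lee_fin.
rewrite -setIUr; set D := _ `|` _.
have mD : measurable D by apply: measurableU; exact: measurable_set_ltr.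
have [mab' mba'] := measurable_runs_end h.
rewrite [LHS](ge0_negligible_integral (N := E `\` D))//.
- by rewrite setDD.
- exact: measurableD.
- by apply/measurable_EFinP; exact: measurable_funTS.
- by move=> w _; rewrite lee_fin.
apply: (subset_measure0 _ _ _ (prob_runs_end_full la0 mu0 h)).
- exact: measurableD.
- by apply: measurableD => //; exact: measurableU.
- apply: setDS; apply: setUSS => w; exact: run_end_lt.
Qed.

(** The larger of the two times is not exponential on this event, so its moments come from the
    complement: the full moment of [b 0] minus its part on [b 0 < a 0], where it is the minimum. *)
Lemma integral_second_precedes j :
  \int[P]_(w in E) (precedes a b w * `|b 0%N w| ^+ j)%:E =
  (j`!%:R / mu ^+ j - mu / (la + mu) * (j`!%:R / (la + mu) ^+ j))%:E * P E.
Proof.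
have [mE ma mb _] := h.
have mf : measurable_fun setT (fun w => `|b 0%N w| ^+ j)%R.
  by apply: measurable_funX; exact: measurableT_comp.
have := integral_split_ties mf (fun w => exprn_ge0 _ (normr_ge0 _)).
rewrite (integral_first mu0 (poisson_onC h)).
rewrite (integral_first_precedes mu0 la0 (poisson_onC h)) (addrC mu).
rewrite -(fineK (fin_num_measure P _ mE)).
case: (\int[P]_(w in E) (precedes a b w * `|b 0%N w| ^+ j)%:E) => [r| |].
- by rewrite -!EFinM -EFinD => -[e]; congr EFin; rewrite mulrBl; lra.
- by rewrite -!EFinM.
- by rewrite -!EFinM.
Qed.

End PoissonTies.

Section SyncChain.
Context (R : realType) d (Omega : measurableType d) (P : probability Omega R).
Local Open Scope ereal_scope.

Section Sequences.
Variables (t tau : nat -> Omega -> R).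

Definition res_seq i k w : R := resid (t ^~ w) (tau ^~ w) i k.
Definition age_at i w : R := last_age (t ^~ w) (tau ^~ w) i.

Hypotheses (mt : forall k, measurable_fun setT (t k))
  (mtau : forall k, measurable_fun setT (tau k)).

Lemma measurable_res_seq i k : measurable_fun setT (res_seq i k).
Proof.
have [mq _] := nat_measurable_sync mt mtau i.
case: k => [|k].
  apply: measurable_funB; first exact: (measurable_nat_comp (g := t) mq).
  by case: i {mq} => [|i] //=; exact: measurable_sync_T.
apply: measurable_funB.
  exact: (measurable_nat_comp (g := fun q => t (q + k.+1)%N) mq).
exact: (measurable_nat_comp (g := fun q => t (q + k)%N) mq).
Qed.

Lemma measurable_age_at i : measurable_fun setT (age_at i).
Proof.
by apply: measurable_funD; apply: measurable_funB;
  do ?[exact: measurable_sync_T|exact: measurable_sync_l|exact: measurable_sync_lambda].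
Qed.

End Sequences.

Lemma age_at_swap t tau i : age_at tau t i = age_at t tau i.
Proof. by apply/funext => w; exact: last_age_swap. Qed.

Lemma next_block_sync t tau i :
  next_block (res_seq t tau i) (res_seq tau t i) (age_at t tau i)
    (res_seq t tau i.+1) (res_seq tau t i.+1).
Proof.
move=> j w hr.
have : ends_run (t ^~ w) (tau ^~ w) i j by exact: hr.
by move=> /ends_run_facts[_ [? ? ? ?]].
Qed.

Lemma ends_run_ex t tau i w : (\bigcup_j run_end (res_seq t tau i) (res_seq tau t i) j) w ->
  exists j, ends_run (t ^~ w) (tau ^~ w) i j.
Proof. by move=> [j _ hr]; exists j; exact: hr. Qed.

Section History.
Variables (la mu : R) (la0 : (0 < la)%R) (mu0 : (0 < mu)%R).
Variables (t tau : nat -> Omega -> R).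
Hypotheses (mt : forall k, measurable_fun setT (t k))
  (mtau : forall k, measurable_fun setT (tau k)).
Hypothesis h0 : poisson_on P la mu setT (res_seq t tau 0) (res_seq tau t 0).

Definition block_data i w : R * R * R :=
  (res_seq t tau i 0%N w, res_seq tau t i 0%N w, age_at t tau i w).

(** Only a generating family closed under intersection, so that one induction step adds exactly the
    event of one block; the sigma-algebra follows in [sigma_history_poisson]. *)
Fixpoint history k : set (set Omega) :=
  if k is k'.+1 then
    [set E `&` block_data k' @^-1` B | E in history k' & B in measurable]
  else [set setT].

Let mra i k : measurable_fun setT (res_seq t tau i k).
Proof. exact: measurable_res_seq. Qed.

Let mrb i k : measurable_fun setT (res_seq tau t i k).
Proof. exact: measurable_res_seq. Qed.

Let mage i : measurable_fun setT (age_at t tau i).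
Proof. exact: measurable_age_at. Qed.

Lemma history_poisson k E : history k E ->
  poisson_on P la mu E (res_seq t tau k) (res_seq tau t k).
Proof.
elim: k E => [_ -> //|k IH _ [E hE [B mB <-]]].
apply: (poisson_on_block la0 mu0 (IH _ hE)) => //.
- exact: next_block_sync.
- by rewrite -age_at_swap; exact: next_block_sync.
Qed.

Lemma historyT k : history k setT.
Proof.
elim: k => [//|k IH]; exists setT => //; exists setT => //.
by rewrite preimage_setT setIT.
Qed.

Lemma history_measurable k : history k `<=` measurable.
Proof. by move=> E /history_poisson[]. Qed.

Lemma history_nd k : history k `<=` history k.+1.
Proof.
by move=> E hE; exists E => //; exists setT => //; rewrite preimage_setT setIT.
Qed.

Lemma history_setI k : setI_closed (history k).
Proof.
elim: k => [|k IH]; first by move=> _ _ -> ->; rewrite setIT.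
move=> _ _ [E hE [B mB <-]] [F hF [C mC <-]].
exists (E `&` F); first exact: IH.
exists (B `&` C); first exact: measurableI.
by rewrite preimage_setI setIACA.
Qed.

(** For fixed cylinders both sides are finite measures in [E] that agree on [history k], which is
    closed under intersection. *)
Lemma sigma_history_poisson k E : <<s history k >> E ->
  poisson_on P la mu E (res_seq t tau k) (res_seq tau t k).
Proof.
move=> hE; have mE := sub_filtration history_measurable hE; split => // As Bs mAs mBs.
have [kap kE] := weight_num la0 mu0 mAs mBs.
pose C := cylinder As (res_seq t tau k) `&` cylinder Bs (res_seq tau t k).
have mC : measurable C by apply: measurableI; exact: measurable_cylinder.
have hm := @g_sigma_algebra_measure_unique _ R Omega (history k)
  (@history_measurable k) (fun=> setT) (fun=> historyT k) (bigcup_const _ _)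
  (mrestr P mC) (mscale kap P) (@history_setI k).
rewrite -setIA -/C muleC -kE.
transitivity (mrestr P mC E) => //.
transitivity (mscale kap P E) => //; apply: hm => //.
- move=> F /history_poisson[mF _ _ hF].
  transitivity (P (F `&` C)) => //.
  by rewrite /C setIA hF// muleC -kE.
- move=> _; apply: le_lt_trans (ltry 1).
  rewrite [X in X <= _](_ : _ = P C); first exact: probability_le1.
  by rewrite /= /mrestr setTI.
Qed.

Lemma good_step_ae i : exists2 N : set Omega, measurable N /\ P N = 0 &
  forall w, ~ N w -> good_step (t ^~ w) (tau ^~ w) i.
Proof.
have h := history_poisson (historyT i).
have [mab mba] := measurable_runs_end h.
exists ([set w | res_seq t tau i 0 w < 0]%R `|` [set w | res_seq tau t i 0 w < 0]%R `|`
  (setT `\` (\bigcup_j run_end (res_seq t tau i) (res_seq tau t i) j `|`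
             \bigcup_j run_end (res_seq tau t i) (res_seq t tau i) j))).
  have mx : measurable [set w | res_seq t tau i 0 w < 0]%R by exact: measurable_set_ltr.
  have my : measurable [set w | res_seq tau t i 0 w < 0]%R by exact: measurable_set_ltr.
  split.
    apply: measurableU; first exact: measurableU.
    by apply: measurableD => //; exact: measurableU.
  rewrite !measureU0//.
  - by have := poisson_on_first_ge0 la0 h; rewrite setTI.
  - by have := poisson_on_first_ge0 mu0 (poisson_onC h); rewrite setTI.
  - exact: measurableU.
  - by apply: measurableD => //; exact: measurableU.
  - exact: (prob_runs_end_full la0 mu0 h).
move=> w /not_orP[/not_orP[/= x0 y0] hr]; split.
- by rewrite leNgt; apply/negP.
- by rewrite leNgt; apply/negP.
have [|] : (\bigcup_j run_end (res_seq t tau i) (res_seq tau t i) j `|`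
  \bigcup_j run_end (res_seq tau t i) (res_seq t tau i) j) w.
  by apply: contrapT => nr; apply: hr; split.
- by move=> /ends_run_ex; left.
- by move=> /ends_run_ex; right.
Qed.

End History.

End SyncChain.

(** * Laws of large numbers for the summands *)

Section BlockVariables.
Context (R : realType) d (Omega : measurableType d) (P : probability Omega R).
Local Open Scope ereal_scope.
Implicit Types (u v : nat -> Omega -> R).

(** [history] is built from ordered data, but these properties of it are symmetric in the two
    processes; hence results for one process give those for the other with the same filtration. *)
Record sync_filtration (F : nat -> set (set Omega)) (lu lv : R) u v : Prop := {
  sf_mu : forall k, measurable_fun setT (u k);
  sf_mv : forall k, measurable_fun setT (v k);
  sf_measurable : forall k, F k `<=` measurable;
  sf_nd : forall k, F k `<=` F k.+1;
  sf_poisson : forall k E, <<s F k >> E ->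
    poisson_on P lu lv E (res_seq u v k) (res_seq v u k);
  sf_x : forall k, adapted_at F k.+1 (res_seq u v k 0%N);
  sf_y : forall k, adapted_at F k.+1 (res_seq v u k 0%N);
  sf_age : forall k, adapted_at F k.+1 (age_at u v k) }.

Lemma sync_filtrationC F (lu lv : R) u v :
  sync_filtration F lu lv u v -> sync_filtration F lv lu v u.
Proof.
move=> [? ? ? ? hp ? ? ha]; split => // [k E hE|k].
  exact: poisson_onC (hp _ _ hE).
by rewrite age_at_swap; exact: ha.
Qed.

Lemma sync_filtration_history (la mu : R) t tau :
  (0 < la)%R -> (0 < mu)%R ->
  (forall k, measurable_fun setT (t k)) -> (forall k, measurable_fun setT (tau k)) ->
  poisson_on P la mu setT (res_seq t tau 0) (res_seq tau t 0) ->
  sync_filtration (history t tau) la mu t tau.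
Proof.
move=> la0 mu0 mt mtau h0.
have aB k : @measurable_fun _ _ (g_sigma_algebraType (history t tau k.+1)) _ setT
    (block_data t tau k).
  move=> _ B mB; rewrite setTI; apply: sub_sigma_algebra; exists setT.
    exact: historyT.
  by exists B => //; rewrite setTI.
split=> //.
- exact: (history_measurable la0 mu0 mt mtau h0).
- exact: history_nd.
- by move=> k E; exact: (sigma_history_poisson la0 mu0 mt mtau h0).
- move=> k; have := measurableT_comp measurable_fst
    (measurableT_comp measurable_fst (aB k)); exact.
- move=> k; have := measurableT_comp measurable_snd
    (measurableT_comp measurable_fst (aB k)); exact.
- move=> k; have := measurableT_comp measurable_snd (aB k); exact.
Qed.

Definition first_wait u v i w : R := `|res_seq u v i 0%N w|.
Definition second_last u v i w : R := precedes (res_seq u v i) (res_seq v u i) w.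
(** On good paths, the block length if [v] ends the block and 0 otherwise; together with its mirror
    image it is the block length. *)
Definition last_wait u v i w : R := (second_last u v i w * first_wait v u i w)%R.
(** On good paths, the time at [T_i] since the last observation of [u]. *)
Definition stale_age u v i w : R := (second_last u v i w * `|age_at u v i w|)%R.

Lemma second_lastX u v i w j : (second_last u v i w ^+ j.+1 = second_last u v i w)%R.
Proof. by rewrite /second_last /precedes; case: (_ < _)%R; rewrite ?expr1n ?expr0n. Qed.

Lemma second_last01 u v i w : (0 <= second_last u v i w <= 1)%R.
Proof. by rewrite /second_last /precedes; case: (_ < _)%R; rewrite ?lexx ler01. Qed.

Section OneFiltration.
Variables (F : nat -> set (set Omega)) (lu lv : R) (u v : nat -> Omega -> R).
Hypotheses (lu0 : (0 < lu)%R) (lv0 : (0 < lv)%R) (sf : sync_filtration F lu lv u v).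

Let L := (lu + lv)%R.

Lemma adapted_first_wait k : adapted_at F k.+1 (first_wait u v k).
Proof. by apply: measurableT_comp => //; exact: (sf_x sf). Qed.

Lemma adapted_second_last k : adapted_at F k.+1 (second_last u v k).
Proof.
rewrite (_ : second_last u v k = fun w =>
  if (res_seq u v k 0%N w < res_seq v u k 0%N w)%R then 1%R else 0%R); last first.
  by apply/funext => w; rewrite /second_last /precedes; case: (_ < _)%R.
apply: measurable_fun_ifT => //.
by apply: measurable_fun_ltr; [exact: (sf_x sf)|exact: (sf_y sf)].
Qed.

Lemma adapted_last_wait k : adapted_at F k.+1 (last_wait u v k).
Proof.
apply: measurable_funM; first exact: adapted_second_last.
by apply: measurableT_comp => //; exact: (sf_y sf).
Qed.

Lemma adapted_stale_age k : adapted_at F k.+1 (stale_age u v k).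
Proof.
apply: measurable_funM; first exact: adapted_second_last.
by apply: measurableT_comp => //; exact: (sf_age sf).
Qed.

Lemma cond_mean_first_wait k j :
  cond_mean P F k (fun w => first_wait u v k w ^+ j)%R (j`!%:R / lu ^+ j).
Proof. by move=> E hE; exact: (integral_first lu0 (sf_poisson sf hE)). Qed.

Lemma cond_mean_second_last k j :
  cond_mean P F k (fun w => second_last u v k w ^+ j.+1)%R (lu / L).
Proof.
move=> E hE; under eq_integral do rewrite second_lastX.
have := integral_first_precedes lu0 lv0 (sf_poisson sf hE) 0.
rewrite fact0 !expr0 divr1 mulr1 => <-.
by apply: eq_integral => w _; rewrite expr0 mulr1.
Qed.

Lemma cond_mean_last_wait k j :
  cond_mean P F k (fun w => last_wait u v k w ^+ j.+1)%R
    (j.+1`!%:R / lv ^+ j.+1 - lv / L * (j.+1`!%:R / L ^+ j.+1)).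
Proof.
move=> E hE; rewrite -(integral_second_precedes lu0 lv0 (sf_poisson sf hE)).
by apply: eq_integral => w _; rewrite /last_wait exprMn second_lastX.
Qed.

Lemma cond_mean_stale_age k j :
  cond_mean P F k (fun w => stale_age u v k w ^+ j.+1)%R
    (lu / L * (j.+1`!%:R / L ^+ j.+1)).
Proof.
move=> E hE.
have mage := measurable_age_at (sf_mu sf) (sf_mv sf) k.
rewrite -(integral_age lu0 lv0 (sf_poisson sf hE) j.+1 mage
  (@next_block_sync _ _ _ u v k)).
by apply: eq_integral => w _; rewrite /stale_age exprMn second_lastX.
Qed.

End OneFiltration.

(** * Predictable factors and innovations, uniformly in [n] *)

Section Families.
Variables (F : nat -> nat -> set (set Omega)).
Hypothesis F_measurable : forall n k, F n k `<=` measurable.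
Hypothesis F_nd : forall n k, F n k `<=` F n k.+1.
Implicit Types (Z phi psi : nat -> nat -> Omega -> R).

Definition uniform_lln Z (c : R) : Prop :=
  exists2 C : R, (0 <= C)%R & forall n, mean_lln P (Z n) c C.

Definition predictable phi (V : R) : Prop := forall n k,
  [/\ adapted_at (F n) k (phi n k), forall w, (0 <= phi n k w)%R &
      mean P (fun w => phi n k w ^+ 2)%R <= V%:E].

Definition innovation psi (c c2 : R) : Prop := forall n k,
  [/\ adapted_at (F n) k.+1 (psi n k), forall w, (0 <= psi n k w)%R,
      cond_mean P (F n) k (psi n k) c &
      cond_mean P (F n) k (fun w => psi n k w ^+ 2)%R c2].

Lemma innovation_mean psi c c2 n k : innovation psi c c2 ->
  mean P (psi n k) = c%:E /\ mean P (fun w => psi n k w ^+ 2)%R = c2%:E.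
Proof.
move=> /(_ n k)[_ _ h1 h2].
have hT : <<s F n k >> setT.
  by have := @measurableT _ (g_sigma_algebraType (F n k)); exact.
have PT : P setT = 1 := probability_setT P.
by have := h1 _ hT; have := h2 _ hT; rewrite PT !mule1.
Qed.

Lemma innovation_ge0 psi c c2 : innovation psi c c2 -> (0 <= c)%R /\ (0 <= c2)%R.
Proof.
move=> h; have [h1 h2] := innovation_mean 0 0 h; have [_ psi0 _ _] := h 0%N 0%N.
split; first by rewrite -lee_fin -h1; exact: mean_ge0.
by rewrite -lee_fin -h2; apply: mean_ge0 => w; exact: sqr_ge0.
Qed.

Lemma uniform_lln_add Z Z' c c' : uniform_lln Z c -> uniform_lln Z' c' ->
  uniform_lln (fun n i w => Z n i w + Z' n i w)%R (c + c').
Proof.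
move=> [C C0 hZ] [C' C'0 hZ']; exists (2 * C + 2 * C')%R.
  by rewrite addr_ge0// mulr_ge0.
by move=> n; exact: mean_lln_add.
Qed.

Lemma uniform_lln_delay Z c : uniform_lln Z c ->
  uniform_lln (fun n => delay (Z n)) c.
Proof.
move=> [C C0 hZ]; exists (2 * C + 2 * c ^+ 2)%R.
  by rewrite addr_ge0// mulr_ge0// sqr_ge0.
by move=> n; exact: mean_lln_delay.
Qed.

Lemma uniform_lln_prod phi psi c1 c2 c22 V : predictable phi V ->
  innovation psi c2 c22 -> uniform_lln phi c1 ->
  uniform_lln (fun n i w => phi n i w * psi n i w)%R (c1 * c2).
Proof.
move=> hphi hpsi [C C0 hlln].
have [c20 c220] := innovation_ge0 hpsi.
have V0 : (0 <= V)%R.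
  have [_ _ hV] := hphi 0%N 0%N; rewrite -lee_fin; apply: le_trans hV.
  by apply: mean_ge0 => w; exact: sqr_ge0.
exists (2 * (V * c22) + 2 * (c2 ^+ 2 * C))%R.
  by rewrite addr_ge0// mulr_ge0// mulr_ge0// sqr_ge0.
move=> n; apply: (@mean_lln_prod _ _ _ _ (F n)) => //.
- by move=> k; have [] := hphi n k.
- by move=> k; have [] := hphi n k.
- by move=> k; have [] := hpsi n k.
- by move=> k; have [] := hpsi n k.
- by move=> k; have [] := hpsi n k.
- by move=> k; have [] := hpsi n k.
- by move=> k; have [] := hphi n k.
Qed.

Lemma uniform_lln_innovation psi c c2 : innovation psi c c2 -> uniform_lln psi c.
Proof.
move=> h; have h1 : predictable (fun _ _ _ => 1%R) 1.
  move=> n k; split => //; first exact: measurable_cst.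
  by rewrite (mean_cst P (1 ^+ 2)) expr1n.
have hc : uniform_lln (fun _ _ _ => 1%R) 1.
  by exists 0%R => // n; exact: mean_lln_cst.
have := uniform_lln_prod h1 h hc.
rewrite mul1r (_ : (fun n i w => 1 * psi n i w)%R = psi)//.
by apply/funext => n; apply/funext => i; apply/funext => w; rewrite mul1r.
Qed.

Lemma predictable_delay psi c c2 : innovation psi c c2 ->
  predictable (fun n => delay (psi n)) c2.
Proof.
move=> h n [|k] /=; last first.
  have [? ? _ _] := h n k; split => //.
  by have [_ ->] := innovation_mean n k h.
split => //; first exact: measurable_cst.
rewrite (mean_cst P (0 ^+ 2)) expr0n/= lee_fin.
by have [] := innovation_ge0 h.
Qed.

(** For the part of F that spans three blocks: an age, the indicator in the next block and a
    residual in the third. The bound [psi <= 1] preserves the second moment bound of [phi]. *)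
Lemma predictable_delay_prod phi psi c c2 V : predictable phi V ->
  innovation psi c c2 -> (forall n k w, psi n k w <= 1)%R ->
  predictable (fun n => delay (fun i w => phi n i w * psi n i w)%R) V.
Proof.
move=> hphi hpsi psi1 n [|k] /=.
  have [_ _ hV] := hphi n 0%N.
  split => //; first exact: measurable_cst.
  rewrite (mean_cst P (0 ^+ 2)) expr0n/=; apply: le_trans hV.
  by apply: mean_ge0 => w; exact: sqr_ge0.
have [aphi phi0 hV] := hphi n k; have [apsi psi0 _ _] := hpsi n k.
have mphi := adapted_at_measurable (@F_measurable n) aphi.
have mpsi := adapted_at_measurable (@F_measurable n) apsi.
split.
- by apply: measurable_funM => //; exact: (adapted_atS (@F_nd n)).
- by move=> w; exact: mulr_ge0.
apply: le_trans hV; apply: mean_le.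
- by apply: measurable_funX; exact: measurable_funM.
- exact: measurable_funX.
- move=> w; rewrite sqr_ge0/= exprMn ler_piMr ?sqr_ge0// expr_le1//.
Qed.

Section Pair.
Variables (lu lv : R) (u v : nat -> nat -> Omega -> R).
Hypotheses (lu0 : (0 < lu)%R) (lv0 : (0 < lv)%R).
Hypothesis sf : forall n, sync_filtration (F n) lu lv (u n) (v n).

Lemma innovation_first_wait :
  innovation (fun n => first_wait (u n) (v n)) lu^-1 (2 / lu ^+ 2).
Proof.
move=> n k; split.
- exact: (adapted_first_wait (sf n)).
- by move=> w; exact: normr_ge0.
- have := @cond_mean_first_wait _ _ _ _ _ lu0 (sf n) k 1.
  by rewrite (_ : 1`!%N = 1%N)// expr1 mul1r; under eq_fun do rewrite expr1.
- exact: (@cond_mean_first_wait _ _ _ _ _ lu0 (sf n) k 2).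
Qed.

Lemma innovation_second_last :
  innovation (fun n => second_last (u n) (v n)) (lu / (lu + lv)) (lu / (lu + lv)).
Proof.
move=> n k; split.
- exact: (adapted_second_last (sf n)).
- by move=> w; have /andP[] := second_last01 (u n) (v n) k w.
- exact: (@cond_mean_second_last _ _ _ _ _ lu0 lv0 (sf n) k 0).
- exact: (@cond_mean_second_last _ _ _ _ _ lu0 lv0 (sf n) k 1).
Qed.

(** The moment computed in [integral_second_precedes], with rates [lu] and [lv]. *)
Definition mean_last_wait (j : nat) : R :=
  (j`!%:R / lv ^+ j - lv / (lu + lv) * (j`!%:R / (lu + lv) ^+ j))%R.

Lemma last_wait_ge0 n k w : (0 <= last_wait (u n) (v n) k w)%R.
Proof.
apply: mulr_ge0; last exact: normr_ge0.
by have /andP[] := second_last01 (u n) (v n) k w.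
Qed.

Lemma innovation_last_wait :
  innovation (fun n => last_wait (u n) (v n)) (mean_last_wait 1) (mean_last_wait 2).
Proof.
move=> n k; split.
- exact: (adapted_last_wait (sf n)).
- exact: last_wait_ge0.
- exact: (@cond_mean_last_wait _ _ _ _ _ lu0 lv0 (sf n) k 0).
- exact: (@cond_mean_last_wait _ _ _ _ _ lu0 lv0 (sf n) k 1).
Qed.

Lemma innovation_last_wait_sqr :
  innovation (fun n k w => last_wait (u n) (v n) k w ^+ 2)%R
    (mean_last_wait 2) (mean_last_wait 4).
Proof.
move=> n k; split.
- by apply: measurable_funX; exact: (adapted_last_wait (sf n)).
- by move=> w; exact: sqr_ge0.
- exact: (@cond_mean_last_wait _ _ _ _ _ lu0 lv0 (sf n) k 1).
- under eq_fun do rewrite -exprM.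
  exact: (@cond_mean_last_wait _ _ _ _ _ lu0 lv0 (sf n) k 3).
Qed.

Lemma innovation_stale_age :
  innovation (fun n => stale_age (u n) (v n)) (lu / (lu + lv) ^+ 2)
    (lu / (lu + lv) * (2 / (lu + lv) ^+ 2)).
Proof.
move=> n k; split.
- exact: (adapted_stale_age (sf n)).
- by move=> w; rewrite mulr_ge0.
- have := @cond_mean_stale_age _ _ _ _ _ lu0 lv0 (sf n) k 0.
  rewrite (_ : 1`!%N = 1%N)// expr1 mul1r (_ : lu / (lu + lv) / (lu + lv) = lu / (lu + lv) ^+ 2)%R.
    exact.
  by rewrite expr2 invfM mulrA.
- exact: (@cond_mean_stale_age _ _ _ _ _ lu0 lv0 (sf n) k 1).
Qed.

End Pair.

Section Limits.
Variables (la mu : R) (t tau : nat -> nat -> Omega -> R).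
Hypotheses (la0 : (0 < la)%R) (mu0 : (0 < mu)%R).
Hypothesis sf : forall n, sync_filtration (F n) la mu (t n) (tau n).

Let fs n := sync_filtrationC (sf n).
Let p := (la / (la + mu))%R.
Let q := (mu / (mu + la))%R.

Definition length_var n k w : R :=
  (last_wait (t n) (tau n) k w + last_wait (tau n) (t n) k w)%R.

Definition G_var n k w : R :=
  (last_wait (t n) (tau n) k w ^+ 2 + last_wait (tau n) (t n) k w ^+ 2)%R.

(** The residual after [T_i] belongs to block [i.+1], so the summand of index [i] is filed under
    [k = i.+1], with a delayed age. *)
Definition H_var n k w : R :=
  (delay (stale_age (t n) (tau n)) k w * first_wait (t n) (tau n) k w +
   delay (stale_age (tau n) (t n)) k w * first_wait (tau n) (t n) k w)%R.

(** The part of the summand of F on the event that the delayed time [T_{k-1}] is an observation of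
    [v]; the other part is its mirror image. *)
Definition half_F_var (u v : nat -> nat -> Omega -> R) n k w : R :=
  (delay (last_wait (u n) (v n)) k w * first_wait (u n) (v n) k w +
   delay (fun i w => delay (stale_age (v n) (u n)) i w * second_last (u n) (v n) i w) k w
     * first_wait (u n) (v n) k w +
   (delay (stale_age (u n) (v n)) k w * last_wait (u n) (v n) k w +
    delay (stale_age (u n) (v n)) k w * last_wait (v n) (u n) k w))%R.

Definition F_var n k w : R := (half_F_var t tau n k w + half_F_var tau t n k w)%R.

Lemma lln_length :
  uniform_lln length_var (mean_last_wait la mu 1 + mean_last_wait mu la 1).
Proof.
apply: uniform_lln_add.
  exact: uniform_lln_innovation (innovation_last_wait la0 mu0 sf).
exact: uniform_lln_innovation (innovation_last_wait mu0 la0 fs).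
Qed.

Lemma lln_G :
  uniform_lln G_var (mean_last_wait la mu 2 + mean_last_wait mu la 2).
Proof.
apply: uniform_lln_add.
  exact: uniform_lln_innovation (innovation_last_wait_sqr la0 mu0 sf).
exact: uniform_lln_innovation (innovation_last_wait_sqr mu0 la0 fs).
Qed.

End Limits.

Lemma lln_delay_prod (psi psi' : nat -> nat -> Omega -> R) c c2 c' c2' :
  innovation psi c c2 -> innovation psi' c' c2' ->
  uniform_lln (fun n i w => delay (psi n) i w * psi' n i w)%R (c * c').
Proof.
move=> h h'; apply: (uniform_lln_prod (predictable_delay h) h').
exact: uniform_lln_delay (uniform_lln_innovation h).
Qed.

Section Limits2.
Variables (la mu : R) (t tau : nat -> nat -> Omega -> R).
Hypotheses (la0 : (0 < la)%R) (mu0 : (0 < mu)%R).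
Hypothesis sf : forall n, sync_filtration (F n) la mu (t n) (tau n).

Let fs n := sync_filtrationC (sf n).

Lemma lln_H : uniform_lln (H_var t tau)
  (la / (la + mu) ^+ 2 * la^-1 + mu / (mu + la) ^+ 2 * mu^-1).
Proof.
apply: uniform_lln_add.
  exact: lln_delay_prod (innovation_stale_age la0 mu0 sf)
    (innovation_first_wait la0 sf).
exact: lln_delay_prod (innovation_stale_age mu0 la0 fs)
  (innovation_first_wait mu0 fs).
Qed.

End Limits2.

Lemma lln_half_F (lu lv : R) (u v : nat -> nat -> Omega -> R) :
  (0 < lu)%R -> (0 < lv)%R ->
  (forall n, sync_filtration (F n) lu lv (u n) (v n)) ->
  uniform_lln (half_F_var u v)
    (mean_last_wait lu lv 1 * lu^-1 +
     lv / (lv + lu) ^+ 2 * (lu / (lu + lv)) * lu^-1 +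
     (lu / (lu + lv) ^+ 2 * mean_last_wait lu lv 1 +
      lu / (lu + lv) ^+ 2 * mean_last_wait lv lu 1)).
Proof.
move=> lu0 lv0 sf; have fs n := sync_filtrationC (sf n).
apply: uniform_lln_add; first apply: uniform_lln_add; last apply: uniform_lln_add.
- exact: lln_delay_prod (innovation_last_wait lu0 lv0 sf)
    (innovation_first_wait lu0 sf).
- apply: (uniform_lln_prod _ (innovation_first_wait lu0 sf)).
    apply: predictable_delay_prod (innovation_second_last lu0 lv0 sf) _.
      exact: predictable_delay (innovation_stale_age lv0 lu0 fs).
    by move=> n k w; have /andP[] := second_last01 (u n) (v n) k w.
  apply: uniform_lln_delay.
  exact: lln_delay_prod (innovation_stale_age lv0 lu0 fs)
    (innovation_second_last lu0 lv0 sf).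
- exact: lln_delay_prod (innovation_stale_age lu0 lv0 sf)
    (innovation_last_wait lu0 lv0 sf).
- exact: lln_delay_prod (innovation_stale_age lu0 lv0 sf)
    (innovation_last_wait lv0 lu0 fs).
Qed.

Lemma lln_F (la mu : R) (t tau : nat -> nat -> Omega -> R) :
  (0 < la)%R -> (0 < mu)%R ->
  (forall n, sync_filtration (F n) la mu (t n) (tau n)) ->
  uniform_lln (F_var t tau)
    (mean_last_wait la mu 1 * la^-1 +
     mu / (mu + la) ^+ 2 * (la / (la + mu)) * la^-1 +
     (la / (la + mu) ^+ 2 * mean_last_wait la mu 1 +
      la / (la + mu) ^+ 2 * mean_last_wait mu la 1) +
    (mean_last_wait mu la 1 * mu^-1 +
     la / (la + mu) ^+ 2 * (mu / (mu + la)) * mu^-1 +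
     (mu / (mu + la) ^+ 2 * mean_last_wait mu la 1 +
      mu / (mu + la) ^+ 2 * mean_last_wait la mu 1))).
Proof.
move=> la0 mu0 sf; apply: uniform_lln_add; first exact: lln_half_F.
by apply: lln_half_F => // n; exact: sync_filtrationC.
Qed.

End Families.

End BlockVariables.

(** * Sums with a random number of terms *)

Section HighProbability.
Context (R : realType) d (Omega : measurableType d) (P : probability Omega R).

(* The events [E n] need not be measurable. *)
Definition whp (E : nat -> set Omega) : Prop :=
  forall delta : R, 0 < delta -> exists n0, forall n, (n0 <= n)%N ->
    exists B, [/\ measurable B, (P B <= delta%:E)%E & forall w, ~ B w -> E n w].

(** Convergence in probability up to a measurable exceptional set, so that random indices such as
    [crossing] need no measurability proof. *)
Definition cvg_whp (Z : nat -> Omega -> R) (c : R) : Prop :=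
  forall eps : R, 0 < eps -> whp (fun n => [set w | `|Z n w - c| < eps]).

Lemma whp_sub (E E' : nat -> set Omega) (n1 : nat) :
  (forall n, (n1 <= n)%N -> E n `<=` E' n) -> whp E -> whp E'.
Proof.
move=> EE' hE delta d0; have [n0 h] := hE _ d0; exists (maxn n0 n1) => n.
rewrite geq_max => /andP[/h[B [mB PB hB]] n1n]; exists B; split => // w /hB.
exact: EE'.
Qed.

Lemma whpI (E E' : nat -> set Omega) : whp E -> whp E' ->
  whp (fun n => E n `&` E' n).
Proof.
move=> hE hE' delta d0; have d2 : 0 < delta / 2 by rewrite divr_gt0.
have [n0 h] := hE _ d2; have [n1 h'] := hE' _ d2.
exists (maxn n0 n1) => n; rewrite geq_max => /andP[/h[B [mB PB hB]] /h'[C [mC PC hC]]].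
exists (B `|` C); split; first exact: measurableU.
  apply: le_trans (measureU2 P mB mC) _.
  by rewrite [delta]splitr EFinD; exact: leeD.
by move=> w /not_orP[/hB ? /hC ?].
Qed.

Lemma whp_ae (E : nat -> set Omega) :
  (forall n, exists2 N, measurable N /\ P N = 0%E & forall w, ~ N w -> E n w) ->
  whp E.
Proof.
move=> h delta d0; exists 0%N => n _; have [N [mN PN] hN] := h n.
by exists N; split => //; rewrite PN lee_fin ltW.
Qed.

Lemma near_inv_lt (eps : R) : 0 < eps ->
  exists n0, forall n, (n0 <= n)%N -> (n.+1%:R)^-1 < eps.
Proof.
move=> e0; exists (Num.truncn eps^-1) => n hn.
rewrite invf_plt ?posrE//; apply: lt_le_trans (truncnS_gt _) _.
by rewrite ler_nat ltnS.
Qed.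

Lemma cvg_whp_mul (A B : nat -> Omega -> R) (a b : R) :
  cvg_whp A a -> cvg_whp B b -> cvg_whp (fun n w => A n w * B n w) (a * b).
Proof.
move=> hA hB eps e0.
(* [eta <= 1] bounds the product of the two errors by one of them, so the total error is below
   [eta * (|a| + |b| + 1) <= eps]. *)
pose eta : R := Num.min 1 (eps / (`|a| + `|b| + 1)).
have den0 : 0 < `|a| + `|b| + 1 by rewrite ltr_wpDl// addr_ge0.
have eta0 : 0 < eta by rewrite lt_min ltr01 divr_gt0.
have eta1 : eta <= 1 by rewrite ge_min lexx.
have eta2 : eta * (`|a| + `|b| + 1) <= eps.
  by rewrite -ler_pdivlMr// ge_min lexx orbT.
apply: (whp_sub (n1 := 0%N)) (whpI (hA _ eta0) (hB _ eta0)) => n _ w [/= h1 h2].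
have -> : A n w * B n w - a * b =
   (A n w - a) * (B n w - b) + ((A n w - a) * b + a * (B n w - b)) by ring.
apply: lt_le_trans eta2.
apply: le_lt_trans (ler_normD _ _) _.
apply: le_lt_trans (lerD (lexx _) (ler_normD _ _)) _.
rewrite !normrM; move: h1 h2 (normr_ge0 (A n w - a)) (normr_ge0 (B n w - b)).
move: (normr_ge0 a) (normr_ge0 b).
set x := `|A n w - a|; set y := `|B n w - b|.
move=> a0 b0 xe ye x0 y0.
have h1 : x * y <= x by rewrite ler_piMr// (le_trans (ltW ye)).
have h2 : x * `|b| <= eta * `|b| by rewrite ler_wpM2r// ltW.
have h3 : `|a| * y <= `|a| * eta by rewrite ler_wpM2l// ltW.
by lra.
Qed.

Lemma cvg_whp_cst (c : R) : cvg_whp (fun _ _ => c) c.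
Proof.
move=> eps e0; apply: whp_ae => n; exists set0; first by split; rewrite ?measure0.
by move=> w _ /=; rewrite subrr normr0.
Qed.

Lemma measurable_le_norm (f : Omega -> R) (r : R) : measurable_fun setT f ->
  measurable [set w | r <= `|f w|].
Proof.
move=> mf; rewrite [X in measurable X](_ : _ = ~` [set w | `|f w| < r]).
  apply: measurableC; apply: measurable_set_ltr => //.
  exact: measurableT_comp.
by apply/seteqP; split => w /=; rewrite leNgt => /negP.
Qed.

Lemma cvg_whp_squeeze (A B Z : nat -> Omega -> R) (c : R) (E : nat -> set Omega) :
  whp E -> (forall n w, E n w -> A n w <= Z n w <= B n w) ->
  cvg_whp A c -> cvg_whp B c -> cvg_whp Z c.
Proof.
move=> hE AZB hA hB eps e0.
apply: (whp_sub (n1 := 0%N)) (whpI hE (whpI (hA _ e0) (hB _ e0))).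
move=> n _ w [/AZB/andP[h1 h2] [/=]]; rewrite !ltr_norml.
by move=> /andP[? ?] /andP[? ?]; apply/andP; split; lra.
Qed.

Lemma cvg_whp_eq (Z Z' : nat -> Omega -> R) (c : R) (E : nat -> set Omega) :
  whp E -> (forall n w, E n w -> Z n w = Z' n w) -> cvg_whp Z c -> cvg_whp Z' c.
Proof.
move=> hE ZZ' hZ; apply: (cvg_whp_squeeze hE _ hZ hZ) => n w /ZZ' ->.
by rewrite lexx.
Qed.

Lemma cvg_whp_sub (A B : nat -> Omega -> R) (a b : R) :
  cvg_whp A a -> cvg_whp B b -> cvg_whp (fun n w => A n w - B n w) (a - b).
Proof.
move=> hA hB eps e0; have e2 : 0 < eps / 2 by rewrite divr_gt0.
apply: (whp_sub (n1 := 0%N)) (whpI (hA _ e2) (hB _ e2)) => n _ w [/=].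
rewrite !ltr_norml => /andP[? ?] /andP[? ?]; apply/andP; split; lra.
Qed.

(** The tolerance [2 / n.+1%:R] admits both a truncation of [gam * n.+1%:R] and, with [gam = 0], a
    constant number of at most two terms. *)
Lemma uniform_lln_whp (Z : nat -> nat -> Omega -> R) (c gam : R) (K : nat -> nat) :
  uniform_lln P Z c -> 0 <= gam ->
  (forall n, `|(K n)%:R / n.+1%:R - gam| <= 2 / n.+1%:R) ->
  cvg_whp (fun n w => (\sum_(i < K n) Z n i w) / n.+1%:R) (gam * c).
Proof.
move=> [C C0 hZ] gam0 hK eps e0 delta d0.
have e20 : 0 < eps / 2 by rewrite divr_gt0.
have g2 : 0 <= C * (gam + 2) by rewrite mulr_ge0// addr_ge0.
(* [n0] brings the Chebyshev bound of the centred sum below [delta]; [n1] below brings the bias of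
   at most [2 * |c| / n.+1%:R] below [eps / 2]. *)
have [n0 hn0] := near_inv_lt (divr_gt0 (mulr_gt0 d0 (exprn_gt0 2 e20))
  (ltr_wpDl g2 ltr01)).
have c40 : 0 < 2 * (`|c| + 1) by rewrite mulr_gt0// ltr_wpDl.
have [n1 hn1] := near_inv_lt (divr_gt0 e20 c40).
exists (maxn n0 n1) => n; rewrite geq_max => /andP[/hn0 {}hn0 /hn1 {}hn1].
have N0 : 0 < n.+1%:R :> R by [].
have eN0 : 0 < eps / 2 * n.+1%:R by rewrite mulr_gt0.
set inv := (n.+1%:R)^-1 in hn0 hn1.
have inv0 : 0 < inv by rewrite invr_gt0.
have Ninv : n.+1%:R * inv = 1 by rewrite divff// gt_eqF.
have hKn := hK n; rewrite -/inv in hKn.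
have KE : (K n)%:R <= (gam + 2) * n.+1%:R.
  move: hKn; rewrite ler_norml => /andP[_]; rewrite lerBlDr => hk.
  rewrite -ler_pdivrMr// -/inv; apply: le_trans hk _; rewrite addrC lerD2l.
  by rewrite ler_piMr// invf_le1// ler1n.
exists [set w | eps / 2 * n.+1%:R <= `|\sum_(i < K n) (Z n i w - c)|]; split.
- apply: measurable_le_norm; apply: measurable_sum => i.
  by apply: measurable_funB => //; have [] := hZ n.
- apply: le_trans (mean_lln_markov (K n) (hZ n) eN0) _; rewrite lee_fin.
  rewrite ler_pdivrMr ?exprn_gt0//.
  apply: (@le_trans _ _ (C * (gam + 2) * n.+1%:R)); first by rewrite -mulrA ler_wpM2l.
  move: hn0; rewrite ltr_pdivlMr ?ltr_wpDl// => hn0.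
  have : inv * (C * (gam + 2)) <= delta * (eps / 2) ^+ 2.
    by apply: le_trans (ltW hn0); rewrite ler_wpM2l ?(ltW inv0)// lerDl.
  move=> /(ler_wpM2r (sqr_ge0 n.+1%:R)).
  rewrite [X in X <= _](_ : _ = C * (gam + 2) * n.+1%:R); last first.
    rewrite expr2 mulrA [inv * _]mulrC -[_ * inv * _]mulrA [inv * _]mulrC Ninv.
    by rewrite mulr1.
  suff -> : delta * (eps / 2 * n.+1%:R) ^+ 2 = delta * (eps / 2) ^+ 2 * n.+1%:R ^+ 2.
    by [].
  by rewrite [(_ * n.+1%:R) ^+ 2]exprMn mulrA.
move=> w /=; move/negP; rewrite -ltNge => hw.
rewrite (_ : _ - _ = (\sum_(i < K n) (Z n i w - c)) / n.+1%:R +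
    c * ((K n)%:R / n.+1%:R - gam)); last first.
  by rewrite sumrB sumr_const card_ord -[c *+ _]mulr_natr; ring.
rewrite [eps]splitr; apply: le_lt_trans (ler_normD _ _) _; apply: ltr_leD.
  by rewrite normrM normfV normr_nat ltr_pdivrMr.
rewrite normrM.
apply: (@le_trans _ _ (`|c| * (2 * inv))); first by rewrite ler_wpM2l.
move: hn1; rewrite ltr_pdivlMr// => hn1.
rewrite (_ : `|c| * (2 * inv) = inv * (2 * (`|c| + 1)) - 2 * inv); last by ring.
by lra.
Qed.

Lemma truncn_bounds (a : R) : 0 <= a ->
  (Num.truncn a)%:R <= a < (Num.truncn a)%:R + 1.
Proof. by move=> /truncn_itv; rewrite natr1. Qed.

Lemma natr_div_trunc (gam : R) n : 0 <= gam ->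
  `|(Num.truncn (gam * n.+1%:R))%:R / n.+1%:R - gam| <= 2 / n.+1%:R.
Proof.
move=> g0; have N0 : 0 < n.+1%:R :> R by [].
have /andP[h1 h2] := truncn_bounds (mulr_ge0 g0 (ltW N0)).
rewrite (_ : _ - gam = ((Num.truncn (gam * n.+1%:R))%:R - gam * n.+1%:R) / n.+1%:R).
  rewrite normrM normfV normr_nat ler_pM2r ?invr_gt0// ler_norml.
  by apply/andP; split; lra.
by rewrite mulrBl mulfK ?gt_eqF.
Qed.

Lemma ler_sum_range (f : nat -> R) j k : (forall i, 0 <= f i) -> (j <= k)%N ->
  \sum_(i < j) f i <= \sum_(i < k) f i.
Proof.
move=> f0 jk; rewrite -!(big_mkord predT f) (big_cat_nat (leq0n j) jk)//= lerDl.
by apply: sumr_ge0.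
Qed.

Lemma sandwich_near (a x b gma gpa ga h eps : R) :
  - (eps / 2) < a - gma -> b - gpa < eps / 2 -> a <= x -> x <= b ->
  h < eps / 2 -> - h <= gma - ga -> gpa <= ga + h -> - eps < x - ga < eps.
Proof. by move=> *; apply/andP; split; lra. Qed.

Lemma cvg_whp_random_sum (Z : nat -> nat -> Omega -> R) (c gam : R)
    (kap : nat -> Omega -> nat) :
  uniform_lln P Z c -> (forall n i w, 0 <= Z n i w) -> 0 <= gam ->
  cvg_whp (fun n w => (kap n w)%:R / n.+1%:R) gam ->
  cvg_whp (fun n w => (\sum_(i < kap n w) Z n i w) / n.+1%:R) (gam * c).
Proof.
move=> hZ Z0 gam0 hkap eps e0.
have c1 : 0 < 2 * (`|c| + 1) by rewrite mulr_gt0// ltr_wpDl.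
(* Moving the limiting number of terms per [n] by [eta] moves the limit by [eta * |c| < eps / 2]. *)
pose eta : R := eps / (2 * (`|c| + 1)).
have eta0 : 0 < eta by rewrite divr_gt0.
have etac : eta * `|c| < eps / 2.
  have : eta * (2 * (`|c| + 1)) = eps by rewrite divfK ?gt_eqF.
  by have := normr_ge0 c; lra.
have e20 : 0 < eps / 2 by rewrite divr_gt0.
clearbody eta.
pose gm : R := Num.max 0 (gam - eta); pose gp : R := gam + eta.
have gm0 : 0 <= gm by rewrite le_max lexx.
have gp0 : 0 <= gp by rewrite addr_ge0// ltW.
have gmg : gam - eta <= gm <= gam.
  by rewrite le_max lexx orbT ge_max gam0/= lerBlDr lerDl ltW.
have hm := uniform_lln_whp hZ gm0 (fun n => natr_div_trunc n gm0) e20.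
have hp := uniform_lln_whp hZ gp0 (fun n => natr_div_trunc n gp0) e20.
apply: (whp_sub (n1 := 0%N)) (whpI (hkap _ eta0) (whpI hm hp)) => n _ w [].
have N0 : 0 < n.+1%:R :> R by [].
rewrite /= !ltr_norml => /andP[k1 k2] [/andP[m1 _] /andP[_ p2]].
have kp : (kap n w <= Num.truncn (gp * n.+1%:R))%N.
  by rewrite truncn_ge_nat ?mulr_ge0// -ler_pdivrMr// /gp addrC -lerBlDr ltW.
have km : (Num.truncn (gm * n.+1%:R) <= kap n w)%N.
  rewrite -(ler_nat R); apply: (@le_trans _ _ (gm * n.+1%:R)).
    by rewrite truncn_le ?mulr_ge0.
  by rewrite -ler_pdivlMr// /gm ge_max divr_ge0//= addrC ltW// -ltrBrDr.
have := ler_sum_range (fun i => Z0 n i w) km.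
have := ler_sum_range (fun i => Z0 n i w) kp.
have iN0 : 0 <= n.+1%:R^-1 :> R by rewrite invr_ge0 ltW.
move=> /(ler_wpM2r iN0) S2 /(ler_wpM2r iN0) S1.
have gc : `|gm * c - gam * c| <= eta * `|c|.
  rewrite -mulrBl normrM ler_wpM2r// ler_norml.
  by move/andP: gmg => [? ?]; apply/andP; split; lra.
have pc : gp * c <= gam * c + eta * `|c|.
  by rewrite /gp mulrDl lerD2l ler_wpM2l ?(ltW eta0)// ler_norm.
move: gc; rewrite ler_norml => /andP[g1 _].
exact: (sandwich_near m1 p2 S1 S2 etac g1 pc).
Qed.

(** The omitted initial terms are themselves a sum with a constant number of terms, negligible after
    division by [n.+1%:R]. *)
Lemma cvg_whp_random_sum_from (Z : nat -> nat -> Omega -> R) (c gam : R)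
    (kap : nat -> Omega -> nat) (m : nat) :
  (m <= 2)%N -> uniform_lln P Z c -> (forall n i w, 0 <= Z n i w) -> 0 <= gam ->
  cvg_whp (fun n w => (kap n w)%:R / n.+1%:R) gam ->
  cvg_whp (fun n w => (\sum_(m <= i < kap n w) Z n i w) / n.+1%:R) (gam * c).
Proof.
move=> m2 hZ Z0 gam0 hkap.
have h1 := cvg_whp_random_sum hZ Z0 gam0 hkap.
have hm n : `|m%:R / n.+1%:R - 0| <= 2 / n.+1%:R :> R.
  by rewrite subr0 ger0_norm ?divr_ge0// ler_wpM2r ?invr_ge0// (ler_nat R m 2).
have h2 := cvg_whp_sub h1 (uniform_lln_whp hZ (lexx 0) hm).
rewrite mul0r subr0 in h2.
apply: (cvg_whp_squeeze (E := fun=> setT) _ _ h2 h1).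
  by apply: whp_ae => n; exists set0; first by split; rewrite ?measure0.
move=> n w _; rewrite -mulrBl !ler_pM2r ?invr_gt0//.
rewrite -!(big_mkord predT (fun i => Z n i w)).
have [mk|km] := leqP m (kap n w).
  rewrite (big_cat_nat (leq0n m) mk)//= lerDr [X in X - _]addrC addrK lexx/=.
  exact: sumr_ge0.
rewrite (big_geq (ltnW km)) subr_le0 !big_mkord; apply/andP; split.
  exact: (ler_sum_range (fun i => Z0 n i w) (ltnW km)).
exact: sumr_ge0.
Qed.

Lemma least_ex (A : set nat) j : A j ->
  A (least A) /\ forall i, A i -> (least A <= i)%N.
Proof.
move=> Aj; have exA : exists i, `[< A i >] by exists j; exact/asboolP.
case: (ex_minnP exA) => k /asboolP Ak hk.
have -> : least A = k by apply: least_eq => // i Ai; apply: hk; exact/asboolP.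
by split => // i Ai; apply: hk; exact/asboolP.
Qed.

(** * First passage of the partial sums over a linear level *)

Section Crossing.
Variables (M : nat -> nat -> Omega -> R) (m : R).
Hypotheses (M_lln : uniform_lln P M m) (M_ge0 : forall n i w, 0 <= M n i w).
Hypothesis m_gt0 : 0 < m.

Let crossings (s : R) n w := [set k | n.+1%:R * s < \sum_(i < k.+1) M n i w].

(** With [M] the block lengths, the least index with [T_k] beyond the level is the number of
    synchronized times up to it, since indices start at 0. *)
Definition crossing s n w : nat := least (crossings s n w).

Lemma crossing_le s n w k : 0 <= s -> n.+1%:R * s < \sum_(i < k) M n i w ->
  (crossing s n w < k)%N /\ crossings s n w (crossing s n w).
Proof.
move=> s0; case: k => [|k] hk.
  by move: hk; rewrite big_ord0 ltNge mulr_ge0.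
by have [h1 h2] := least_ex (hk : crossings s n w k); split => //; rewrite ltnS h2.
Qed.

Lemma whp_crossed s (a : R) : 0 <= s -> s < a * m -> 0 <= a ->
  whp (fun n => [set w |
    n.+1%:R * s < \sum_(i < Num.truncn (a * n.+1%:R)) M n i w]).
Proof.
move=> s0 sa a0; have e0 : 0 < a * m - s by rewrite subr_gt0.
apply: (whp_sub (n1 := 0%N)) (uniform_lln_whp M_lln a0
  (fun n => natr_div_trunc n a0) e0) => n _ w /=.
by rewrite ltr_norml opprB ltrD2r => /andP[h1 _]; rewrite mulrC -ltr_pdivlMr.
Qed.

Lemma whp_not_crossed s (a : R) : a * m < s -> 0 <= a ->
  whp (fun n => [set w |
    \sum_(i < Num.truncn (a * n.+1%:R)) M n i w < n.+1%:R * s]).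
Proof.
move=> sa a0; have e0 : 0 < s - a * m by rewrite subr_gt0.
apply: (whp_sub (n1 := 0%N)) (uniform_lln_whp M_lln a0
  (fun n => natr_div_trunc n a0) e0) => n _ w /=.
by rewrite ltr_norml ltrD2r => /andP[_ h1]; rewrite (mulrC _ s) -ltr_pdivrMr.
Qed.

(** With high probability the level is crossed at all, so [least] does not return its default;
    nonnegative terms make the partial sums monotone, so crossing is final. *)
Lemma whp_crossingP s : 0 <= s -> whp (fun n => [set w | forall i,
  (\sum_(j < i.+1) M n j w <= n.+1%:R * s) = (i < crossing s n w)%N]).
Proof.
move=> s0.
have sm : s < (s / m + 1) * m by rewrite mulrDl divfK ?gt_eqF// mul1r ltrDl.
have a0 : 0 <= s / m + 1 by rewrite addr_ge0// divr_ge0// ltW.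
apply: (whp_sub (n1 := 0%N)) (whp_crossed s0 sm a0) => n _ w /=.
move=> /(crossing_le s0)[_ cr] i; apply/idP/idP => [h|].
  rewrite ltnNge; apply/negP => ci; move: cr; rewrite /crossings /= ltNge.
  move=> /negP; apply; apply: le_trans h.
  exact: (ler_sum_range (fun j => M_ge0 n j w)).
move=> ic; rewrite leNgt; apply/negP => h.
have [_ /(_ i h)] := least_ex (h : crossings s n w i).
by rewrite leqNgt ic.
Qed.

Lemma cvg_whp_crossing s : 0 <= s ->
  cvg_whp (fun n w => (crossing s n w)%:R / n.+1%:R) (s / m).
Proof.
move=> s0 eps e0; have e20 : 0 < eps / 2 by rewrite divr_gt0.
have [n0 hn0] := near_inv_lt e20.
have sm0 : 0 <= s / m by rewrite divr_ge0// ltW.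
have smm : s / m * m = s by rewrite divfK ?gt_eqF.
have ap0 : 0 <= s / m + eps / 2 by rewrite addr_ge0// ltW.
have hp : whp (fun n => [set w | (crossing s n w)%:R < n.+1%:R * (s / m + eps)]).
  have sp : s < (s / m + eps / 2) * m by rewrite mulrDl smm ltrDl mulr_gt0.
  apply: (whp_sub (n1 := 0%N)) (whp_crossed s0 sp ap0) => n _ w /=.
  have N0 : 0 < n.+1%:R :> R by [].
  move=> /(crossing_le s0)[+ _]; rewrite -(ltr_nat R) => /lt_le_trans; apply.
  apply: (@le_trans _ _ ((s / m + eps / 2) * n.+1%:R)).
    by rewrite truncn_le mulr_ge0.
  by rewrite mulrC ler_pM2l// lerD2l; lra.
(* Truncation costs one term, the [+ 1] here, which [hn0] makes smaller than [eps / 2] after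
   division. *)
have hm : whp (fun n => [set w |
    n.+1%:R * (s / m - eps / 2) <= (crossing s n w)%:R + 1]).
  have [am|am] := ltP (s / m - eps / 2) 0.
    apply: whp_ae => n; exists set0; first by split; rewrite ?measure0.
    move=> w _ /=; apply: (@le_trans _ _ 0); last by rewrite addr_ge0.
    by rewrite pmulr_rle0// ltW.
  have sp : (s / m - eps / 2) * m < s by rewrite mulrBl smm ltrBlDr ltrDl mulr_gt0.
  apply: (whp_sub (n1 := 0%N)) (whpI (whp_crossingP s0) (whp_not_crossed sp am)).
  move=> n _ w [/= hi h].
  set K := Num.truncn _ in h.
  have Kc : (K <= crossing s n w)%N.
    case: K h => [//|K] h; by rewrite -hi ltW.
  rewrite mulrC; have /andP[_ /ltW/le_trans] := truncn_bounds (mulr_ge0 am (ler0n R n.+1)).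
  by apply; rewrite lerD2r ler_nat.
apply: (whp_sub (n1 := n0)) (whpI hp hm) => n /hn0 hn w [/= h1 h2].
have N0 : 0 < n.+1%:R :> R by [].
have Ninv : n.+1%:R * n.+1%:R^-1 = 1 :> R by rewrite divff// gt_eqF.
rewrite ltr_norml; apply/andP; split; last first.
  by rewrite ltrBlDr ltr_pdivrMr// mulrC [eps + _]addrC.
rewrite -(@ltrD2r _ (s / m)) subrK ltr_pdivlMr//.
apply: (@lt_le_trans _ _ (n.+1%:R * (s / m - eps / 2) - 1)); last by rewrite lerBlDr.
have h3 : 1 < n.+1%:R * (eps / 2) by rewrite -ltr_pdivrMl// mulr1.
by rewrite [_ * n.+1%:R]mulrC !mulrDr !mulrN; lra.
Qed.

(** [N] is the largest index, one less than the number of times because they are numbered from 0. *)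
Lemma cvg_whp_crossing_pred s : 0 <= s ->
  cvg_whp (fun n w => (crossing s n w).-1%:R / n.+1%:R) (s / m).
Proof.
move=> s0; have h := cvg_whp_crossing s0.
have h0 : cvg_whp (fun n _ => 1 / n.+1%:R) 0.
  move=> eps /near_inv_lt[n0 hn0]; apply: (whp_sub (n1 := n0) (E := fun=> setT)).
    by move=> n /hn0 hn w _ /=; rewrite subr0 ger0_norm ?divr_ge0// mul1r.
  by apply: whp_ae => n; exists set0; first by split; rewrite ?measure0.
have h1 := cvg_whp_sub h h0; rewrite subr0 in h1.
apply: (cvg_whp_squeeze (E := fun=> setT) _ _ h1 h).
  by apply: whp_ae => n; exists set0; first by split; rewrite ?measure0.
move=> n w _; rewrite -mulrBl !ler_pM2r ?invr_gt0// lerBlDr.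
rewrite ler_nat leq_pred andbT.
by case: (crossing s n w) => [|k]; rewrite ?add0r ?natr1//= ler0n.
Qed.

End Crossing.

End HighProbability.

(** * Scaling of time *)

Section Scaling.
Context (R : realType).
Variables (c : R) (u v : nat -> R).
Hypothesis c0 : 0 < c.

Let cu k := c * u k.
Let cv k := c * v k.

Lemma sync_step_scale qr : sync_step cu cv qr = sync_step u v qr.
Proof.
have ceq x y : (c * x == c * y) = (x == y) by apply: inj_eq; apply: mulfI; rewrite gt_eqF.
have muE q r : step_mu cu cv q r = step_mu u v q r.
  rewrite /step_mu /cu /cv ltr_pM2l//; case: ifP => // _; congr least.
  by apply/seteqP; split => k /=; rewrite ler_pM2l.
have wE q r : step_w cu cv q r = step_w u v q r.
  rewrite /step_w /cu /cv ltr_pM2l//; case: ifP => // _; congr least.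
  by apply/seteqP; split => k /=; rewrite ler_pM2l.
by case: qr => q r; rewrite /sync_step muE wE /cu /cv ltr_pM2l// !ceq.
Qed.

Lemma sync_qr_scale i :
  sync_q cu cv i = sync_q u v i /\ sync_r cu cv i = sync_r u v i.
Proof.
suff E : iter i (sync_step cu cv) (0%N, 0%N) = iter i (sync_step u v) (0%N, 0%N).
  by rewrite /sync_q /sync_r E.
by elim: i => //= i ->; rewrite sync_step_scale.
Qed.

Lemma sync_g_scale i : sync_g cu cv i = c * sync_g u v i.
Proof.
have [qE rE] := sync_qr_scale i; rewrite /sync_g qE rE /cu; congr (c * u _).
rewrite /step_mu /cu /cv ltr_pM2l//; case: ifP => // _; congr least.
by apply/seteqP; split => k /=; rewrite ler_pM2l.
Qed.

Lemma sync_gamma_scale i : sync_gamma cu cv i = c * sync_gamma u v i.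
Proof.
have [qE rE] := sync_qr_scale i; rewrite /sync_gamma qE rE /cv; congr (c * v _).
rewrite /step_w /cu /cv ltr_pM2l//; case: ifP => // _; congr least.
by apply/seteqP; split => k /=; rewrite ler_pM2l.
Qed.

Lemma sync_T_scale i : sync_T cu cv i = c * sync_T u v i.
Proof. by rewrite /sync_T sync_g_scale sync_gamma_scale minr_pMr// ltW. Qed.

Lemma sync_l_scale i : sync_l cu cv i = c * sync_l u v i.
Proof. by rewrite /sync_l; have [-> _] := sync_qr_scale i. Qed.

Lemma sync_lambda_scale i : sync_lambda cu cv i = c * sync_lambda u v i.
Proof. by rewrite /sync_lambda; have [_ ->] := sync_qr_scale i. Qed.

Lemma sync_DT_scale i : sync_DT cu cv i = c * sync_DT u v i.
Proof. by rewrite /sync_DT !sync_T_scale mulrBr. Qed.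

Lemma sync_N_scale T : sync_N cu cv (c * T) = sync_N u v T.
Proof.
by congr greatest; apply/seteqP; split => k /=; rewrite sync_T_scale ler_pM2l.
Qed.

Let scaleE := (sync_T_scale, sync_g_scale, sync_gamma_scale, sync_l_scale,
  sync_lambda_scale, sync_DT_scale).

(** The quadratic summands gain [c ^+ 2], cancelled by [c * T] in the prefactor and by the outer
    division. *)
Let scale_sum (N m : nat) (T : R) (Q : pred nat) (f g : nat -> R) :
  (forall i, f i = c ^+ 2 * g i) ->
  N%:R / (c * T) * (\sum_(1 <= i < m | Q i) f i) / c =
  N%:R / T * \sum_(1 <= i < m | Q i) g i.
Proof.
move=> fg; under eq_bigr do rewrite fg.
rewrite -mulr_sumr invfM expr2; set S := \sum_(_ <= _ < _ | _) _.
have cV : c * c^-1 = 1 by rewrite divff// gt_eqF.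
transitivity (N%:R / T * S * (c * c^-1) * (c * c^-1)); first by ring.
by rewrite cV !mulr1.
Qed.

Lemma qvar_G_scale T s :
  qvar_G cu cv (c * T) (c * s) / c = qvar_G u v T s.
Proof.
rewrite /qvar_G sync_N_scale.
under eq_bigl do rewrite sync_T_scale ler_pM2l//.
by apply: scale_sum => i; rewrite sync_DT_scale exprMn.
Qed.

Lemma qvar_F_scale T s :
  qvar_F cu cv (c * T) (c * s) / c = qvar_F u v T s.
Proof.
rewrite /qvar_F sync_N_scale.
under eq_bigl do rewrite sync_T_scale ler_pM2l//.
by apply: scale_sum => i; rewrite !scaleE; ring.
Qed.

Lemma qvar_H_scale T s :
  qvar_H cu cv (c * T) (c * s) / c = qvar_H u v T s.
Proof.
rewrite /qvar_H sync_N_scale.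
under eq_bigl do rewrite sync_T_scale ler_pM2l//.
by apply: scale_sum => i; rewrite !scaleE; ring.
Qed.

End Scaling.

(** * From crossing indices to the quadratic variations *)

Section CrossingSums.
Context (R : realType).
Variables (u v : nat -> R) (T s : R) (kT ks : nat).
Hypothesis s_le_T : s <= T.
Hypothesis kTP : forall i, (sync_T u v i <= T) = (i < kT)%N.
Hypothesis ksP : forall i, (sync_T u v i <= s) = (i < ks)%N.

Let ks_le_kT : (ks <= kT)%N.
Proof.
case: ks ksP => // k kP; rewrite -kTP.
by apply: le_trans s_le_T; rewrite kP.
Qed.

Lemma sync_N_crossing : sync_N u v T = kT.-1.
Proof.
rewrite /sync_N; case: kT kTP => [|k] kP.
  (* If no synchronized time lies in the interval, the default 0 agrees with [0.-1]. *)
  by apply: greatest_none => n [/= + _]; rewrite kP ltn0.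
by apply: greatest_eq => [|j]; rewrite /= kP.
Qed.

Lemma qvar_G_crossing (g : nat -> R) :
  (forall i, sync_DT u v i.+1 ^+ 2 = g i.+1) ->
  qvar_G u v T s = kT.-1%:R / T * \sum_(1 <= i < ks) g i.
Proof.
move=> gE; rewrite /qvar_G sync_N_crossing; congr (_ * _).
under eq_bigl do rewrite ksP.
case: kT ks_le_kT => [|k] /= ksk.
  by rewrite !big_geq// (leq_trans ksk).
rewrite (big_nat_widen _ _ _ _ _ ksk) big_nat_cond [RHS]big_nat_cond.
by apply: eq_bigr; case.
Qed.

Lemma sum_crossing (f g : nat -> R) : (forall i, f i.+1 = g i.+2) ->
  \sum_(1 <= i < kT.-1 | sync_T u v i.+1 <= s) f i = \sum_(2 <= k < ks) g k.
Proof.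
move=> fg; under eq_bigl do rewrite ksP.
(* The condition at level [s] already keeps the index below the bound coming from [N], because
   [ks <= kT]. *)
rewrite [RHS]big_add1 [RHS](big_nat_widen _ _ kT.-1)/=; last first.
  by case: ks ks_le_kT => // a; case: kT => // b; rewrite ltnS.
rewrite big_nat_cond [RHS]big_nat_cond; apply: eq_big.
  by move=> i; congr (_ && _); case: ks.
by case.
Qed.

Lemma qvar_F_crossing (g : nat -> R) :
  (forall i,
    (sync_T u v i.+1 - sync_lambda u v i.+1) * (sync_g u v i.+1 - sync_T u v i.+1)
    + (sync_T u v i.+1 - sync_l u v i.+1) * (sync_gamma u v i.+1 - sync_T u v i.+1)
    + sync_DT u v i.+2 * (sync_T u v i.+1 - sync_l u v i.+2)
    + sync_DT u v i.+2 * (sync_T u v i.+1 - sync_lambda u v i.+2) = g i.+2) ->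
  qvar_F u v T s = kT.-1%:R / T * \sum_(2 <= i < ks) g i.
Proof. by move=> gE; rewrite /qvar_F sync_N_crossing; congr (_ * _); exact: sum_crossing. Qed.

Lemma qvar_H_crossing (g : nat -> R) :
  (forall i,
    (sync_T u v i.+1 - sync_l u v i.+2) * (sync_g u v i.+1 - sync_T u v i.+1)
    + (sync_T u v i.+1 - sync_lambda u v i.+2) * (sync_gamma u v i.+1 - sync_T u v i.+1)
    = g i.+2) ->
  qvar_H u v T s = kT.-1%:R / T * \sum_(2 <= i < ks) g i.
Proof. by move=> gE; rewrite /qvar_H sync_N_crossing; congr (_ * _); exact: sum_crossing. Qed.

End CrossingSums.

(** * Limits of the quadratic variations *)

Section GoodPaths.
Context (R : realType) d (Omega : measurableType d).
Variables (t tau : nat -> nat -> Omega -> R) (n : nat) (w : Omega).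
Let u := t n ^~ w.
Let v := tau n ^~ w.
Hypothesis good : forall i, good_step u v i.

Let res_ge0 i : 0 <= resid u v i 0 /\ 0 <= resid v u i 0.
Proof. by have [] := good i. Qed.

Let age_ge0 i : 0 <= last_age u v i.
Proof. by case: (good_step_cases (good i)) => [[]|[]]. Qed.

Let last_waitE i : last_wait (t n) (tau n) i w = tau_last u v i * resid v u i 0.
Proof.
have [_ h] := res_ge0 i.
by rewrite /last_wait /first_wait /res_seq ger0_norm.
Qed.

Let last_waitE' i : last_wait (tau n) (t n) i w = tau_last v u i * resid u v i 0.
Proof.
have [h _] := res_ge0 i.
by rewrite /last_wait /first_wait /res_seq ger0_norm.
Qed.

Let stale_ageE i : stale_age (t n) (tau n) i w = tau_last u v i * last_age u v i.
Proof. by rewrite /stale_age /age_at ger0_norm. Qed.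

Let stale_ageE' i : stale_age (tau n) (t n) i w = tau_last v u i * last_age u v i.
Proof. by rewrite /stale_age age_at_swap /age_at ger0_norm. Qed.

Let first_waitE i : first_wait (t n) (tau n) i w = resid u v i 0.
Proof. by have [h _] := res_ge0 i; rewrite /first_wait /res_seq ger0_norm. Qed.

Let first_waitE' i : first_wait (tau n) (t n) i w = resid v u i 0.
Proof. by have [_ h] := res_ge0 i; rewrite /first_wait /res_seq ger0_norm. Qed.

Let second_lastE i : second_last (t n) (tau n) i w = tau_last u v i.
Proof. by []. Qed.

Let second_lastE' i : second_last (tau n) (t n) i w = tau_last v u i.
Proof. by []. Qed.

Let blockE i : block_length u v i =
  tau_last u v i * resid v u i 0 + tau_last v u i * resid u v i 0.
Proof.
case: (good_step_cases (good i)) => [[-> -> _ [_ -> _ _ _]]|[-> -> _ [_ -> _ _ _]]].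
  by rewrite mul1r mul0r addr0.
by rewrite mul1r mul0r add0r.
Qed.

Lemma length_var_good i : length_var t tau n i w = block_length u v i.
Proof. by rewrite /length_var last_waitE last_waitE' blockE. Qed.

Lemma sync_T_good i : sync_T u v i = \sum_(j < i.+1) length_var t tau n j w.
Proof.
rewrite sync_T_sum; last by move=> j _; exact: good.
by apply: eq_bigr => j _; rewrite length_var_good.
Qed.

Lemma G_var_good i : sync_DT u v i.+1 ^+ 2 = G_var t tau n i.+1 w.
Proof.
rewrite sync_DT_length ?blockE; last exact: good.
rewrite /G_var last_waitE last_waitE'.
(* One of the two indicators is 0, so the square of the sum is the sum of the squares. *)
case: (good_step_cases (good i.+1)) => [[-> -> _ _]|[-> -> _ _]]; ring.
Qed.

Lemma H_var_good i :
  (sync_T u v i.+1 - sync_l u v i.+2) * (sync_g u v i.+1 - sync_T u v i.+1)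
  + (sync_T u v i.+1 - sync_lambda u v i.+2) * (sync_gamma u v i.+1 - sync_T u v i.+1)
  = H_var t tau n i.+2 w.
Proof.
rewrite H_term; last exact: good.
by rewrite /H_var /= stale_ageE stale_ageE' first_waitE first_waitE'.
Qed.

Lemma F_var_good i :
  (sync_T u v i.+1 - sync_lambda u v i.+1) * (sync_g u v i.+1 - sync_T u v i.+1)
  + (sync_T u v i.+1 - sync_l u v i.+1) * (sync_gamma u v i.+1 - sync_T u v i.+1)
  + sync_DT u v i.+2 * (sync_T u v i.+1 - sync_l u v i.+2)
  + sync_DT u v i.+2 * (sync_T u v i.+1 - sync_lambda u v i.+2)
  = F_var t tau n i.+2 w.
Proof.
rewrite /F_var /half_F_var [RHS]/=.
rewrite !stale_ageE !stale_ageE' !first_waitE !first_waitE' !last_waitE !last_waitE'.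
rewrite (second_lastE i.+1) (second_lastE' i.+1) F_term; [|exact: good..].
by rewrite blockE; ring.
Qed.

End GoodPaths.

Section ScaledLimits.
Context (R : realType) d (Omega : measurableType d) (P : probability Omega R).
Variables (la mu : R) (la0 : 0 < la) (mu0 : 0 < mu).
Variables (t tau : nat -> nat -> Omega -> R).
Hypotheses (mt : forall n k, measurable_fun setT (t n k))
  (mtau : forall n k, measurable_fun setT (tau n k)).
Hypothesis h0 : forall n,
  poisson_on P la mu setT (res_seq (t n) (tau n) 0) (res_seq (tau n) (t n) 0).
Variables (T s : R) (T_gt0 : 0 < T) (s_0T : 0 <= s <= T).

Let F n := history (t n) (tau n).
Let F_measurable n k : F n k `<=` measurable.
Proof. exact: (history_measurable la0 mu0 (mt n) (mtau n) (h0 n)). Qed.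

Let F_nd n k : F n k `<=` F n k.+1.
Proof. exact: history_nd. Qed.

Let sf n : sync_filtration P (F n) la mu (t n) (tau n) :=
  sync_filtration_history la0 mu0 (mt n) (mtau n) (h0 n).

Definition mean_block : R := mean_last_wait la mu 1 + mean_last_wait mu la 1.

Lemma mean_blockE : mean_block = (la ^+ 2 + la * mu + mu ^+ 2) / (la * mu * (la + mu)).
Proof.
have h := addr_gt0 la0 mu0.
rewrite /mean_block /mean_last_wait (_ : 1`!%N = 1%N)//.
by field; rewrite ?gt_eqF//= addrC.
Qed.

Lemma mean_block_gt0 : 0 < mean_block.
Proof.
by rewrite mean_blockE divr_gt0// ?mulr_gt0 ?addr_gt0 ?exprn_gt0 ?mulr_gt0.
Qed.

Let M_ge0 n i w : 0 <= length_var t tau n i w.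
Proof. by rewrite addr_ge0// last_wait_ge0. Qed.

Let M_lln := lln_length F_measurable F_nd la0 mu0 sf.

(** A countable union of null sets makes all steps good at once. *)
Let all_good : whp P (fun n => [set w | forall i, good_step (t n ^~ w) (tau n ^~ w) i]).
Proof.
apply: whp_ae => n.
have gs := good_step_ae la0 mu0 (mt n) (mtau n) (h0 n).
pose N i := projT1 (cid2 (gs i)).
have NP i : measurable (N i) /\ P (N i) = 0%E by rewrite /N; case: cid2.
have gN i w : ~ N i w -> good_step (t n ^~ w) (tau n ^~ w) i.
  by rewrite /N; case: cid2 => ? ? h; exact: h.
exists (\bigcup_i N i).
  split; first by apply: bigcup_measurable => i _; have [] := NP i.
  apply/eqP; rewrite -measure_le0; apply: le_trans.
    apply: (measure_sigma_subadditive P) => [i||]; last exact: subset_refl.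
      by have [] := NP i.
    by apply: bigcup_measurable => i _; have [] := NP i.
  by rewrite eseries0// => i _ _; have [] := NP i.
by move=> w nN i; apply: gN => Ni; apply: nN; exists i.
Qed.

Let kap := crossing (length_var t tau).

Lemma cvg_whp_qvar (qvar : nat -> Omega -> R) (Z : nat -> nat -> Omega -> R)
    (c : R) (m : nat) :
  (m <= 2)%N -> uniform_lln P Z c -> (forall n i w, 0 <= Z n i w) ->
  (forall n w, (forall i, good_step (t n ^~ w) (tau n ^~ w) i) ->
    (forall i, (sync_T (t n ^~ w) (tau n ^~ w) i <= n.+1%:R * T) = (i < kap T n w)%N) ->
    (forall i, (sync_T (t n ^~ w) (tau n ^~ w) i <= n.+1%:R * s) = (i < kap s n w)%N) ->
    qvar n w = (kap T n w).-1%:R / (n.+1%:R * T) * \sum_(m <= i < kap s n w) Z n i w) ->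
  cvg_whp P (fun n w => qvar n w / n.+1%:R) (c / mean_block ^+ 2 * s).
Proof.
move=> m2 hZ Z0 hq; have /andP[s0 sT] := s_0T; have T0 := ltW T_gt0.
have m0 := mean_block_gt0.
have hT := cvg_whp_crossing_pred M_lln M_ge0 m0 T0.
have hs := cvg_whp_crossing M_lln M_ge0 m0 s0.
have sm0 : 0 <= s / mean_block by rewrite divr_ge0// ltW.
have hS := cvg_whp_random_sum_from m2 hZ Z0 sm0 hs.
have h := cvg_whp_mul (cvg_whp_mul hT (cvg_whp_cst P T^-1)) hS.
(* The first factor is the limit of [N / n] over [T]; the second is [s / mean_block] terms per [n],
   each of mean [c]. *)
have cE : T / mean_block / T * (s / mean_block * c) = c / mean_block ^+ 2 * s.
  by field; rewrite ?gt_eqF.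
rewrite -cE; apply: (cvg_whp_eq _ _ h).
  exact: (whpI all_good (whpI (whp_crossingP M_lln M_ge0 m0 T0)
    (whp_crossingP M_lln M_ge0 m0 s0))).
move=> n w [good [hkT hks]].
rewrite hq//; last 2 first.
- by move=> i; rewrite sync_T_good//; exact: hkT.
- by move=> i; rewrite sync_T_good//; exact: hks.
by rewrite invfM; ring.
Qed.

Let scaled_le n : n.+1%:R * s <= n.+1%:R * T.
Proof. by case/andP: s_0T => _; rewrite ler_pM2l. Qed.

Lemma cvg_whp_G : cvg_whp P
  (fun n w => qvar_G (t n ^~ w) (tau n ^~ w) (n.+1%:R * T) (n.+1%:R * s) / n.+1%:R)
  ((mean_last_wait la mu 2 + mean_last_wait mu la 2) / mean_block ^+ 2 * s).
Proof.
apply: (cvg_whp_qvar (m := 1) _ (lln_G F_measurable F_nd la0 mu0 sf)) => //.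
  by move=> n i w; rewrite addr_ge0// sqr_ge0.
move=> n w good hT hs; apply: qvar_G_crossing => // i.
exact: G_var_good.
Qed.

Let delay_ge0 (Z : nat -> Omega -> R) k w : (forall i, 0 <= Z i w) -> 0 <= delay Z k w.
Proof. by case: k => [|k] //= ->. Qed.

Lemma stale_age_ge0 (a b : nat -> Omega -> R) k w : 0 <= stale_age a b k w.
Proof. by rewrite mulr_ge0//; have /andP[] := second_last01 a b k w. Qed.

Lemma cvg_whp_H : cvg_whp P
  (fun n w => qvar_H (t n ^~ w) (tau n ^~ w) (n.+1%:R * T) (n.+1%:R * s) / n.+1%:R)
  ((la / (la + mu) ^+ 2 * la^-1 + mu / (mu + la) ^+ 2 * mu^-1) / mean_block ^+ 2 * s).
Proof.
apply: (cvg_whp_qvar (m := 2) _ (lln_H F_measurable F_nd la0 mu0 sf)) => //.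
  move=> n i w; rewrite addr_ge0// mulr_ge0 ?normr_ge0// delay_ge0// => j;
    exact: stale_age_ge0.
move=> n w good hT hs; apply: qvar_H_crossing => // i.
exact: H_var_good.
Qed.

Let half_F_var_ge0 (a b : nat -> nat -> Omega -> R) n i w : 0 <= half_F_var a b n i w.
Proof.
have l0 (a' b' : nat -> nat -> Omega -> R) j : 0 <= last_wait (a' n) (b' n) j w.
  exact: last_wait_ge0.
have s0 := stale_age_ge0.
rewrite /half_F_var !addr_ge0 ?mulr_ge0 ?normr_ge0 ?l0 ?delay_ge0// => j.
by rewrite mulr_ge0 ?delay_ge0.
Qed.

Lemma cvg_whp_F : cvg_whp P
  (fun n w => qvar_F (t n ^~ w) (tau n ^~ w) (n.+1%:R * T) (n.+1%:R * s) / n.+1%:R)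
  ((mean_last_wait la mu 1 * la^-1 +
     mu / (mu + la) ^+ 2 * (la / (la + mu)) * la^-1 +
     (la / (la + mu) ^+ 2 * mean_last_wait la mu 1 +
      la / (la + mu) ^+ 2 * mean_last_wait mu la 1) +
    (mean_last_wait mu la 1 * mu^-1 +
     la / (la + mu) ^+ 2 * (mu / (mu + la)) * mu^-1 +
     (mu / (mu + la) ^+ 2 * mean_last_wait mu la 1 +
      mu / (mu + la) ^+ 2 * mean_last_wait la mu 1))) / mean_block ^+ 2 * s).
Proof.
apply: (cvg_whp_qvar (m := 2) _ (lln_F F_measurable F_nd la0 mu0 sf)) => //.
  by move=> n i w; rewrite addr_ge0.
move=> n w good hT hs; apply: qvar_F_crossing => // i.
exact: F_var_good.
Qed.

End ScaledLimits.

(** * From Poisson processes to independent waiting times *)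

Section PoissonData.
Context (R : realType) d (Omega : measurableType d) (P : probability Omega R).
Local Open Scope ereal_scope.

Lemma mutually_independent_seq (I : choiceType) (G : I -> set (set Omega))
    (E : I -> set Omega) (r : seq I) : mutually_independent P G -> uniq r ->
  (forall i, i \in r -> G i (E i)) ->
  P (\bigcap_(i in [set` r]) E i) = \prod_(i <- r) P (E i).
Proof.
move=> ind ur hE; pose J := [fset i in r]%fset.
have := ind J E (fun i => fun iJ => hE i (eq_ind _ is_true iJ _ (in_fset _ _ i))).
have -> : [set` J] = [set` r] by apply/seteqP; split => i /=; rewrite in_fset.
move=> ->; apply: perm_big; apply: uniq_perm => //.
by move=> i; rewrite in_fset.
Qed.

Lemma cylinder_bigcap (As : seq (set R)) (a : nat -> Omega -> R) :
  cylinder As a =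
  \bigcap_(i in [set` iota 0 (size As)]) (a i @^-1` nth setT As i).
Proof.
rewrite [RHS](_ : _ = [set w | forall i, (i < size As)%N -> nth setT As i (a i w)]).
  apply/seteqP; split => [w|w]; elim: As a => [//|A As IH] a /=.
    by move=> [h0 h] [|i]//= iA; exact: (IH _ h i iA).
  by move=> h; split; [exact: (h 0%N)|apply: IH => i iA; exact: (h i.+1 iA)].
apply/seteqP; split => w h i /=.
  by move=> iA; apply: h; rewrite /= mem_iota.
by rewrite mem_iota add0n => /andP[_]; exact: h.
Qed.

Lemma weight_prod (la : R) (As : seq (set R)) :
  weight la As = \prod_(i <- iota 0 (size As)) exponential_prob la (nth setT As i).
Proof.
elim: As => [|A As IH] /=; first by rewrite big_nil.
by rewrite big_cons /= IH -[1%N]addn0 iotaDl big_map.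
Qed.

Lemma all_measurable_nth (As : seq (set R)) i :
  all_measurable As -> measurable (nth setT As i).
Proof.
elim: As i => [|A As IH] [|i] //=; last by move=> [_]; exact: IH.
by move=> [].
Qed.

Lemma measurable_scale_preimage (c : R) (A : set R) : measurable A ->
  measurable [set z | A (c * z)%R].
Proof.
move=> mA; rewrite -[X in measurable X]setTI.
have mM : measurable_fun [set: R] (fun z : R => c * z)%R by exact: measurable_funM.
exact: mM.
Qed.

Lemma prob_poisson_cylinder (theta c : R) (a : nat -> Omega -> R) (As : seq (set R)) :
  (0 < theta)%R -> (0 < c)%R -> poisson_arrival_times P (theta / c) a ->
  all_measurable As ->
  P (cylinder As (fun k w => c * waiting_time a k w)%R) = weight theta^-1 As.
Proof.
move=> th0 c0 [ma ind law] mAs.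
rewrite cylinder_bigcap weight_prod (mutually_independent_seq ind) ?iota_uniq//.
  apply: eq_bigr => i _; have mA := all_measurable_nth i mAs.
  have thc0 : (0 < (theta / c)^-1)%R by rewrite invr_gt0 divr_gt0.
  have lac0 : (0 < (theta / c)^-1 / c)%R by rewrite divr_gt0.
  have h := exponential_scale thc0 lac0 c0 mA.
  rewrite !exponential_lawE in h.
  have -> : (theta^-1 = (theta / c)^-1 / c)%R.
    by rewrite invf_div mulrAC divff ?gt_eqF// mul1r.
  by rewrite -[RHS]h -(law i)//; exact: measurable_scale_preimage.
move=> i _; rewrite /generated_by_var /preimage_set_system /=.
exists [set z | nth setT As i (c * z)%R]; last by rewrite setTI.
by apply: measurable_scale_preimage; exact: all_measurable_nth.
Qed.

Lemma generated_by_process_cylinder (c : R) (a : nat -> Omega -> R) (As : seq (set R)) :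
  all_measurable As ->
  generated_by_process [set: nat] a (cylinder As (fun k w => c * waiting_time a k w)%R).
Proof.
move=> mAs.
(* With this sigma-algebra on the sample space, membership of the cylinder is its measurability. *)
pose S := g_sigma_algebraType (\bigcup_(i in [set: nat]) generated_by_var (a i)).
have ma k : measurable_fun setT (a k : S -> R).
  move=> _ B mB; rewrite setTI; apply: sub_sigma_algebra; exists k => //.
  by exists B => //; rewrite setTI.
apply: (@measurable_cylinder R _ S As) => // k.
apply: measurable_funM; first exact: measurable_cst.
by case: k => [|k]; [exact: ma|apply: measurable_funB; exact: ma].
Qed.

Lemma poisson_on_arrival_times (theta1 theta2 c : R) (a b : nat -> Omega -> R)
    (G : set (set Omega)) :
  (0 < theta1)%R -> (0 < theta2)%R -> (0 < c)%R ->
  poisson_arrival_times P (theta1 / c) a -> poisson_arrival_times P (theta2 / c) b ->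
  mutually_independent P (fun i : 'I_3 => nth set0
    [:: generated_by_process [set: nat] a; generated_by_process [set: nat] b; G] i) ->
  poisson_on P theta1^-1 theta2^-1 setT (fun k w => c * waiting_time a k w)%R
    (fun k w => c * waiting_time b k w)%R.
Proof.
move=> th1 th2 c0 ha hb ind.
have mw (x : nat -> Omega -> R) : (forall k, measurable_fun setT (x k)) ->
    forall k, measurable_fun setT (fun w => c * waiting_time x k w)%R.
  move=> mx k; apply: measurable_funM; first exact: measurable_cst.
  by case: k => [|k]; [exact: mx|apply: measurable_funB; exact: mx].
split => //.
- by apply: mw; have [] := ha.
- by apply: mw; have [] := hb.
move=> As Bs mAs mBs; rewrite setTI probability_setT mul1e.
rewrite -(prob_poisson_cylinder th1 c0 ha mAs) -(prob_poisson_cylinder th2 c0 hb mBs).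
set CA := cylinder As _; set CB := cylinder Bs _.
pose E (i : 'I_3) := if i == ord0 then CA else CB.
pose i1 : 'I_3 := @Ordinal 3 1 isT.
have := mutually_independent_seq (E := E) (r := [:: ord0; i1]) ind isT.
rewrite big_cons big_seq1 /E /= => <-.
  congr (P _); apply/seteqP; split => w /=.
    by move=> [hA hB] i; rewrite /= !inE => /orP[/eqP->|/eqP->].
  move=> h; split; first by have := h ord0; apply; rewrite /= !inE.
  by have := h i1; apply; rewrite /= !inE.
move=> i; rewrite !inE => /orP[/eqP->|/eqP->] /=; exact: generated_by_process_cylinder.
Qed.

End PoissonData.

Section InProbability.
Context (R : realType) d (Omega : measurableType d) (P : probability Omega R).

(** Measurability of the deviation events allows comparison with the exceptional sets. The shift
    leaves out [n = 0], for which [theta / n] is no mean waiting time. *)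
Lemma cvg_whp_in_probability (Z : nat -> Omega -> R) (c : R) :
  (forall n, measurable_fun setT (Z n.+1)) -> cvg_whp P (fun n => Z n.+1) c ->
  cvg_in_probability P Z c.
Proof.
move=> mZ hZ eps eps0.
have mA n : measurable [set w | eps <= `|Z n.+1 w - c|].
  by apply: measurable_le_norm; apply: measurable_funB.
apply/fine_cvgP; split; first by exists 1%N => // -[//|n] _; exact: fin_num_measure.
apply/cvgrPdist_le => delta delta0; have [n0 h] := hZ _ eps0 _ delta0.
exists n0.+1 => // -[//|n] /= n0n; have [B [mB PB hB]] := h _ n0n.
rewrite sub0r normrN ger0_norm; last by rewrite fine_ge0.
rewrite -lee_fin fineK; last exact: fin_num_measure.
apply: le_trans PB; apply: le_measure; rewrite ?inE//.
move=> w /= wA; apply: contrapT => /hB /=.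
by rewrite ltNge wA.
Qed.

Lemma res_seq0 (a b : nat -> Omega -> R) (c : R) :
  res_seq (fun k w => c * a k w) (fun k w => c * b k w) 0 =
  fun k w => c * waiting_time a k w.
Proof.
apply/funext => -[|k]; apply/funext => w; rewrite /res_seq /resid /=.
  by rewrite subr0.
by rewrite !add0n -mulrBr.
Qed.

End InProbability.

(** * Closed forms of the limits *)

Section Constants.
Context (R : realType).
Variables (theta1 theta2 : R) (th1 : 0 < theta1) (th2 : 0 < theta2).
Let la := theta1^-1.
Let mu := theta2^-1.

Let sum_neq0 : theta1 + theta2 != 0.
Proof. by rewrite gt_eqF// addr_gt0. Qed.

Let quad_neq0 : theta1 ^+ 2 + theta1 * theta2 + theta2 ^+ 2 != 0.
Proof. by rewrite gt_eqF// !addr_gt0 ?mulr_gt0 ?exprn_gt0. Qed.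

Let swap_sum : mu + la = la + mu. Proof. exact: addrC. Qed.

Let rate_la : la / (la + mu) = theta2 / (theta1 + theta2).
Proof. by rewrite /la /mu; field; rewrite ?gt_eqF//= ?addr_gt0. Qed.

Let rate_mu : mu / (la + mu) = theta1 / (theta1 + theta2).
Proof. by rewrite /la /mu; field; rewrite ?gt_eqF//= ?addr_gt0. Qed.

Let rate_sum : (la + mu)^-1 = theta1 * theta2 / (theta1 + theta2).
Proof. by rewrite /la /mu; field; rewrite ?gt_eqF//= ?addr_gt0. Qed.

Let mean_la_mu j : mean_last_wait la mu j =
  j`!%:R * (theta2 ^+ j - theta1 / (theta1 + theta2) *
            (theta1 * theta2 / (theta1 + theta2)) ^+ j).
Proof.
by rewrite /mean_last_wait -rate_mu -rate_sum exprVn /mu exprVn invrK; ring.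
Qed.

Let mean_mu_la j : mean_last_wait mu la j =
  j`!%:R * (theta1 ^+ j - theta2 / (theta1 + theta2) *
            (theta1 * theta2 / (theta1 + theta2)) ^+ j).
Proof.
by rewrite /mean_last_wait swap_sum -rate_la -rate_sum exprVn /la exprVn invrK; ring.
Qed.

Let mean_blockTE : mean_block la mu =
  (theta1 ^+ 2 + theta1 * theta2 + theta2 ^+ 2) / (theta1 + theta2).
Proof.
by rewrite /mean_block mean_la_mu mean_mu_la (_ : 1`!%N = 1%N)//; field.
Qed.

(** The denominator in the limit of G is a disguised perfect square, that of [mean_block] times
    [theta1 + theta2]. *)
Let den_G : theta1 ^+ 2 * theta2 ^+ 2 +
  (theta1 ^+ 2 + theta2 ^+ 2) * (theta1 + theta2) ^+ 2 =
  (theta1 ^+ 2 + theta1 * theta2 + theta2 ^+ 2) ^+ 2.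
Proof. by ring. Qed.

(** The left side is the mean of a maximum as the sum of the two means minus the mean of the
    minimum; it equals [mean_block]. *)
Let den_FH : theta1 + theta2 - theta1 * theta2 / (theta1 + theta2) =
  (theta1 ^+ 2 + theta1 * theta2 + theta2 ^+ 2) / (theta1 + theta2).
Proof. by field. Qed.

Lemma constant_G :
  (mean_last_wait la mu 2 + mean_last_wait mu la 2) / mean_block la mu ^+ 2 =
  2 * (1 - 2 * theta1 ^+ 2 * theta2 ^+ 2 /
                  (theta1 ^+ 2 * theta2 ^+ 2
                   + (theta1 ^+ 2 + theta2 ^+ 2) * (theta1 + theta2) ^+ 2)).
Proof.
rewrite den_G mean_blockTE mean_la_mu mean_mu_la (_ : 2`!%N = 2%N)//.
by field; rewrite sum_neq0 quad_neq0.
Qed.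

Let rate_la2 : la / (la + mu) ^+ 2 =
  theta2 / (theta1 + theta2) * (theta1 * theta2 / (theta1 + theta2)).
Proof. by rewrite -rate_la -rate_sum expr2 invfM mulrA. Qed.

Let rate_mu2 : mu / (la + mu) ^+ 2 =
  theta1 / (theta1 + theta2) * (theta1 * theta2 / (theta1 + theta2)).
Proof. by rewrite -rate_mu -rate_sum expr2 invfM mulrA. Qed.

Lemma constant_H :
  (la / (la + mu) ^+ 2 * la^-1 + mu / (mu + la) ^+ 2 * mu^-1) / mean_block la mu ^+ 2 =
  2 * (((theta1 + theta2 - theta1 * theta2 / (theta1 + theta2)) ^+ 2)^-1
              * (theta1 ^+ 2 * theta2 ^+ 2 / (theta1 + theta2) ^+ 2)).
Proof.
rewrite swap_sum rate_la2 rate_mu2 mean_blockTE den_FH /la /mu !invrK.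
by field; rewrite sum_neq0 quad_neq0.
Qed.

Lemma constant_F :
  (mean_last_wait la mu 1 * la^-1 +
     mu / (mu + la) ^+ 2 * (la / (la + mu)) * la^-1 +
     (la / (la + mu) ^+ 2 * mean_last_wait la mu 1 +
      la / (la + mu) ^+ 2 * mean_last_wait mu la 1) +
    (mean_last_wait mu la 1 * mu^-1 +
     la / (la + mu) ^+ 2 * (mu / (mu + la)) * mu^-1 +
     (mu / (mu + la) ^+ 2 * mean_last_wait mu la 1 +
      mu / (mu + la) ^+ 2 * mean_last_wait la mu 1))) / mean_block la mu ^+ 2 =
  2 * theta1 * theta2 / (theta1 ^+ 2 + theta1 * theta2 + theta2 ^+ 2)
          + 4 * theta1 ^+ 2 * theta2 ^+ 2 /
            ((theta1 + theta2 - theta1 * theta2 / (theta1 + theta2)) ^+ 2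
             * (theta1 + theta2) ^+ 2).
Proof.
rewrite swap_sum rate_la2 rate_mu2 rate_la rate_mu mean_la_mu mean_mu_la mean_blockTE.
rewrite den_FH /la /mu !invrK (_ : 1`!%N = 1%N)//.
by field; rewrite sum_neq0 quad_neq0.
Qed.

End Constants.

Theorem proposition5p1 (R : realType) (d : measure_display)
    (Omega : measurableType d) (P : probability Omega R) (T theta1 theta2 : R)
    (Fi : R -> set (set Omega)) (X Y : R -> Omega -> R)
    (t tau : nat -> nat -> Omega -> R)
    (T_gt0 : 0 < T) (theta1_gt0 : 0 < theta1) (theta2_gt0 : 0 < theta2)
    (Fi_filtration : filtration T Fi)
    (X_semimartingale : continuous_semimartingale P T Fi X)
    (Y_semimartingale : continuous_semimartingale P T Fi Y)
    (t_poisson : forall n, (0 < n)%N ->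
       poisson_arrival_times P (theta1 / n%:R) (t n))
    (tau_poisson : forall n, (0 < n)%N ->
       poisson_arrival_times P (theta2 / n%:R) (tau n))
    (independence : forall n, (0 < n)%N ->
       mutually_independent P (fun i : 'I_3 => nth set0
         [:: generated_by_process [set: nat] (t n);
             generated_by_process [set: nat] (tau n);
             <<s generated_by_process `[0, T] X
                 `|` generated_by_process `[0, T] Y >>] i))
    (s : R) (s_0T : 0 <= s <= T) :
  let G n w := qvar_G (t n ^~ w) (tau n ^~ w) T s in
  let F n w := qvar_F (t n ^~ w) (tau n ^~ w) T s in
  let H n w := qvar_H (t n ^~ w) (tau n ^~ w) T s in
  [/\ cvg_in_probability P G
        (2 * (1 - 2 * theta1 ^+ 2 * theta2 ^+ 2 /
                  (theta1 ^+ 2 * theta2 ^+ 2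
                   + (theta1 ^+ 2 + theta2 ^+ 2) * (theta1 + theta2) ^+ 2))
         * s),
      cvg_in_probability P F
        ((2 * theta1 * theta2 /
            (theta1 ^+ 2 + theta1 * theta2 + theta2 ^+ 2)
          + 4 * theta1 ^+ 2 * theta2 ^+ 2 /
            ((theta1 + theta2 - theta1 * theta2 / (theta1 + theta2)) ^+ 2
             * (theta1 + theta2) ^+ 2))
         * s),
      cvg_in_probability P H
        (2 * (((theta1 + theta2 - theta1 * theta2 / (theta1 + theta2)) ^+ 2)^-1
              * (theta1 ^+ 2 * theta2 ^+ 2 / (theta1 + theta2) ^+ 2))
         * s)
    & theta1 = theta2 ->
      [/\ cvg_in_probability P G (14 / 9 * s),
          cvg_in_probability P F (10 / 9 * s)
        & cvg_in_probability P H (2 / 9 * s)]].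
Proof.
move=> G F H.
(* The index is shifted to start where the Poisson hypotheses do; the scaled rates are [theta1^-1]
   and [theta2^-1] for every [n]. *)
pose tt n k w := n.+1%:R * t n.+1 k w.
pose tautt n k w := n.+1%:R * tau n.+1 k w.
have N0 n : 0 < n.+1%:R :> R by [].
have mt n k : measurable_fun setT (t n.+1 k) by have [] := t_poisson n.+1 isT.
have mtau n k : measurable_fun setT (tau n.+1 k) by have [] := tau_poisson n.+1 isT.
have mtt n k : measurable_fun setT (tt n k) by exact: measurable_funM.
have mtautt n k : measurable_fun setT (tautt n k) by exact: measurable_funM.
have la0 : 0 < theta1^-1 by rewrite invr_gt0.
have mu0 : 0 < theta2^-1 by rewrite invr_gt0.
have h0 n : poisson_on P theta1^-1 theta2^-1 setT
    (res_seq (tt n) (tautt n) 0) (res_seq (tautt n) (tt n) 0).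
  rewrite !res_seq0.
  exact: (poisson_on_arrival_times theta1_gt0 theta2_gt0 (N0 n)
    (t_poisson n.+1 isT) (tau_poisson n.+1 isT) (independence n.+1 isT)).
have cG : cvg_in_probability P G
    (2 * (1 - 2 * theta1 ^+ 2 * theta2 ^+ 2 /
                  (theta1 ^+ 2 * theta2 ^+ 2
                   + (theta1 ^+ 2 + theta2 ^+ 2) * (theta1 + theta2) ^+ 2)) * s).
  apply: cvg_whp_in_probability => [n|]; first exact: measurable_qvar_G.
  rewrite -constant_G// (_ : (fun n => G n.+1) = fun n w =>
    qvar_G (tt n ^~ w) (tautt n ^~ w) (n.+1%:R * T) (n.+1%:R * s) / n.+1%:R).
    exact: cvg_whp_G.
  by apply/funext => n; apply/funext => w; rewrite /tt /tautt qvar_G_scale.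
have cF : cvg_in_probability P F
    ((2 * theta1 * theta2 / (theta1 ^+ 2 + theta1 * theta2 + theta2 ^+ 2)
      + 4 * theta1 ^+ 2 * theta2 ^+ 2 /
        ((theta1 + theta2 - theta1 * theta2 / (theta1 + theta2)) ^+ 2
         * (theta1 + theta2) ^+ 2)) * s).
  apply: cvg_whp_in_probability => [n|]; first exact: measurable_qvar_F.
  rewrite -constant_F// (_ : (fun n => F n.+1) = fun n w =>
    qvar_F (tt n ^~ w) (tautt n ^~ w) (n.+1%:R * T) (n.+1%:R * s) / n.+1%:R).
    exact: cvg_whp_F.
  by apply/funext => n; apply/funext => w; rewrite /tt /tautt qvar_F_scale.
have cH : cvg_in_probability P H
    (2 * (((theta1 + theta2 - theta1 * theta2 / (theta1 + theta2)) ^+ 2)^-1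
          * (theta1 ^+ 2 * theta2 ^+ 2 / (theta1 + theta2) ^+ 2)) * s).
  apply: cvg_whp_in_probability => [n|]; first exact: measurable_qvar_H.
  rewrite -constant_H// (_ : (fun n => H n.+1) = fun n w =>
    qvar_H (tt n ^~ w) (tautt n ^~ w) (n.+1%:R * T) (n.+1%:R * s) / n.+1%:R).
    exact: cvg_whp_H.
  by apply/funext => n; apply/funext => w; rewrite /tt /tautt qvar_H_scale.
split => // th12.
have th0 : theta2 != 0 by rewrite gt_eqF.
move: cG cF cH; rewrite th12 => cG cF cH; split.
- rewrite (_ : 14 / 9 = 2 * (1 - 2 * theta2 ^+ 2 * theta2 ^+ 2 /
    (theta2 ^+ 2 * theta2 ^+ 2
     + (theta2 ^+ 2 + theta2 ^+ 2) * (theta2 + theta2) ^+ 2)))//.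
  (* Once the denominator is a monomial, [theta2 != 0] is all that [field] requires. *)
  rewrite (_ : _ + _ = 9 * theta2 ^+ 4); last by ring.
  by field.
- rewrite (_ : 10 / 9 = 2 * theta2 * theta2 /
      (theta2 ^+ 2 + theta2 * theta2 + theta2 ^+ 2)
    + 4 * theta2 ^+ 2 * theta2 ^+ 2 /
      ((theta2 + theta2 - theta2 * theta2 / (theta2 + theta2)) ^+ 2
       * (theta2 + theta2) ^+ 2))//.
  rewrite (_ : theta2 ^+ 2 + theta2 * theta2 + theta2 ^+ 2 = 3 * theta2 ^+ 2); last by ring.
  rewrite (_ : theta2 + theta2 = 2 * theta2); last by ring.
  rewrite (_ : 2 * theta2 - _ = 3 / 2 * theta2); last by field.
  by field.
- rewrite (_ : 2 / 9 = 2 * (((theta2 + theta2 - theta2 * theta2 / (theta2 + theta2)) ^+ 2)^-1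
      * (theta2 ^+ 2 * theta2 ^+ 2 / (theta2 + theta2) ^+ 2)))//.
  rewrite (_ : theta2 + theta2 = 2 * theta2); last by ring.
  rewrite (_ : 2 * theta2 - _ = 3 / 2 * theta2); last by field.
  by field.
Qed.
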